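(* Let $d\ge1$ be an integer, $m\ge1$ and $\beta>0$ real, and let $Y$ be a complex Banach space. The set $V$ of functions of the form $$h(z)=\sum_{l=1}^{n}K_{m,\beta}(z,a_l)c_l,\qquad a_l\in\mathbb{C}^d,\ c_l\in Y,\ n \text{ a positive integer},$$ is dense in $F$ whenever $F\in\{F^{p}_{m,\beta}(Y),\,F^{\infty,0}_{m,\beta}(Y)\}$, $1\le p<\infty$.
   Context: For real $m\ge 1$ and $\beta>0$, $d\mu_{m,\beta}(\zeta)=c_{m,\beta}e^{-\beta|\zeta|^{2m}}dv(\zeta)$ is a probability measure on $\mathbb{C}^d$, where $dv$ is Lebesgue measure and $c_{m,\beta}=\frac{m\beta^{d/m}}{\pi^d}\frac{\Gamma(d)}{\Gamma(d/m)}$. $F^p_{m,\beta}(Y)$ is the space of $Y$-valued entire functions $f$ on $\mathbb{C}^d$ with $\|f\|^p_{F^p_{m,\beta}(Y)}=c_{m,\beta}\int_{\mathbb{C}^d}\|f(\zeta)e^{-\frac{\beta}{2}|\zeta|^{2m}}\|_Y^p\,dv(\zeta)<\infty$ if $1\le p<\infty$. $F^{\infty,0}_{m,\beta}(Y)$ is the space of $Y$-valued entire functions $f$ on $\mathbb{C}^d$ with $\lim_{|\zeta|\to\infty}\|f(\zeta)\|_Ye^{-\frac{\beta}{2}|\zeta|^{2m}}=0$, with norm $\sup_{\zeta}\|f(\zeta)\|_Ye^{-\frac{\beta}{2}|\zeta|^{2m}}$. $K_{m,\beta}$ denotes the reproducing kernel of the Hilbert space $F^2_{m,\beta}$ of scalar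 entire functions on $\mathbb{C}^d$ that lie in $L^2(d\mu_{m,\beta})$. *)

(* Defs.v *)
From HB Require Import structures.
From mathcomp Require Import all_boot all_order all_algebra.
From mathcomp Require Import complex.
From mathcomp Require Import all_classical all_reals all_analysis.

Set Implicit Arguments.
Unset Strict Implicit.
Unset Printing Implicit Defensive.

Import Order.TTheory GRing.Theory Num.Theory.
Import numFieldNormedType.Exports.

Local Open Scope classical_set_scope.
Local Open Scope ring_scope.
Local Open Scope complex_scope.

(* The library's sigma-finite structure on [m1 \x m2] is only inferred when [m1]
   and [m2] are the projections of a pair of subprobabilities, so the property
   is restated here. *)
Lemma sigma_finite_prod d1 d2 (T1 : measurableType d1) (T2 : measurableType d2)
    (R : realType) (m1 : {sigma_finite_measure set T1 -> \bar R})
    (m2 : {sigma_finite_measure set T2 -> \bar R}) :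
  sigma_finite [set: (T1 * T2)%type] (m1 \x m2)%E.
Proof.
have /sigma_finiteP[F [TF ndF Foo]] := sigma_finiteT m1.
have /sigma_finiteP[G [TG ndG Goo]] := sigma_finiteT m2.
exists (fun n => F n `*` G n).
  rewrite -setXTT TF TG predeqE => -[x y]; split.
    move=> [/= [n _ Fnx] [k _ Gky]]; exists (maxn n k) => //; split.
    - by move: x Fnx; exact/subsetPset/ndF/leq_maxl.
    - by move: y Gky; exact/subsetPset/ndG/leq_maxr.
  by move=> [n _ []/= ? ?]; split; exists n.
move=> k; have [? ?] := Foo k; have [? ?] := Goo k.
split; first exact: measurableX.
by rewrite product_measure1E// lte_mul_pinfty// ge0_fin_numE.
Qed.

Section TupleMeasure.
Context (disp : measure_display) (T : measurableType disp) (R : realType).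

Definition tuple_cons (n : nat) (x : T * n.-tuple T) : n.+1.-tuple T :=
  [tuple of x.1 :: x.2].

Lemma measurable_tuple_cons (n : nat) :
  measurable_fun [set: (T * n.-tuple T)%type] (@tuple_cons n).
Proof.
by apply: measurable_cons; [exact: measurable_fst|exact: measurable_snd].
Qed.

Section Step.
Variables (n : nat) (mu : {sigma_finite_measure set T -> \bar R}).
Variable (nu : {sigma_finite_measure set (n.-tuple T) -> \bar R}).

Definition tuple_consm : set (n.+1.-tuple T) -> \bar R :=
  pushforward (mu \x nu)%E (@tuple_cons n).

HB.instance Definition _ := Measure.copy tuple_consm
  (measure_function_pushforward__canonical__measure_function_Measure
     (mu \x nu)%E (@measurable_tuple_cons n)).

Let tuple_consm_sigma_finite : sigma_finite [set: n.+1.-tuple T] tuple_consm.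
Proof.
have [F FT Foo] := sigma_finite_prod mu nu.
pose uncons (t : n.+1.-tuple T) := (thead t, [tuple of behead t]).
have consK : cancel (@tuple_cons n) uncons.
  move=> [x t]; rewrite /uncons /tuple_cons /=; congr (_, _).
  exact: val_inj.
have munc : measurable_fun [set: n.+1.-tuple T] uncons.
  apply: measurable_fun_pair; first exact: measurable_tnth.
  exact: measurable_behead.
exists (fun k => uncons @^-1` F k).
  by rewrite -preimage_bigcup -FT preimage_setT.
move=> k; have [mF Fk] := Foo k; split.
  by rewrite -[X in measurable X]setTI; exact: munc.
rewrite /tuple_consm /pushforward (_ : _ @^-1` _ = F k)//.
by apply/seteqP; split=> x /=; rewrite consK.
Qed.

HB.instance Definition _ :=
  Measure_isSigmaFinite.Build _ _ _ tuple_consm tuple_consm_sigma_finite.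

End Step.

(* The [n]-fold product measure [mu \x ... \x mu]. *)
Fixpoint tuple_measure (mu : {sigma_finite_measure set T -> \bar R}) (n : nat) :
    {sigma_finite_measure set (n.-tuple T) -> \bar R} :=
  match n with
  | 0 => @dirac _ _ [tuple] R
  | k.+1 => tuple_consm mu (tuple_measure mu k)
  end.

End TupleMeasure.

Section LebesgueCn.
Context {R : realType}.

Definition plane_lebesgue :
    set (measurableTypeR R * measurableTypeR R)%type -> \bar R :=
  (@lebesgue_measure R \x @lebesgue_measure R)%E.

HB.instance Definition _ := Measure.on plane_lebesgue.

HB.instance Definition _ := Measure_isSigmaFinite.Build _ _ _ plane_lebesgue
  (sigma_finite_prod (@lebesgue_measure R) (@lebesgue_measure R)).

(* Lebesgue measure on [C^d], carried by [(R x R)^d]; [cvec] is the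
   identification of [(R x R)^d] with [C^d]. *)
Definition lebesgueC (d : nat) := tuple_measure plane_lebesgue d.

Definition cvec (d : nat)
    (t : d.-tuple (measurableTypeR R * measurableTypeR R)) : 'rV[R[i]]_d :=
  \row_j ((tnth t j).1 +i* (tnth t j).2).

Definition integralC (d : nat) (g : 'rV[R[i]]_d -> \bar R) : \bar R :=
  (\int[lebesgueC d]_t g (cvec t))%E.

Definition cintegralC (d : nat) (g : 'rV[R[i]]_d -> R[i]) : R[i] :=
  fine (integralC (fun z => (complex.Re (g z))%:E)) +i*
  fine (integralC (fun z => (complex.Im (g z))%:E)).

End LebesgueCn.

Section FockSpaces.
Context {R : realType}.

(* Norms over [R[i]] take values in [R[i]]; [rnorm] is the same norm with values
   in [R]. *)
Definition rnorm {V : normedZmodType R[i]} (v : V) : R := complex.Re `|v|.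

(* The norm of the library on ['rV[R[i]]_d] is the sup norm. *)
Definition enorm {d : nat} (z : 'rV[R[i]]_d) : R :=
  Num.sqrt (\sum_(j < d) rnorm (z ord0 j) ^+ 2).

Definition Gamma (s : R) : R :=
  \int[lebesgue_measure]_(t in `]0, +oo[) (t `^ (s - 1) * expR (- t)).

Definition fock_const (d : nat) (m beta : R) : R :=
  m * beta `^ (d%:R / m) / pi ^+ d * (Gamma d%:R / Gamma (d%:R / m)).

Definition entire {d : nat} {Y : normedModType R[i]} (f : 'rV[R[i]]_d -> Y) :=
  forall z, differentiable f z.

Section Weighted.
Context {d : nat} {Y : normedModType R[i]}.
Variables (m beta : R).
Implicit Type f : 'rV[R[i]]_d -> Y.

Definition weighted_norm f (z : 'rV[R[i]]_d) : R :=
  rnorm (f z) * expR (- (beta / 2) * enorm z `^ (2 * m)).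

Definition fock_normp (p : R) f : \bar R :=
  ((fock_const d m beta)%:E *
    integralC (fun z => (weighted_norm f z `^ p)%:E))%E.

Definition fock_norm (p : R) f : \bar R := (fock_normp p f `^ p^-1)%E.

Definition fock_space (p : R) : set ('rV[R[i]]_d -> Y) :=
  [set f | entire f /\ (fock_normp p f < +oo)%E].

Definition fock_norm_infty f : \bar R :=
  ereal_sup [set (weighted_norm f z)%:E | z in [set: 'rV[R[i]]_d]].

Definition fock_space_infty0 : set ('rV[R[i]]_d -> Y) :=
  [set f | entire f /\
    forall eps : R, 0 < eps -> exists M : R,
      forall z, M < enorm z -> weighted_norm f z < eps].

End Weighted.

(* [dmu_{m,beta}] has density [fock_density] with respect to Lebesgue measure. *)
Definition fock_density {d : nat} (m beta : R) (z : 'rV[R[i]]_d) : R :=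
  fock_const d m beta * expR (- beta * enorm z `^ (2 * m)).

Definition fock_hilbert (d : nat) (m beta : R) : set ('rV[R[i]]_d -> R[i]) :=
  [set f | entire (f : 'rV[R[i]]_d -> R[i]^o) /\
    (integralC (fun z => (rnorm (f z) ^+ 2 * fock_density m beta z)%:E)
      < +oo)%E].

Definition fock_inner (d : nat) (m beta : R) (f g : 'rV[R[i]]_d -> R[i]) : R[i] :=
  cintegralC (fun z => f z * (g z)^* * (fock_density m beta z)%:C).

Definition reproducing_kernel (d : nat) (m beta : R)
    (K : 'rV[R[i]]_d -> 'rV[R[i]]_d -> R[i]) :=
  forall a, fock_hilbert m beta (K ^~ a) /\
    forall f, fock_hilbert m beta f -> f a = fock_inner m beta f (K ^~ a).

Definition kernel_span (d : nat) (Y : normedModType R[i])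
    (K : 'rV[R[i]]_d -> 'rV[R[i]]_d -> R[i]) : set ('rV[R[i]]_d -> Y) :=
  [set h | exists (n : nat) (a : 'I_n -> 'rV[R[i]]_d) (c : 'I_n -> Y),
    (0 < n)%N /\ h = (fun z => \sum_(l < n) K z (a l) *: c l)].

Definition dense_for (d : nat) (Y : normedModType R[i])
    (N : ('rV[R[i]]_d -> Y) -> \bar R) (F V : set ('rV[R[i]]_d -> Y)) :=
  V `<=` F /\
  forall f, F f -> forall eps : R, 0 < eps ->
    exists h, V h /\ (N (f \- h)%R < eps%:E)%E.

End FockSpaces.

(* Main.v *)
(* Write [N z = beta / 2 |z|^(2m)], and say that [f] is subcritical when
   [||f z|| <= C e^(sigma N z)] with [sigma < 1].  Elements of the Fock spaces
   satisfy this with any [sigma > 1], by the mean value property, so that their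
   dilates [f (r z)], [r < 1], are subcritical, and these dilates converge to [f].

   Unitary invariance and uniqueness of the kernel give
   [K (t z, a) = K (z, t a)] for [|t| = 1], hence for [0 < t < 1] by analytic
   continuation; dilating the crude bound on [K] then yields
   [|K (z, a)| <= C e^(N z / tau + tau^3 N a)] for every [tau > 1].  For a
   subcritical [g] the reproducing formula, which holds after composition with a
   norming functional, reads [g z = int K (z, w) g(w) dmu(w)] with an integrand
   decaying exponentially in [N w].  The Riemann sums of this integral lie in [V];
   they converge to [g] pointwise and are uniformly subcritical, which implies
   convergence in all the norms. *)

(* The kernel is given only by its reproducing property, so bounds on it start from
   [K a a = ||K_a||^2]. The bound obtained this way grows like [e^(tau (N z + N a))], too fast in
   [z] for the kernel functions to be visibly subcritical. The dilation symmetry unbalances the two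
   exponents: the growth in [z] falls below the critical rate and the loss goes to the other
   variable, where the density [e^(- 2 N w)] pays for it. Integrability then requires
   [tau^3 + sigma < 2], up to a further factor [tau], and this can be arranged with [tau > 1]
   precisely because [sigma < 1]; hence the detour through dilates.

   [Y]-valued integrals never occur: a functional norming the error vector turns every identity into
   one between scalar Lebesgue integrals. Several complex variables are reduced to one by
   restriction to complex lines.

   In [F^p] the dilates of [f] come with no evident common integrable majorant, but the integrals of
   their weighted powers exceed that of [f] by at most a factor tending to 1, which is what a
   Scheffe argument needs. *)
Require Import Defs.
From HB Require Import structures.
From mathcomp Require Import all_boot all_order all_algebra.
From mathcomp Require Import complex.
From mathcomp Require Import all_classical all_reals all_analysis measurable_realfun.
From mathcomp Require Import ring lra.

Set Implicit Arguments.
Unset Strict Implicit.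
Unset Printing Implicit Defensive.

Import Order.TTheory GRing.Theory Num.Theory.
Import numFieldNormedType.Exports.
Local Open Scope classical_set_scope.
Local Open Scope ring_scope.
Local Open Scope complex_scope.

(** * Norming functionals *)

Section Rnorm.
Context {R : realType} {V : normedModType R[i]}.
Implicit Types (x y : V) (c : R[i]).

Lemma rnormE (W : normedZmodType R[i]) (x : W) : `|x| = (rnorm x)%:C.
Proof.
have := ger0_Im (normr_ge0 x); rewrite /rnorm.
by case: `|x| => a b /= ->.
Qed.

Lemma rnorm_ge0 (W : normedZmodType R[i]) (x : W) : 0 <= rnorm x.
Proof. by have := normr_ge0 x; rewrite rnormE lecR. Qed.

Lemma rnormD (W : normedZmodType R[i]) (x y : W) : rnorm (x + y) <= rnorm x + rnorm y.
Proof. by have := ler_normD x y; rewrite !rnormE -rmorphD lecR. Qed.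

Lemma rnormN (W : normedZmodType R[i]) (x : W) : rnorm (- x) = rnorm x.
Proof. by rewrite /rnorm normrN. Qed.

Lemma rnormZ c x : rnorm (c *: x) = rnorm c * rnorm x.
Proof.
by apply: (@complexI R); rewrite -rnormE normrZ !rnormE -rmorphM.
Qed.

Lemma rnormM (c e : R[i]) : rnorm (c * e) = rnorm c * rnorm e.
Proof.
by apply: (@complexI R); rewrite -rnormE normrM !rnormE -rmorphM.
Qed.

Lemma rnorm0 (W : normedZmodType R[i]) : rnorm (0 : W) = 0.
Proof. by rewrite /rnorm normr0. Qed.

Lemma rnorm0_eq0 (W : normedZmodType R[i]) (x : W) : rnorm x = 0 -> x = 0.
Proof. by move=> x0; apply/normr0_eq0; rewrite rnormE x0. Qed.

Lemma rnormC (r : R) : rnorm (r%:C : R[i]) = `|r|.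
Proof. by rewrite /rnorm normc_def /= expr0n addr0 sqrtr_sqr. Qed.

Lemma rnorm_sqr (c : R[i]) : rnorm c ^+ 2 = complex.Re c ^+ 2 + complex.Im c ^+ 2.
Proof. by rewrite /rnorm normc_def /= sqr_sqrtr // addr_ge0 ?sqr_ge0. Qed.

Lemma Re_le_rnorm (c : R[i]) : `|complex.Re c| <= rnorm c.
Proof.
by rewrite -(@ler_sqr _ _ _) ?nnegrE ?rnorm_ge0// real_normK ?num_real// rnorm_sqr lerDl sqr_ge0.
Qed.

Lemma Im_le_rnorm (c : R[i]) : `|complex.Im c| <= rnorm c.
Proof.
by rewrite -(@ler_sqr _ _ _) ?nnegrE ?rnorm_ge0// real_normK ?num_real// rnorm_sqr lerDr sqr_ge0.
Qed.

Lemma rnorm_conj (c : R[i]) : rnorm c^* = rnorm c.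
Proof. by case: c => a b; rewrite /rnorm !normc_def /= sqrrN. Qed.

End Rnorm.

Section HahnBanach.
Context {R : realType} {V : normedModType R[i]}.

Lemma realN1Z (v : V) : (- 1)%:C *: v = - v.
Proof. by rewrite (_ : (- 1)%:C = - 1) ?scaleN1r// -(rmorph1 (real_complex R)) -rmorphN. Qed.

(* Real-linear functionals on subspaces of [V] are handled as their graphs, which
   Zorn's lemma can order by inclusion. *)
Definition real_subspace (G : set (V * R)) :=
  [/\ G (0, 0),
      forall x y, G x -> G y -> G (x.1 + y.1, x.2 + y.2) &
      forall (t : R) x, G x -> G (t%:C *: x.1, t * x.2)].

Definition dominated_graph (G : set (V * R)) :=
  real_subspace G /\ forall x, G x -> x.2 <= rnorm x.1.

Let line (v : V) : set (V * R) :=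
  [set x | exists t : R, x = (t%:C *: v, t * rnorm v)].

Let line_dominated v : dominated_graph (line v).
Proof.
split; first split.
- by exists 0; rewrite rmorph0 scale0r mul0r.
- move=> x y [s ->] [t ->] /=; exists (s + t).
  by rewrite rmorphD scalerDl mulrDl.
- move=> t x [s ->] /=; exists (t * s).
  by rewrite scalerA -rmorphM mulrA.
move=> x [t ->] /=; rewrite rnormZ rnormC ler_wpM2r ?rnorm_ge0//.
exact: ler_norm.
Qed.

(** One vector is adjoined to the domain. Any [a] between the numbers [x.2 - ||x.1 - v||] and the
    numbers [||y.1 + v|| - y.2] works: domination of the sum of [x] and [y] separates the two
    families, and scaling by [1 / |s|] reduces [s] to [1] or [-1]. *)
Lemma hahn_banach_step (G : set (V * R)) (v : V) : dominated_graph G ->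
  exists a : R, forall x s, G x -> x.2 + s * a <= rnorm (x.1 + s%:C *: v).
Proof.
move=> [[G0 GD GZ] Gle].
pose E := [set x.2 - rnorm (x.1 - v) | x in G].
have key x y : G x -> G y -> x.2 - rnorm (x.1 - v) <= rnorm (y.1 + v) - y.2.
  move=> Gx Gy; rewrite lerBlDr addrAC lerBrDr.
  apply: (le_trans (Gle _ (GD _ _ Gx Gy))) => /=.
  by rewrite (le_trans _ (rnormD _ _))// addrACA subrr addr0 addrC.
have E0 : E !=set0 by exists (0 - rnorm (0 - v)), (0, 0).
have Eub y : G y -> ubound E (rnorm (y.1 + v) - y.2).
  by move=> Gy _ [x Gx <-]; exact: key.
have hubE : has_ubound E by exists (rnorm (0 + v) - 0); exact: (Eub (0, 0)).
exists (sup E) => x s Gx.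
have [s0|s0|->] := ltgtP s 0; last first.
- by rewrite mul0r rmorph0 scale0r !addr0; exact: Gle.
- have := ge_sup E0 (Eub _ (GZ s^-1 _ Gx)); rewrite /= => h.
  rewrite -lerBrDl -(ler_pM2l (x := s^-1)) ?invr_gt0// mulKf ?gt_eqF//.
  apply: (le_trans h); rewrite mulrBr lerD2r.
  rewrite -[X in _ <= X * _]gtr0_norm ?invr_gt0// -rnormC -rnormZ scalerDr.
  by rewrite scalerA -rmorphM mulVf ?gt_eqF// rmorph1 scale1r.
- have h := ub_le_sup hubE (imageP _ (GZ (- s)^-1 _ Gx)).
  have s0' : 0 < (- s)^-1 by rewrite invr_gt0 oppr_gt0.
  have wE : rnorm ((- s)^-1%:C *: x.1 - v) = (- s)^-1 * rnorm (x.1 + s%:C *: v).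
    rewrite -[X in _ = X * _](gtr0_norm s0') -rnormC -rnormZ scalerDr.
    rewrite scalerA -rmorphM invrN mulNr mulVf ?lt_eqF//.
    by rewrite realN1Z.
  rewrite -lerBrDl -(ler_pM2l s0') mulrA invrN mulNr mulVf ?lt_eqF//.
  by move: h; rewrite /= wE invrN; lra.
Qed.

Theorem hahn_banach (v : V) : exists u : V -> R,
  [/\ forall x y, u (x + y) = u x + u y, forall (t : R) x, u (t%:C *: x) = t * u x,
      forall x, `|u x| <= rnorm x & u v = rnorm v].
Proof.
pose P G := G = set0 \/ (dominated_graph G /\ line v `<=` G).
have [F FP Ftot|G [[G0|[domG lineG]] Gmax]] := @Zorn_bigcup _ P.
- have [F0|/existsNP[G1 /not_implyP[FG1 /eqP G10]]] := pselect (forall G, F G -> G = set0).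
    by left; apply/seteqP; split=> // x [G /F0 ->].
  right; have FdG G : F G -> G !=set0 -> dominated_graph G /\ line v `<=` G.
    by move=> /FP[->|//] [].
  have [[[G1z _ _] _] lG1] := FdG _ FG1 (proj1 (set0P _) G10).
  split; last by move=> x lx; exists G1 => //; exact: lG1.
  split; first split.
  + by exists G1.
  + move=> x y [A FA Ax] [B FB By].
    have [AB|BA] := Ftot _ _ FA FB.
      exists B => //; have [|[[_ + _] _] _] := FdG B FB; first by exists y.
      by apply=> //; exact: AB.
    exists A => //; have [|[[_ + _] _] _] := FdG A FA; first by exists x.
    by apply=> //; exact: BA.
  + move=> t x [A FA Ax]; exists A => //.
    by have [|[[_ _ h] _] _] := FdG A FA; [exists x|exact: h].
  + move=> x [A FA Ax].
    by have [|[_ h] _] := FdG A FA; [exists x|exact: h].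
- exfalso; apply: (Gmax (line v)); last by right; split.
  rewrite properEneq G0; split => //; apply/eqP => h.
  have : line v (0, 0) by exists 0; rewrite rmorph0 scale0r mul0r.
  by rewrite -h.
have total x : exists r, G (x, r).
  have [a ha] := hahn_banach_step x domG.
  have [[Gz GD GZ] Gle] := domG.
  pose B := [set y : V * R | exists z s, G z /\ y = (z.1 + s%:C *: x, z.2 + s * a)].
  have GB : G `<=` B.
    by move=> [y r] Gy; exists (y, r), 0; rewrite rmorph0 scale0r mul0r !addr0.
  have : ~ G `<` B.
    move=> GltB; apply: (Gmax B GltB); right; split; last exact: subset_trans GB.
    split; first split.
    + exact: GB.
    + move=> _ _ [y [s [Gy ->]]] [z [t [Gz' ->]]].
      exists (y.1 + z.1, y.2 + z.2), (s + t); split; first exact: GD.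
      by congr (_, _) => /=; rewrite addrACA ?rmorphD ?scalerDl ?mulrDl.
    + move=> t _ [y [s [Gy ->]]]; exists (t%:C *: y.1, t * y.2), (t * s).
      split; first exact: GZ.
      by rewrite /= scalerDr scalerA -rmorphM mulrDr mulrA.
    + by move=> _ [y [s [Gy ->]]] /=; exact: ha.
  rewrite properEneq => /not_andP[/negP|/(_ GB)//]; rewrite negbK => /eqP GeB.
  exists a; rewrite GeB; exists (0, 0), 1; split => //=.
  by rewrite !add0r scale1r mul1r.
have [u Gu] := choice total.
have [[Gz GD GZ] Gle] := domG.
(* Domination makes the graph single-valued: if [(x, a)] and [(x, b)] lie in [G], so does
   [(0, a - b)], whence [a - b <= 0]. *)
have Guniq x r s : G (x, r) -> G (x, s) -> r = s.
  have half a b : G (x, a) -> G (x, b) -> a <= b.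
    move=> Ga Gb; have := Gle _ (GD _ _ Ga (GZ (-1) _ Gb)).
    by rewrite /= realN1Z subrr rnorm0 mulN1r subr_le0.
  by move=> Gr Gs; apply/eqP; rewrite eq_le !half.
have uZ t x : u (t%:C *: x) = t * u x by exact: (Guniq _ _ _ (Gu _) (GZ t _ (Gu x))).
have ule x : u x <= rnorm x by exact: (Gle _ (Gu x)).
exists u; split => //.
- by move=> x y; exact: (Guniq _ _ _ (Gu _) (GD _ _ (Gu x) (Gu y))).
- move=> x; rewrite ler_norml ule andbT lerNl.
  have := ule ((-1)%:C *: x); rewrite uZ mulN1r => /le_trans; apply.
  by rewrite realN1Z rnormN.
- apply: (Guniq v); first exact: Gu.
  by apply: lineG; exists 1; rewrite scale1r mul1r.
Qed.

End HahnBanach.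

(** * Cauchy's theorem and the mean value property *)

Section Goursat.
Context {R : realType}.

(** Goursat's nested rectangles for an abstract additive rectangle function. When [J] is nonzero,
    some quarter keeps at least a fourth of its absolute value at each subdivision, exactly the rate
    at which the square of the half-perimeter shrinks; at the limit point this contradicts the local
    bound. *)
Lemma quadrisection (J : R -> R -> R -> R -> R) (a b c d : R) :
  a < b -> c < d ->
  (forall x x' y y', a <= x -> x < x' -> x' <= b -> c <= y -> y < y' -> y' <= d ->
    let s := (x + x') / 2 in let t := (y + y') / 2 in
    J x x' y y' = J x s y t + J s x' y t + J x s t y' + J s x' t y') ->
  (forall p q, a <= p <= b -> c <= q <= d -> forall e : R, 0 < e ->
    exists2 r : R, 0 < r & forall x x' y y', a <= x <= p -> p <= x' <= b ->
      c <= y <= q -> q <= y' <= d -> x < x' -> y < y' ->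
      x' - x < r -> y' - y < r ->
      `|J x x' y y'| <= e * ((x' - x) + (y' - y)) ^+ 2) ->
  J a b c d = 0.
Proof.
move=> ab cd Jadd Jloc; apply/eqP/negPn/negP => J0.
pose L := b - a; pose W := d - c.
have L0 : 0 < L by rewrite subr_gt0.
have W0 : 0 < W by rewrite subr_gt0.
(* Half of the initial ratio, so that the whole rectangle satisfies the strict inequality in
   [bad]. *)
pose e := `|J a b c d| / (2 * (L + W) ^+ 2).
have LW1 : 0 < L + W by exact: addr_gt0.
have LW0 : 0 < (L + W) ^+ 2 by rewrite exprn_gt0.
have e0 : 0 < e by apply: divr_gt0; [rewrite normr_gt0|exact: mulr_gt0].
pose h n : R := 2^-1 ^+ n.
have h0 n : 0 < h n by rewrite exprn_gt0// invr_gt0.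
have hS n : h n.+1 = h n / 2 by rewrite /h exprSr.
pose bad n (p : R * R) := [/\ a <= p.1, p.1 + L * h n <= b, c <= p.2,
   p.2 + W * h n <= d &
   e * ((L + W) * h n) ^+ 2 < `|J p.1 (p.1 + L * h n) p.2 (p.2 + W * h n)|].
have bad0 : bad 0%N (a, c).
  have -> : bad 0%N (a, c) = [/\ a <= a, a + L <= b, c <= c, c + W <= d &
      e * (L + W) ^+ 2 < `|J a (a + L) c (c + W)|] by rewrite /bad /h expr0 !mulr1.
  rewrite !subrKC; split => //.
  have -> : e * (L + W) ^+ 2 = `|J a b c d| / 2 by rewrite /e; field; lra.
  by rewrite ltr_pdivrMr// ltr_pMr ?normr_gt0// ltr1n.
(* [bad n p] stands under the existential so that choice yields a map on all pairs, which can be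
   iterated. *)
have step n (p : R * R) : exists q : R * R, bad n p ->
    [/\ bad n.+1 q, p.1 <= q.1, q.1 + L * h n.+1 <= p.1 + L * h n, p.2 <= q.2 &
        q.2 + W * h n.+1 <= p.2 + W * h n].
  have [badp|] := pselect (bad n p); last by exists p.
  have [p1 p1b p2 p2d Jp] := badp.
  have Lh : 0 < L * h n by rewrite mulr_gt0.
  have Wh : 0 < W * h n by rewrite mulr_gt0.
  have : exists q, [/\ e * ((L + W) * h n.+1) ^+ 2 <
       `|J q.1 (q.1 + L * h n.+1) q.2 (q.2 + W * h n.+1)|,
        p.1 <= q.1, q.1 + L * h n.+1 <= p.1 + L * h n, p.2 <= q.2 &
        q.2 + W * h n.+1 <= p.2 + W * h n].
    pose x1 := p.1 + L * h n.+1; pose y1 := p.2 + W * h n.+1.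
    apply: contrapT => /forallNP nq.
    have good x y : p.1 <= x -> x + L * h n.+1 <= p.1 + L * h n -> p.2 <= y ->
        y + W * h n.+1 <= p.2 + W * h n ->
        `|J x (x + L * h n.+1) y (y + W * h n.+1)| <= e * ((L + W) * h n.+1) ^+ 2.
      by move=> ? ? ? ?; rewrite leNgt; apply/negP => ?; apply: (nq (x, y)).
    have := Jadd p.1 (p.1 + L * h n) p.2 (p.2 + W * h n).
    have -> : (p.1 + (p.1 + L * h n)) / 2 = x1 by rewrite /x1 hS; field.
    have -> : (p.2 + (p.2 + W * h n)) / 2 = y1 by rewrite /y1 hS; field.
    have g1 : `|J p.1 x1 p.2 y1| <= e * ((L + W) * h n.+1) ^+ 2.
      by apply: good => //; rewrite hS; lra.
    have g2 : `|J x1 (p.1 + L * h n) p.2 y1| <= e * ((L + W) * h n.+1) ^+ 2.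
      have -> : p.1 + L * h n = x1 + L * h n.+1 by rewrite /x1 hS; field.
      by apply: good => //; rewrite /x1 hS; lra.
    have g3 : `|J p.1 x1 y1 (p.2 + W * h n)| <= e * ((L + W) * h n.+1) ^+ 2.
      have -> : p.2 + W * h n = y1 + W * h n.+1 by rewrite /y1 hS; field.
      by apply: good => //; rewrite /y1 hS; lra.
    have g4 : `|J x1 (p.1 + L * h n) y1 (p.2 + W * h n)| <= e * ((L + W) * h n.+1) ^+ 2.
      have -> : p.1 + L * h n = x1 + L * h n.+1 by rewrite /x1 hS; field.
      have -> : p.2 + W * h n = y1 + W * h n.+1 by rewrite /y1 hS; field.
      by apply: good => //; rewrite /x1 /y1 hS; lra.
    move=> /= Jsum; move: Jp; rewrite Jsum//; [|lra|lra].
    apply/negP; rewrite -leNgt.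
    have -> : e * ((L + W) * h n) ^+ 2 = e * ((L + W) * h n.+1) ^+ 2 *+ 4.
      by rewrite hS -mulr_natr; field.
    rewrite (mulrSr _ 3) (mulrSr _ 2) mulr2n.
    rewrite (le_trans (ler_normD _ _))// lerD//.
    by rewrite (le_trans (ler_normD _ _))// lerD// (le_trans (ler_normD _ _))// lerD.
  move=> [q [Jq q1 q1b q2 q2d]]; exists q => _; split => //.
  split => //; first exact: le_trans q1.
  - exact: le_trans p1b.
  - exact: le_trans q2.
  - exact: le_trans p2d.
have [f fP] : exists f : nat -> R * R -> R * R, forall n p, bad n p ->
    [/\ bad n.+1 (f n p), p.1 <= (f n p).1,
        (f n p).1 + L * h n.+1 <= p.1 + L * h n, p.2 <= (f n p).2 &
        (f n p).2 + W * h n.+1 <= p.2 + W * h n].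
  have /choice[g gP] : forall np : nat * (R * R), exists q : R * R,
      bad np.1 np.2 -> [/\ bad np.1.+1 q, np.2.1 <= q.1,
        q.1 + L * h np.1.+1 <= np.2.1 + L * h np.1, np.2.2 <= q.2 &
        q.2 + W * h np.1.+1 <= np.2.2 + W * h np.1].
    by move=> [n p]; exact: step.
  by exists (fun n p => g (n, p)) => n p; exact: (gP (n, p)).
pose P := fix P n := if n is k.+1 then f k (P k) else (a, c).
have badP n : bad n (P n) by elim: n => //= n /fP[].
have mono n k : (P n).1 <= (P (n + k)%N).1 /\
    (P (n + k)%N).1 + L * h (n + k)%N <= (P n).1 + L * h n /\
    (P n).2 <= (P (n + k)%N).2 /\
    (P (n + k)%N).2 + W * h (n + k)%N <= (P n).2 + W * h n.
  elim: k => [|k [A [B [C D]]]]; first by rewrite addn0 !lexx.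
  rewrite addnS; have [_ A' B' C' D'] := fP _ _ (badP (n + k)%N).
  split; first exact: le_trans A'.
  by do 2!(split; first exact: le_trans B + exact: le_trans C'); exact: le_trans D.
have nest1 n k : (P n).1 <= (P k).1 + L * h k.
  have [nk|/ltnW kn] := leqP n k.
    rewrite -(subnKC nk); have [/le_trans + _] := mono n (k - n)%N; apply.
    by rewrite lerDl mulr_ge0 ?ltW.
  rewrite -(subnKC kn); have [_ [+ _]] := mono k (n - k)%N; apply: le_trans.
  by rewrite lerDl mulr_ge0 ?ltW.
have nest2 n k : (P n).2 <= (P k).2 + W * h k.
  have [nk|/ltnW kn] := leqP n k.
    rewrite -(subnKC nk); have [_ [_ [/le_trans + _]]] := mono n (k - n)%N; apply.
    by rewrite lerDl mulr_ge0 ?ltW.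
  rewrite -(subnKC kn); have [_ [_ [_ +]]] := mono k (n - k)%N; apply: le_trans.
  by rewrite lerDl mulr_ge0 ?ltW.
(* By [nest1] and [nest2] each lower left corner stays below every upper right corner, so the
   suprema lie in all the rectangles. *)
pose p := sup (range (fun n => (P n).1)); pose q := sup (range (fun n => (P n).2)).
have pP n : (P n).1 <= p <= (P n).1 + L * h n.
  apply/andP; split.
    apply: ub_le_sup; last by exists n.
    by exists ((P n).1 + L * h n) => _ [k _ <-].
  by apply: ge_sup; [exists (P 0%N).1, 0%N|move=> _ [k _ <-]].
have qP n : (P n).2 <= q <= (P n).2 + W * h n.
  apply/andP; split.
    apply: ub_le_sup; last by exists n.
    by exists ((P n).2 + W * h n) => _ [k _ <-].
  by apply: ge_sup; [exists (P 0%N).2, 0%N|move=> _ [k _ <-]].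
have pab : a <= p <= b.
  have := pP 0%N; rewrite /= /h expr0 mulr1 /L; lra.
have qcd : c <= q <= d.
  have := qP 0%N; rewrite /= /h expr0 mulr1 /W; lra.
have [r r0 Jr] := Jloc p q pab qcd e e0.
have [n hn] : exists n, (L + W) * h n < r.
  have : h @ \oo --> (0 : R) by apply: cvg_expr; rewrite gtr0_norm ?invf_lt1 ?ltr1n.
  move=> /cvgrPdist_lt/(_ (r / (L + W)))[|n _ /(_ n (leqnn n))].
    exact: divr_gt0.
  rewrite /= sub0r normrN gtr0_norm// => hn; exists n.
  by rewrite mulrC -ltr_pdivlMr.
have Lh : 0 < L * h n by rewrite mulr_gt0.
have Wh : 0 < W * h n by rewrite mulr_gt0.
have [A B C D] := badP n; have /andP[p1 p2] := pP n; have /andP[q1 q2] := qP n.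
apply/negP; rewrite -leNgt.
apply: (le_trans (Jr _ _ _ _ _ _ _ _ _ _ _ _)); rewrite ?ltrDl ?A ?C ?B ?D ?p1 ?q1 ?p2 ?q2//.
- by move: hn; rewrite mulrDl; lra.
- by move: hn; rewrite mulrDl; lra.
by rewrite le_eqVlt; apply/orP; left; apply/eqP; ring.
Qed.

Local Notation mu := (@lebesgue_measure R).

Lemma continuous_itv_integrable (f : R -> R) (a b : R) :
  (forall x, a <= x <= b -> {for x, continuous f}) ->
  mu.-integrable `[a, b] (EFin \o f).
Proof.
move=> fc; apply: continuous_compact_integrable; first exact: segment_compact.
apply: continuous_in_subspaceT => x; rewrite inE/= in_itv/=; exact: fc.
Qed.

Lemma Rintegral_itv_split (f : R -> R) (a m b : R) : a <= m <= b ->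
  (forall x, a <= x <= b -> {for x, continuous f}) ->
  \int[mu]_(x in `[a, b]) f x =
  \int[mu]_(x in `[a, m]) f x + \int[mu]_(x in `[m, b]) f x.
Proof.
move=> /andP[am mb] fc.
have fi : mu.-integrable `[a, b] (EFin \o f) by exact: continuous_itv_integrable.
have := @Rintegral_itvB _ f (BLeft a) (BRight b) m fi.
rewrite !bnd_simp => /(_ am mb); rewrite Rintegral_itv_obnd_cbnd; first lra.
apply: integrableS fi => //; apply: subset_itvr; by rewrite bnd_simp.
Qed.

Lemma Rintegral_itv_near_cst (f : R -> R) (a b k M : R) : a <= b ->
  (forall x, a <= x <= b -> {for x, continuous f}) ->
  (forall x, a <= x <= b -> `|f x - k| <= M) ->
  `|\int[mu]_(x in `[a, b]) f x - k * (b - a)| <= M * (b - a).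
Proof.
move=> ab fc fk.
have fi : mu.-integrable `[a, b] (EFin \o f) by exact: continuous_itv_integrable.
have ci (c : R) : mu.-integrable `[a, b] (EFin \o (fun=> c)).
  by apply: continuous_itv_integrable => x _; exact: cvg_cst.
have cE (c : R) : \int[mu]_(x in `[a, b]) c = c * (b - a).
  rewrite Rintegral_cst//; rewrite [X in fine X](@lebesgue_measure_itv R `[a, b]).
  rewrite /= lte_fin.
  by move: ab; rewrite le_eqVlt => /predU1P[->|ab]; rewrite ?ltxx ?subrr// ab.
have fkc x : a <= x <= b -> {for x, continuous (fun x => f x - k)}.
  by move=> /fc fx; apply: cvgB => //; exact: cvg_cst.
rewrite -cE -RintegralB//; apply: (le_trans (le_normr_Rintegral _ _)) => //.
  exact: continuous_itv_integrable.
rewrite -cE; apply: le_Rintegral => //.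
by apply: continuous_itv_integrable => x xab; apply: cvg_norm; exact: fkc.
Qed.

Lemma lipschitz_at_continuous (f : R -> R) (x r L : R) : 0 < r ->
  (forall h, `|h| < r -> `|f (x + h) - f x| <= L * `|h|) ->
  {for x, continuous f}.
Proof.
move=> r0 fL; apply/cvgrPdist_lt => /= e e0.
have L0 : 0 < `|L| + 1 by rewrite ltr_wpDl.
near=> y; rewrite distrC -(subrKC x y).
apply: (@le_lt_trans _ _ ((`|L| + 1) * `|y - x|)).
  apply: le_trans (fL _ _) _; first by rewrite distrC; near: y; exact: cvgr_dist_lt.
  by rewrite ler_wpM2r// (le_trans (ler_norm L))// lerDl.
rewrite mulrC -ltr_pdivlMr// distrC; near: y; apply: cvgr_dist_lt => //.
exact: divr_gt0.
Unshelve. all: by end_near. Qed.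

(* Green's formula for the field [(U, - V)], with no continuity assumed on the
   partial derivatives. *)
Lemma goursat (U V : R -> R -> R) (a b c d : R) : a < b -> c < d ->
  (forall x y, a <= x <= b -> c <= y <= d -> exists A B C : R,
    forall e : R, 0 < e -> exists2 r : R, 0 < r &
    forall h k, `|h| < r -> `|k| < r ->
      `|U (x + h) (y + k) - U x y - (A * h + B * k)| <= e * (`|h| + `|k|) /\
      `|V (x + h) (y + k) - V x y - (C * h + A * k)| <= e * (`|h| + `|k|)) ->
  \int[mu]_(y in `[c, d]) (U b y - U a y) =
  \int[mu]_(x in `[a, b]) (V x d - V x c).
Proof.
move=> ab cd UV.
have near x y : a <= x <= b -> c <= y <= d -> exists2 r : R, 0 < r & exists L : R,
    forall h k, `|h| < r -> `|k| < r ->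
    `|U (x + h) (y + k) - U x y| <= L * (`|h| + `|k|) /\
    `|V (x + h) (y + k) - V x y| <= L * (`|h| + `|k|).
  move=> xab ycd; have [A [B [C +]]] := UV _ _ xab ycd.
  move=> /(_ 1 ltr01)[r r0 UVr]; exists r => //.
  exists (1 + `|A| + `|B| + `|C|) => h k hr kr.
  have lin (D E : R) : `|D * h + E * k| <= (`|D| + `|E|) * (`|h| + `|k|).
    rewrite (le_trans (ler_normD _ _))// !normrM mulrDr mulrDl mulrDl.
    by rewrite addrACA lerD// ?lerDl ?lerDr mulr_ge0.
  have hk0 : 0 <= `|h| + `|k| by rewrite addr_ge0.
  have AB := mulr_ge0 (normr_ge0 B) hk0; have AC := mulr_ge0 (normr_ge0 C) hk0.
  have [hU hV] := UVr h k hr kr; split.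
    rewrite -[X in `|X|](subrK (A * h + B * k)) (le_trans (ler_normD _ _))//.
    by rewrite (le_trans (lerD hU (lin _ _)))//; lra.
  rewrite -[X in `|X|](subrK (C * h + A * k)) (le_trans (ler_normD _ _))//.
  by rewrite (le_trans (lerD hV (lin _ _)))//; lra.
have cU x y : a <= x <= b -> c <= y <= d -> {for y, continuous (U x)}.
  move=> xab ycd; have [r r0 [L UVr]] := near _ _ xab ycd.
  apply: (@lipschitz_at_continuous _ _ r L) => // h hr.
  by have [] := UVr 0 h; rewrite ?normr0// addr0 add0r.
have cV x y : a <= x <= b -> c <= y <= d -> {for x, continuous (V ^~ y)}.
  move=> xab ycd; have [r r0 [L UVr]] := near _ _ xab ycd.
  apply: (@lipschitz_at_continuous _ _ r L) => // h hr.
  by have [] := UVr h 0; rewrite ?normr0// !addr0.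
have cUB x x' y : a <= x <= b -> a <= x' <= b -> c <= y <= d ->
    {for y, continuous (fun y => U x' y - U x y)}.
  by move=> ? ? ?; apply: cvgB; exact: cU.
have cVB y y' x : c <= y <= d -> c <= y' <= d -> a <= x <= b ->
    {for x, continuous (fun x => V x y' - V x y)}.
  by move=> ? ? ?; apply: cvgB; exact: cV.
(* The defect of Green's formula. It is additive because the integrals over interior edges
   cancel. *)
pose J a b c d := \int[mu]_(y in `[c, d]) (U b y - U a y) -
  \int[mu]_(x in `[a, b]) (V x d - V x c).
apply/subr0_eq; rewrite -/(J a b c d); apply: quadrisection => //.
  move=> x x' y y' ax xx' x'b cy yy' y'd s t; rewrite /J.
  have xs : x <= s by rewrite /s; lra.
  have sx : s <= x' by rewrite /s; lra.
  have yt : y <= t by rewrite /t; lra.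
  have ty : t <= y' by rewrite /t; lra.
  have {}xx' := ltW xx'; have {}yy' := ltW yy'.
  have as_ := le_trans ax xs; have sb := le_trans sx x'b.
  have ct := le_trans cy yt; have td := le_trans ty y'd.
  have cy' := le_trans ct ty; have yd := le_trans yt td.
  have ax' := le_trans as_ sx; have xb := le_trans xs sb.
  have sub x1 x2 y1 y2 : a <= x1 -> x1 <= x2 -> x2 <= b ->
    c <= y1 -> y1 <= y2 -> y2 <= d ->
    \int[mu]_(y in `[y1, y2]) (U x2 y - U x1 y) =
    \int[mu]_(y in `[y1, y2]) U x2 y - \int[mu]_(y in `[y1, y2]) U x1 y /\
    \int[mu]_(x in `[x1, x2]) (V x y2 - V x y1) =
    \int[mu]_(x in `[x1, x2]) V x y2 - \int[mu]_(x in `[x1, x2]) V x y1.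
    move=> a1 x12 b2 c1 y12 d2.
    have hx1 : a <= x1 <= b by rewrite a1 (le_trans x12).
    have hx2 : a <= x2 <= b by rewrite b2 (le_trans a1).
    have hy1 : c <= y1 <= d by rewrite c1 (le_trans y12).
    have hy2 : c <= y2 <= d by rewrite d2 (le_trans c1).
    split; apply: RintegralB => //; apply: continuous_itv_integrable => z /andP[? ?].
    - by apply: cU => //; rewrite (le_trans c1)//= (le_trans _ d2).
    - by apply: cU => //; rewrite (le_trans c1)//= (le_trans _ d2).
    - by apply: cV => //; rewrite (le_trans a1)//= (le_trans _ b2).
    - by apply: cV => //; rewrite (le_trans a1)//= (le_trans _ b2).
  have spU z : a <= z <= b -> \int[mu]_(y in `[y, y']) U z y =
      \int[mu]_(y in `[y, t]) U z y + \int[mu]_(y in `[t, y']) U z y.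
    move=> zab; apply: Rintegral_itv_split => [|w /andP[yw wy]].
      by rewrite yt ty.
    by apply: cU; rewrite // (le_trans cy)// (le_trans wy).
  have spV z : c <= z <= d -> \int[mu]_(x in `[x, x']) V x z =
      \int[mu]_(x in `[x, s]) V x z + \int[mu]_(x in `[s, x']) V x z.
    move=> zcd; apply: Rintegral_itv_split => [|w /andP[xw wx]].
      by rewrite xs sx.
    by apply: cV; rewrite // (le_trans ax)// (le_trans wx).
  have [//|//|//|//|//|//|-> ->] := sub x x' y y'.
  have [//|//|//|//|//|//|-> ->] := sub x s y t.
  have [//|//|//|//|//|//|-> ->] := sub s x' y t.
  have [//|//|//|//|//|//|-> ->] := sub x s t y'.
  have [//|//|//|//|//|//|-> ->] := sub s x' t y'.
  rewrite !spU ?spV ?ax ?as_ ?ax' ?cy ?ct ?cy'//.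
  move: (\int[mu]_(y in _) _) => I1; ring.
move=> p q pab qcd e e0.
have [A [B [C +]]] := UV _ _ pab qcd.
have e20 : 0 < e / 2 by rewrite divr_gt0.
move=> /(_ _ e20)[r r0 UVr]; exists r => //.
move=> x x' y y' xp px' yq qy' xx' yy' xr yr; rewrite /J.
set l := x' - x; set w := y' - y.
have key u v : x <= u <= x' -> y <= v <= y' ->
    `|U u v - U p q - (A * (u - p) + B * (v - q))| <= e / 2 * (l + w) /\
    `|V u v - V p q - (C * (u - p) + A * (v - q))| <= e / 2 * (l + w).
  move=> ux vy; have up : `|u - p| <= l by rewrite ler_norml /l; lra.
  have vq : `|v - q| <= w by rewrite ler_norml /w; lra.
  have := UVr (u - p) (v - q); rewrite !subrKC.
  move=> /(_ (le_lt_trans up xr) (le_lt_trans vq yr))[hU hV].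
  split; [apply: le_trans hU _|apply: le_trans hV _];
    by apply: ler_wpM2l; [exact: ltW|exact: lerD].
(* Between opposite edges the linear part of [U] changes by [A * l] and that of [V] by [A * w], with
   the same [A] by the Cauchy-Riemann equations. Both integrals are thus close to [A * l * w]; the
   errors [e / 2] of the two edges add up to [e]. *)
have iU : `|\int[mu]_(y in `[y, y']) (U x' y - U x y) - A * l * w| <=
    e * (l + w) * w.
  apply: Rintegral_itv_near_cst; first exact: ltW.
    by move=> z ?; apply: cUB; lra.
  move=> z zy; have [|h1 _] := key x' z _ zy; first lra.
  have [|h2 _] := key x z _ zy; first lra.
  by move: h1 h2; rewrite !ler_norml /l; lra.
have iV : `|\int[mu]_(x in `[x, x']) (V x y' - V x y) - A * w * l| <=
    e * (l + w) * l.
  apply: Rintegral_itv_near_cst; first exact: ltW.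
    by move=> z ?; apply: cVB; lra.
  move=> z zy; have [|_ h1] := key z y' zy; first lra.
  have [|_ h2] := key z y zy; first lra.
  by move: h1 h2; rewrite !ler_norml /w; lra.
move: iU iV; rewrite !ler_norml.
have -> : e * (l + w) ^+ 2 = e * (l + w) * w + e * (l + w) * l by ring.
by lra.
Qed.

End Goursat.

(** * Holomorphic functions of one variable: circle means and uniqueness *)

Section ComplexDerivative.
Context {R : realType}.
Local Notation C := R[i].
Implicit Types (f g : C -> C) (z : C).

Definition cderivable f z := exists D : C, forall e : R, 0 < e ->
  exists2 r : R, 0 < r & forall h, rnorm h < r ->
    rnorm (f (z + h) - f z - D * h) <= e * rnorm h.

Lemma rnorm_lt0 (c : C) (W : normedZmodType C) (x : W) :
  0 < c -> (`|x| < c) = (rnorm x < complex.Re c).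
Proof.
move=> c0; rewrite rnormE (_ : c = (complex.Re c)%:C) ?ltcR//.
by move: c0; rewrite ltcE => /andP[/= /eqP]; case: c => a b /= ->.
Qed.

Lemma differentiable_rnorm (V W : normedModType C) (f : V -> W) (x : V) :
  differentiable f x -> forall e : R, 0 < e ->
  exists2 r : R, 0 < r & forall h, rnorm h < r ->
    rnorm (f (x + h) - f x - 'd f x h) <= e * rnorm h.
Proof.
move=> df e e0.
have := diff_locallyxC df.
set o := (X in forall h, _ = _ + X h) => fE.
have : \forall x \near (0:V), `|o x| <= e%:C * `|x|; first by apply: littleoP; rewrite ltcR.
move=> /nbhs_ballP[r /= r0 oe].
exists (complex.Re r); first by move: r0; rewrite ltcE => /andP[].
move=> h hr; rewrite fE -addrA -opprD [_ + o h]addrC addrK.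
have : `|o h| <= e%:C * `|h|.
  by apply: oe; rewrite -ball_normE /ball_/= sub0r normrN rnorm_lt0.
by rewrite !rnormE -rmorphM lecR.
Qed.

Lemma cderivable_comp f g z : cderivable f z -> cderivable g (f z) ->
  cderivable (g \o f) z.
Proof.
move=> [D fD] [E gE]; exists (E * D) => e e0.
have [r1 r10 f1] := fD 1 ltr01.
pose L := rnorm D + 1.
have L0 : 0 < L by rewrite ltr_wpDl ?rnorm_ge0.
have E1 : 0 < rnorm E + 1 by rewrite ltr_wpDl ?rnorm_ge0.
have [|r2 r20 g2] := gE (e / 2 / L); first by rewrite !divr_gt0.
have [|r3 r30 f3] := fD (e / 2 / (rnorm E + 1)); first by rewrite !divr_gt0.
exists (Num.min r1 (Num.min r3 (r2 / L))).
  by rewrite !lt_min r10 r30 divr_gt0.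
move=> h; rewrite !lt_min => /and3P[h1 h3 h2] /=.
set k := f (z + h) - f z.
have kL : rnorm k <= L * rnorm h.
  rewrite -(subrK (D * h) k) (le_trans (rnormD _ _))// mulrDl rnormM addrC.
  by rewrite lerD2l; exact: f1.
have kr : rnorm k < r2.
  by rewrite (le_lt_trans kL)// mulrC -ltr_pdivlMr.
have := g2 k kr; rewrite subrKC => {}g2.
have -> : g (f (z + h)) - g (f z) - E * D * h =
    (g (f (z + h)) - g (f z) - E * k) + E * (k - D * h) by ring.
rewrite (le_trans (rnormD _ _))// rnormM.
have -> : e * rnorm h = e / 2 * rnorm h + e / 2 * rnorm h by field.
apply: lerD.
  apply: (le_trans g2); apply: (@le_trans _ _ (e / 2 / L * (L * rnorm h))).
    by apply: ler_wpM2l => //; apply/ltW; rewrite !divr_gt0.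
  by rewrite mulrA divfK ?gt_eqF.
apply: (@le_trans _ _ ((rnorm E + 1) * (e / 2 / (rnorm E + 1) * rnorm h))).
  by apply: ler_pM; rewrite ?rnorm_ge0 ?lerDl//; exact: f3.
by rewrite mulrA [_ * (e / 2 / _)]mulrC divfK ?gt_eqF.
Qed.

(** Schwarz reflection. It makes the conjugate of an antiholomorphic expression available as a
    holomorphic function in [kernel_dilation]. *)
Lemma cderivable_conj f z : cderivable f z^* ->
  cderivable (fun w => (f w^*)^* ) z.
Proof.
move=> [D fD]; exists D^* => e /fD[r r0 fr]; exists r => // h hr.
have := fr h^*; rewrite rnorm_conj => /(_ hr); apply: le_trans.
by rewrite -(rnorm_conj (f _ - _ - _)) !rmorphB !rmorphM/= conjCK rmorphD.
Qed.

Lemma cderivable_sub f g z : cderivable f z -> cderivable g z ->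
  cderivable (fun w => f w - g w) z.
Proof.
move=> [D fD] [E gE]; exists (D - E) => e e0.
have e20 : 0 < e / 2 by rewrite divr_gt0.
have [r r0 fr] := fD _ e20; have [s s0 gs] := gE _ e20.
exists (Num.min r s); first by rewrite lt_min r0.
move=> h; rewrite lt_min => /andP[hr hs].
have -> : f (z + h) - g (z + h) - (f z - g z) - (D - E) * h =
  (f (z + h) - f z - D * h) - (g (z + h) - g z - E * h) by ring.
rewrite (le_trans (rnormD _ _))// rnormN (splitr e) mulrDl.
by rewrite lerD ?fr ?gs.
Qed.

Lemma cderivable_mull f z c : cderivable f z -> cderivable (fun w => c * f w) z.
Proof.
move=> [D fD]; exists (c * D) => e e0.
have c1 : 0 < rnorm c + 1 by rewrite ltr_wpDl ?rnorm_ge0.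
have [|r r0 fr] := fD (e / (rnorm c + 1)); first exact: divr_gt0.
exists r => // h hr; rewrite -mulrA -!mulrBr rnormM.
apply: (@le_trans _ _ ((rnorm c + 1) * (e / (rnorm c + 1) * rnorm h))).
  by apply: ler_pM; rewrite ?rnorm_ge0 ?lerDl//; exact: fr.
by rewrite mulrA [_ * (e / _)]mulrC divfK ?gt_eqF.
Qed.

Lemma differentiable_cderivable (f : C^o -> C^o) (z : C^o) :
  differentiable f z -> cderivable f z.
Proof.
move=> df; exists ('d f z 1) => e /(differentiable_rnorm df)[r r0 fr].
exists r => // h /fr; have -> : 'd f z h = 'd f z 1 * h; last by [].
transitivity ('d f z (h *: (1 : C^o))); first by congr ('d f z _); rewrite [RHS]mulr1.
by rewrite linearZ [LHS]mulrC.
Qed.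

Lemma is_derive_near (f : R -> R) (x d e : R) : is_derive x 1 f d -> 0 < e ->
  exists2 r : R, 0 < r & forall h, `|h| < r -> `|f (x + h) - f x - d * h| <= e * `|h|.
Proof.
move=> [df dE] e0; move: df; rewrite /derivable => /cvg_ex[l /= fl].
have ld : l = d by rewrite -dE; apply/esym/cvg_lim.
move: fl; rewrite ld => /cvgrPdist_le/(_ _ e0).
move=> /nbhs_ballP[r /= r0 fr]; exists r => // h hr.
have [->|h0] := eqVneq h 0; first by rewrite addr0 subrr mulr0 subr0 normr0 mulr0.
have h0r : ball (0 : R) r h by rewrite -ball_normE /ball_/= sub0r normrN.
have /= := fr h h0r h0.
rewrite distrC [_%:A]mulr1 [h + x]addrC => fh.
have -> : f (x + h) - f x - d * h = (h^-1 *: (f (x + h) - f x) - d) * h.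
  by rewrite mulrBl [_ *: _]mulrC mulfVK.
by rewrite normrM ler_wpM2r.
Qed.

Definition cis (y : R) : C := cos y +i* sin y.

Definition cexp (w : C) : C := (expR (complex.Re w))%:C * cis (complex.Im w).

Lemma cisD x y : cis (x + y) = cis x * cis y.
Proof.
by apply/eqP; rewrite eq_complex /= cosD sinD addrC eqxx /= addrC eqxx.
Qed.

Lemma rnorm_cis y : rnorm (cis y) = 1.
Proof.
apply/eqP; rewrite -(@eqrXn2 _ 2)// ?rnorm_ge0// rnorm_sqr /= cos2Dsin2 expr1n.
by rewrite eqxx.
Qed.

Lemma cexpD w h : cexp (w + h) = cexp w * cexp h.
Proof.
case: w h => [a b] [c d]; rewrite /cexp /= expRD cisD rmorphM; ring.
Qed.

Lemma rnorm_le_ReIm (c : C) : rnorm c <= `|complex.Re c| + `|complex.Im c|.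
Proof.
rewrite -(@ler_sqr R) ?nnegrE ?rnorm_ge0 ?addr_ge0//.
rewrite rnorm_sqr sqrrD !real_normK ?num_real// lerD2r lerDl.
by rewrite mulrn_wge0// mulr_ge0.
Qed.

(** The functional equation [cexpD] moves the question to the origin, where the real derivatives of
    [expR], [cos] and [sin] at 0 suffice. *)
Lemma cderivable_cexp w : cderivable cexp w.
Proof.
suff c0 (e : R) : 0 < e -> exists2 r : R, 0 < r & forall h, rnorm h < r ->
    rnorm (cexp h - 1 - h) <= e * rnorm h.
  exists (cexp w) => e e0; have E1 : 0 < rnorm (cexp w) + 1.
    by rewrite ltr_wpDl ?rnorm_ge0.
  have [|r r0 cr] := c0 (e / (rnorm (cexp w) + 1)); first exact: divr_gt0.
  exists r => // h /cr {}cr; rewrite cexpD.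
  have -> : cexp w * cexp h - cexp w - cexp w * h = cexp w * (cexp h - 1 - h) by ring.
  rewrite rnormM.
  apply: (@le_trans _ _ ((rnorm (cexp w) + 1) * (e / (rnorm (cexp w) + 1) * rnorm h))).
    by apply: ler_pM; rewrite ?rnorm_ge0 ?lerDl.
  by rewrite mulrA [_ * (e / _)]mulrC divfK ?gt_eqF.
(* The four error terms [t1] to [t4] below add up to [9 * e1 * n], which [e / 16] covers; the cap at
   1 gives the crude bounds on [expR a] and [sin b]. *)
move=> e0; pose e1 : R := Num.min 1 (e / 16).
have e10 : 0 < e1 by rewrite lt_min ltr01 divr_gt0.
have e11 : e1 <= 1 by rewrite ge_min lexx.
have e1e : e1 <= e / 16 by rewrite ge_min lexx orbT.
move: e1 e10 e11 e1e => e1 e10 e11 e1e.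
have [r1 r10 E1] := is_derive_near (is_derive_expR (0 : R)) e10.
have [r2 r20 C1] := is_derive_near (is_derive_cos (0 : R)) e10.
have [r3 r30 S1] := is_derive_near (is_derive_sin (0 : R)) e10.
exists (Num.min e1 (Num.min r1 (Num.min r2 r3))).
  by rewrite !lt_min e10 r10 r20.
case=> a b; rewrite !lt_min => /and4P[h1 hr1 hr2 hr3].
have ha : `|a| <= rnorm (a +i* b) by exact: (Re_le_rnorm (a +i* b)).
have hb : `|b| <= rnorm (a +i* b) by exact: (Im_le_rnorm (a +i* b)).
have := E1 a (le_lt_trans ha hr1); rewrite add0r expR0 mul1r => {}E1.
have := C1 b (le_lt_trans hb hr2).
rewrite add0r cos0 sin0 oppr0 mul0r subr0 => {}C1.
have := S1 b (le_lt_trans hb hr3).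
rewrite add0r sin0 cos0 subr0 mul1r => {}S1.
set n := rnorm (a +i* b) in ha hb h1 *.
have a0 := normr_ge0 a; have b0 := normr_ge0 b.
have n0 : 0 <= n := le_trans a0 ha.
apply: (le_trans (rnorm_le_ReIm _)); rewrite /cexp /=.
rewrite !mul0r subr0 addr0 oppr0 addr0.
have Ea : `|expR a - 1| <= 2 * n.
  rewrite -(subrK a (expR a - 1)) (le_trans (ler_normD _ _))//.
  rewrite (le_trans (lerD E1 ha))//.
  suff : e1 * `|a| <= 1 * n by lra.
  by apply: ler_pM => //; exact: ltW.
have Ea3 : `|expR a| <= 3.
  rewrite -(subrK 1 (expR a)) (le_trans (ler_normD _ _))// normr1.
  have n1 : n <= 1 by rewrite (le_trans (ltW h1)).
  lra.
have Sb : `|sin b| <= 2 * n.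
  rewrite -(subrK b (sin b)) (le_trans (ler_normD _ _))//.
  rewrite (le_trans (lerD S1 hb))//.
  suff : e1 * `|b| <= 1 * n by lra.
  by apply: ler_pM => //; exact: ltW.
have en : e1 * n <= e / 16 * n by rewrite ler_wpM2r.
have -> : expR a * cos b - 1 - a = (expR a - 1 - a) + expR a * (cos b - 1) by ring.
have -> : expR a * sin b - b = (expR a - 1) * sin b + (sin b - b) by ring.
have t1 : `|expR a - 1 - a| <= e1 * n by rewrite (le_trans E1)// ler_wpM2l// ltW.
have t2 : `|expR a * (cos b - 1)| <= 3 * (e1 * n).
  by rewrite normrM ler_pM// (le_trans C1)// ler_wpM2l// ltW.
have t3 : `|(expR a - 1) * sin b| <= (2 * n) * (2 * e1).
  rewrite normrM ler_pM// (le_trans Sb)// ler_wpM2l//; exact: ltW.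
have t4 : `|sin b - b| <= e1 * n by rewrite (le_trans S1)// ler_wpM2l// ltW.
have en0 : 0 <= e * n by rewrite mulr_ge0// ltW.
have := ler_normD (expR a - 1 - a) (expR a * (cos b - 1)).
have := ler_normD ((expR a - 1) * sin b) (sin b - b).
lra.
Qed.

Local Notation mu := (@lebesgue_measure R).

Lemma rnorm_cexp w : rnorm (cexp w) = expR (complex.Re w).
Proof. by rewrite rnormM rnormC rnorm_cis mulr1 gtr0_norm ?expR_gt0. Qed.

Lemma cderivable_continuous_Re f w : cderivable f w ->
  exists2 r : R, 0 < r & exists L : R, forall h, rnorm h < r ->
    rnorm (f (w + h) - f w) <= L * rnorm h.
Proof.
move=> [D /(_ 1 ltr01)[r r0 fr]]; exists r => //; exists (1 + rnorm D) => h /fr.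
move=> fh; rewrite -(subrK (D * h) (f _ - _)) (le_trans (rnormD _ _))//.
by rewrite mulrDl rnormM lerD2r.
Qed.

Lemma real_cis0 : cis 0 = 1 :> C.
Proof. by rewrite /cis cos0 sin0. Qed.

Lemma cis2pi : cis (2 * pi) = 1 :> C.
Proof. by rewrite /cis mulr_natl cos2pi sin2pi. Qed.

(* Green's formula for [g (exp (x + i y))] on [[s, 0] x [0, 2 pi]] makes the
   circle mean independent of the radius [exp s]; then [s] goes to [-oo]. *)
Lemma circle_mean (g : C -> C) :
  (forall z, rnorm z <= 1 -> cderivable g z) ->
  \int[mu]_(y in `[0, 2 * pi]) complex.Re (g (cis y)) =
  complex.Re (g 0) * (2 * pi).
Proof.
move=> gd; pose G x y := g (cexp (x +i* y)).
have pi20 : 0 < 2 * pi :> R by rewrite mulr_gt0// pi_gt0.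
have Gd (x y : R) : x <= 0 -> exists A B : R, forall e : R, 0 < e ->
    exists2 r : R, 0 < r & forall h k : R, `|h| < r -> `|k| < r ->
    `|complex.Re (G (x + h) (y + k)) - complex.Re (G x y) - (A * h - B * k)| <= e * (`|h| + `|k|) /\
    `|complex.Im (G (x + h) (y + k)) - complex.Im (G x y) - (B * h + A * k)| <= e * (`|h| + `|k|).
  move=> x0; have [|D GD] := @cderivable_comp cexp g (x +i* y) (cderivable_cexp _).
    by apply: gd; rewrite rnorm_cexp /= -expR0 ler_expR.
  exists (complex.Re D), (complex.Im D) => e e0.
  have [r r0 Gr] := GD e e0; exists (r / 2); first exact: divr_gt0.
  move=> h k hr kr; have hk := rnorm_le_ReIm (h +i* k).
  have {}Gr : rnorm (G (x + h) (y + k) - G x y - D * (h +i* k)) <= e * (`|h| + `|k|).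
    apply: le_trans (Gr (h +i* k) _) _; last by apply: ler_wpM2l => //; exact: ltW.
    by rewrite (le_lt_trans hk)// (splitr r) ltrD.
  have := le_trans (Re_le_rnorm _) Gr; have := le_trans (Im_le_rnorm _) Gr.
  by case: D {GD Gr} => A B; case: (G (x + h) _) => ? ?; case: (G x y) => ? ? /=;
    rewrite [B * h + _]addrC.
have cG (x y : R) : x <= 0 -> {for y, continuous (fun y => complex.Re (G x y))}.
  move=> /(Gd _ y)[A [B /(_ 1 ltr01)[r r0 Gr]]].
  apply: (@lipschitz_at_continuous _ _ _ r (1 + `|B|)) => // h hr.
  have [] := Gr 0 h; rewrite ?normr0// addr0 mulr0 !sub0r opprK add0r mul1r => Gh _.
  rewrite -[X in `|X|](addrK (B * h)) (le_trans (ler_normB _ _))//.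
  by rewrite mulrDl mul1r normrM lerD2r.
have mean s : s < 0 -> \int[mu]_(y in `[0, 2 * pi]) complex.Re (G 0 y) =
    \int[mu]_(y in `[0, 2 * pi]) complex.Re (G s y).
  move=> s0; apply/subr0_eq; rewrite -RintegralB//; last 2 first.
    by apply: continuous_itv_integrable => z _; exact: cG.
    by apply: continuous_itv_integrable => z _; apply: cG; exact: ltW.
  (* The two horizontal edges carry the same values of [G], which has period [2 * pi] in [y], so the
     right-hand side of Green's formula vanishes. *)
  rewrite (@goursat _ (fun x y => complex.Re (G x y)) (fun x y => complex.Im (G x y)))//.
    rewrite (@eq_Rintegral _ _ _ _ _ (fun=> 0)) ?Rintegral_cst ?mul0r// => x _.
    by rewrite /G /cexp /= cis2pi real_cis0 subrr.
  move=> x y /andP[_ /(Gd _ y)[A [B AB]]] _; exists A, (- B), B => e e0.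
  by have [r r0 Gr] := AB e e0; exists r => // h k hr kr; rewrite mulNr; exact: Gr.
have G0 : (fun y => complex.Re (G 0 y)) = (fun y => complex.Re (g (cis y))).
  by apply/funext => y; rewrite /G /cexp /= expR0 mul1r.
rewrite -G0; apply/eqP; rewrite -subr_eq0 -normr_le0; apply/ler_addgt0Pl => e e0.
rewrite addr0.
have [|r r0 [L gr]] := @cderivable_continuous_Re g 0; first by apply: gd; rewrite rnorm0.
(* The radius of the small circle: within reach of the Lipschitz estimate at 0, below 1 so that
   [ln d] is negative, and small enough for [g] to be within [e / (2 * pi)] of [g 0] on it. *)
pose d := Num.min (Num.min (r / 2) (1 / 2)) (e / (2 * pi) / (`|L| + 1)).
have L1 : 0 < `|L| + 1 by rewrite ltr_wpDl.
have d0 : 0 < d by rewrite !lt_min !divr_gt0.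
have dr : d < r.
  rewrite (@le_lt_trans _ _ (r / 2))//; last by rewrite ltr_pdivrMr// ltr_pMr// ltr1n.
  by rewrite !ge_min lexx.
have d1 : d < 1.
  by rewrite (@le_lt_trans _ _ (1 / 2))// ?ge_min ?ge_min ?lexx ?orbT// ltr_pdivrMr// mul1r ltr1n.
have dL : (`|L| + 1) * d <= e / (2 * pi).
  by rewrite mulrC -ler_pdivlMr// /d ge_min lexx orbT.
have s0 : ln d < 0 by rewrite ln_lt0// d0.
rewrite (mean _ s0) -[2 * pi in X in _ - X]subr0 -[e](@divfK _ (2 * pi)) ?gt_eqF//.
rewrite -[X in _ <= _ * X]subr0.
apply: Rintegral_itv_near_cst => [|y _|y _]; first exact: ltW.
  by apply: cG; exact: ltW.
have cd : rnorm (cexp (ln d +i* y)) = d by rewrite rnorm_cexp lnK.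
have := gr (cexp (ln d +i* y)); rewrite cd add0r => /(_ dr).
rewrite -raddfB => {}gr; apply: (le_trans (Re_le_rnorm _)); apply: (le_trans gr).
apply: le_trans dL; rewrite ler_wpM2r ?ltW// (le_lt_trans (ler_norm L))// ltrDl//.
Qed.

Lemma cderivable_moebius (t : R) (z : C) : 0 < t < 1 -> rnorm z <= 1 ->
  cderivable (fun w => (w + t%:C) / (1 + t%:C * w)) z.
Proof.
move=> /andP[t0 t1] z1; apply: differentiable_cderivable.
have nz : 1 + t%:C * z != 0.
  rewrite addrC -[1]opprK subr_eq0; apply/eqP => /(congr1 rnorm).
  rewrite rnormM rnormC gtr0_norm// rnormN -(rmorph1 (real_complex R)) rnormC normr1.
  apply/eqP; rewrite lt_eqF// (le_lt_trans _ t1)//.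
  by rewrite -[leRHS]mulr1 ler_wpM2l// ltW.
apply: (@differentiableM _ _ (fun w : C^o => w + t%:C : C^o)
  (fun w : C^o => (1 + t%:C * w)^-1 : C^o)).
  by apply: differentiableD; [exact: ex_diff|exact: differentiable_cst].
apply: (@differentiableV _ _ (fun w : C^o => 1 + t%:C * w : C^o)) => //.
Qed.

Lemma rnorm_moebius (t : R) (z : C) : 0 < t < 1 -> rnorm z = 1 ->
  rnorm ((z + t%:C) / (1 + t%:C * z)) = 1.
Proof.
move=> /andP[t0 t1] z1.
have zt : rnorm (z + t%:C) = rnorm (1 + t%:C * z).
  apply/eqP; rewrite -(@eqrXn2 _ 2)// ?rnorm_ge0// !rnorm_sqr.
  have := rnorm_sqr z; rewrite z1 expr1n; case: z {z1} => a b /= ab.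
  rewrite !mul0r addr0 subr0 !add0r; apply/eqP.
  transitivity (a ^+ 2 + b ^+ 2 + 2 * a * t + t ^+ 2); first ring.
  transitivity (1 + 2 * a * t + t ^+ 2 * (a ^+ 2 + b ^+ 2)); last by ring.
  by rewrite -ab mulr1.
have nz : rnorm (z + t%:C) != 0.
  have := rnormD (z + t%:C) (- t%:C); rewrite addrK z1 rnormN rnormC gtr0_norm//.
  by move=> h; rewrite gt_eqF// -(ltrD2r t) add0r (lt_le_trans t1).
have iz : 1 + t%:C * z != 0.
  by apply: contra_neq nz => iz; rewrite zt iz rnorm0.
apply: (@mulIf _ (rnorm (1 + t%:C * z))); first by rewrite -zt.
by rewrite -rnormM divfK// mul1r zt.
Qed.

(** The circle mean only reads the value at the centre, so [t] is first moved there by the disc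
    automorphism [phi], which preserves the unit circle. Multiplying [h] by [1] and by ['i] recovers
    both parts of [h t] from real parts. *)
Lemma circle_vanishing (h : C -> C) : (forall z, cderivable h z) ->
  (forall z, rnorm z = 1 -> h z = 0) -> forall t : R, 0 < t < 1 -> h t%:C = 0.
Proof.
move=> hd h0 t t01; pose phi z := (z + t%:C) / (1 + t%:C * z).
have phi0 : phi 0 = t%:C by rewrite /phi mulr0 addr0 add0r divr1.
have Re0 (c : C) : complex.Re (c * h t%:C) = 0.
  have /= := @circle_mean (fun z => c * h (phi z)).
  rewrite phi0 (@eq_Rintegral _ _ _ _ _ (fun=> 0)); last first.
    by move=> y _; rewrite h0 ?mulr0// rnorm_moebius// rnorm_cis.
  rewrite Rintegral_cst// mul0r => /(_ _)/esym/eqP.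
  rewrite mulf_eq0 (gt_eqF (mulr_gt0 _ (pi_gt0 R)))// orbF => hc; apply/eqP/hc.
  move=> z z1; apply: cderivable_mull; apply: cderivable_comp => //.
  exact: cderivable_moebius.
have := Re0 1; have := Re0 'i; rewrite mul1r.
by case: (h t%:C) => a b /=; rewrite mul0r mul1r sub0r => /eqP; rewrite oppr_eq0 => /eqP -> ->.
Qed.

End ComplexDerivative.

(** * Integration on C^d *)

Section ChangeOfVariables.
Context {R : realType}.
Local Notation mu := (@lebesgue_measure R).

(** The change of variables formula for a map of constant Jacobian [1 / k]. Stating it for
    nonnegative functions makes it stable under composition and compatible with Tonelli. *)
Definition scales_by d (T : measurableType d) (m : set T -> \bar R) (k : R)
    (phi : T -> T) :=
  [/\ 0 <= k, measurable_fun setT phi &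
   forall g : T -> \bar R, measurable_fun setT g -> (forall x, (0 <= g x)%E) ->
     (\int[m]_x g (phi x) = k%:E * \int[m]_x g x)%E].

Lemma scales_by_comp d (T : measurableType d) (m : set T -> \bar R)
    (k l : R) (phi psi : T -> T) :
  scales_by m k phi -> scales_by m l psi -> scales_by m (k * l) (phi \o psi).
Proof.
move=> [k0 mphi kphi] [l0 mpsi lpsi]; split.
- exact: mulr_ge0.
- exact: measurableT_comp.
move=> g mg g0; rewrite /= (lpsi (g \o phi)) ?kphi//.
  by rewrite muleA -EFinM mulrC.
  exact: (measurableT_comp mg mphi).
by move=> x; exact: g0.
Qed.

Lemma scales_by1_comp d (T : measurableType d) (m : set T -> \bar R)
    (phi psi : T -> T) :
  scales_by m 1 phi -> scales_by m 1 psi -> scales_by m 1 (phi \o psi).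
Proof. by move=> h1 h2; have := scales_by_comp h1 h2; rewrite mulr1. Qed.

(** Uniqueness of Lebesgue measure: [a] times the image of [mu] under the affine map agrees with
    [mu] on half-open intervals. *)
Lemma lebesgue_scales_by (a b : R) : 0 < a ->
  scales_by mu a^-1 (fun x => a * x + b).
Proof.
move=> a0; have a0' : 0 <= a := ltW a0.
pose phi (x : measurableTypeR R) : measurableTypeR R := a * x + b.
have mphi : measurable_fun setT phi.
  by apply: measurable_funD => //; apply: measurable_funM.
split; [by rewrite invr_ge0|exact: mphi|].
move=> g mg g0.
pose pf : {measure set (measurableTypeR R) -> \bar R} :=
  measure_function_pushforward__canonical__measure_function_Measure mu mphi.
pose nu : {measure set (measurableTypeR R) -> \bar R} := mscale (NngNum a0') pf.
have muE A : measurable A -> mu A = nu A.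
  apply: lebesgue_measure_unique => _ [[x y] _ <-]/=.
  rewrite /mscale/= /pushforward.
  have -> : phi @^-1` `]x, y]%classic = `](x - b) / a, (y - b) / a]%classic.
    apply/seteqP; split=> t; rewrite /phi /= !in_itv/= ltr_pdivrMr// ler_pdivlMr//;
      by rewrite ltrBlDr lerBrDr [t * a]mulrC.
  rewrite !lebesgue_measure_itv/= !lte_fin ltr_pM2r ?invr_gt0// ltrD2r.
  case: ifP => xy; last by rewrite mule0.
  by rewrite -!EFinB -EFinM; congr EFin; field; rewrite gt_eqF.
have -> : (\int[mu]_x g x = \int[nu]_x g x)%E.
  by apply: eq_measure_integral => A mA _; exact: muE.
rewrite /nu ge0_integral_mscale//= muleA -EFinM mulVf ?gt_eqF// mul1e.
by rewrite ge0_integral_pushforward.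
Qed.

Local Notation RT := (measurableTypeR R).
Local Notation plane := (RT * RT)%type.
Local Notation leb2 := (@plane_lebesgue R).

Lemma plane_integral (g : plane -> \bar R) : measurable_fun setT g ->
  (forall x, (0 <= g x)%E) ->
  (\int[leb2]_x g x = \int[mu]_x \int[mu]_y g (x, y))%E.
Proof. by move=> mg g0; rewrite /plane_lebesgue fubini_tonelli1. Qed.

Lemma plane_integral2 (g : plane -> \bar R) : measurable_fun setT g ->
  (forall x, (0 <= g x)%E) ->
  (\int[leb2]_x g x = \int[mu]_y \int[mu]_x g (x, y))%E.
Proof. by move=> mg g0; rewrite /plane_lebesgue fubini_tonelli2. Qed.

Lemma measurable_section_integral d1 d2 (T1 : measurableType d1)
    (T2 : measurableType d2) (m2 : {sigma_finite_measure set T2 -> \bar R})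
    (f : T1 * T2 -> \bar R) : measurable_fun setT f ->
  (forall x, (0 <= f x)%E) ->
  measurable_fun setT (fun x => \int[m2]_y f (x, y))%E.
Proof. by move=> mf f0; exact: measurable_fun_fubini_tonelli_F. Qed.

Lemma measurable_section_integral2 d1 d2 (T1 : measurableType d1)
    (T2 : measurableType d2) (m1 : {sigma_finite_measure set T1 -> \bar R})
    (f : T1 * T2 -> \bar R) : measurable_fun setT f ->
  (forall x, (0 <= f x)%E) ->
  measurable_fun setT (fun y => \int[m1]_x f (x, y))%E.
Proof. by move=> mf f0; exact: measurable_fun_fubini_tonelli_G. Qed.

Lemma plane_swap_scales_by : scales_by leb2 1 (fun x : plane => (x.2, x.1)).
Proof.
have msw : measurable_fun [set: plane] (fun x : plane => (x.2, x.1)).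
  by apply: measurable_fun_pair; [exact: measurable_snd|exact: measurable_fst].
split => // g mg g0.
rewrite mul1e plane_integral ?plane_integral2//.
exact: (measurableT_comp mg msw).
Qed.

(** For each fixed second coordinate the shear is a translation of the line. *)
Lemma plane_shear_scales_by (s : R) :
  scales_by leb2 1 (fun x : plane => (x.1 + s * x.2, x.2)).
Proof.
have msh : measurable_fun [set: plane] (fun x : plane => (x.1 + s * x.2 : RT, x.2)).
  apply: measurable_fun_pair; last exact: measurable_snd.
  by apply: measurable_funD => //; apply: measurable_funM.
split => // g mg g0.
rewrite mul1e plane_integral2//; last exact: (measurableT_comp mg msh).
rewrite [RHS]plane_integral2//; apply: eq_integral => y _ /=.
have [_ _ /(_ (fun x => g (x, y)))] := lebesgue_scales_by (s * y) ltr01.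
rewrite invr1 mul1e => <-//; first by apply: eq_integral => x _; rewrite mul1r.
exact: (measurableT_comp mg (measurable_pair2 y)).
Qed.

Lemma plane_affine_scales_by (a b c : R) : 0 < a ->
  scales_by leb2 (a^-1 * a^-1) (fun x : plane => (a * x.1 + b, a * x.2 + c)).
Proof.
move=> a0.
have [k0 m1 h1] := lebesgue_scales_by b a0.
have [_ m2 h2] := lebesgue_scales_by c a0.
have mph : measurable_fun [set: plane] (fun x : plane => (a * x.1 + b : RT, a * x.2 + c : RT)).
  apply: measurable_fun_pair.
    exact: (measurableT_comp m1 measurable_fst).
  exact: (measurableT_comp m2 measurable_snd).
split => //; first exact: mulr_ge0.
move=> g mg g0.
rewrite plane_integral//; last exact: (measurableT_comp mg mph).
under eq_integral => x _.
  rewrite (h2 (fun y => g (a * x + b, y)))//; last exact: (measurableT_comp mg (measurable_pair1 _)).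
  over.
have mF := measurable_section_integral mu mg g0.
have F0 x : (0 <= \int[mu]_y g (x, y))%E by exact: integral_ge0.
rewrite ge0_integralZl//; last exact: (measurableT_comp mF m1).
by rewrite (h1 (fun x => \int[mu]_y g (x, y))%E)// muleA -EFinM plane_integral.
Qed.

Definition plane_rot (c s : R) (x : plane) : plane :=
  (c * x.1 - s * x.2, s * x.1 + c * x.2).

(** A rotation is a product of three shears: two horizontal ones with slope [t = - tan (theta / 2)]
    around a vertical one with slope [sin theta], the latter written as a horizontal shear between
    two swaps. The slope [t] is infinite at the half turn, which is taken as two quarter turns. *)
Lemma plane_rot_scales_by (c s : R) : c ^+ 2 + s ^+ 2 = 1 ->
  scales_by leb2 1 (plane_rot c s).
Proof.
suff rot (u v : R) : u ^+ 2 + v ^+ 2 = 1 -> u != -1 -> scales_by leb2 1 (plane_rot u v).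
  move=> cs; have [c1|] := eqVneq c (-1); last exact: rot.
  have s0 : s = 0.
    by apply/eqP; rewrite -(@sqrf_eq0 R); apply/eqP; move: cs; rewrite c1; lra.
  have q : scales_by leb2 1 (plane_rot 0 1).
    by apply: rot; [rewrite expr0n expr1n add0r|rewrite eq_sym oppr_eq0 oner_eq0].
  have -> : plane_rot c s = plane_rot 0 1 \o plane_rot 0 1.
    by apply/funext => -[x y]; rewrite /plane_rot /= c1 s0; congr (_, _); ring.
  exact: scales_by1_comp.
move=> uv u1; have u10 : 1 + u != 0 by rewrite addrC -[1]opprK subr_eq0.
pose t := - v / (1 + u).
have -> : plane_rot u v = (fun x : plane => (x.1 + t * x.2, x.2)) \o
   ((fun x : plane => (x.2, x.1)) \o ((fun x : plane => (x.1 + v * x.2, x.2)) \o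
   ((fun x : plane => (x.2, x.1)) \o (fun x : plane => (x.1 + t * x.2, x.2))))).
  have tv : t * v = u - 1.
    apply: (mulIf u10); rewrite /t mulrAC divfK//.
    by move: uv; nra.
  have t1 : t * (1 + u) = - v by rewrite /t divfK.
  apply/funext => -[x y]; rewrite /plane_rot /=; congr (_, _).
    transitivity (x + t * y + (t * v) * x + (t * v) * t * y + t * y); last ring.
    rewrite tv; transitivity (u * x + t * (1 + u) * y); last ring.
    by rewrite t1; ring.
  transitivity (y + v * x + (t * v) * y); last ring.
  by rewrite tv; ring.
have S1 := plane_shear_scales_by; have W := plane_swap_scales_by.
by do !apply: scales_by1_comp => //.
Qed.

End ChangeOfVariables.

Section TupleIntegral.
Context d (T : measurableType d) (R : realType).
Variable m : {sigma_finite_measure set T -> \bar R}.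

Lemma tuple_integral0 (f : 0.-tuple T -> \bar R) :
  (\int[tuple_measure m 0]_t f t = f [tuple])%E.
Proof.
have mf : measurable_fun setT f.
  have -> : f = cst (f [tuple]) by apply/funext => t; rewrite (tuple0 t).
  exact: measurable_cst.
by rewrite /= integral_dirac// diracE in_setT mul1e.
Qed.

Lemma tuple_integralS n (f : n.+1.-tuple T -> \bar R) :
  measurable_fun setT f -> (forall t, (0 <= f t)%E) ->
  (\int[tuple_measure m n.+1]_t f t =
   \int[m]_x \int[tuple_measure m n]_t f (tuple_cons (x, t)))%E.
Proof.
move=> mf f0.
have mc := @measurable_tuple_cons _ T n.
transitivity (\int[pushforward (m \x tuple_measure m n)%E (@tuple_cons _ T n)]_t f t)%E => //.
rewrite ge0_integral_pushforward//.
rewrite preimage_setT fubini_tonelli1//.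
  exact: (measurableT_comp mf mc).
by move=> x; exact: f0.
Qed.

Lemma measurable_map_tuple n (phi : 'I_n -> T -> T) :
  (forall j, measurable_fun setT (phi j)) ->
  measurable_fun setT (fun t : n.-tuple T => [tuple phi j (tnth t j) | j < n]).
Proof.
move=> mphi; apply/measurable_fun_tnthP => j.
rewrite (_ : _ \o _ = phi j \o (fun t => tnth t j)).
  exact: (measurableT_comp (mphi j) (measurable_tnth j)).
by apply/funext => t /=; rewrite tnth_mktuple.
Qed.

Lemma tuple_scales_by n (k : R) (phi : 'I_n -> T -> T) : 0 <= k ->
  (forall j, scales_by m k (phi j)) ->
  scales_by (tuple_measure m n) (k ^+ n)
    (fun t : n.-tuple T => [tuple phi j (tnth t j) | j < n]).
Proof.
move=> k0; elim: n phi => [|n IH] phi sphi.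
  split => // [|g mg g0].
    by apply: measurable_map_tuple => j; have [] := sphi j.
  rewrite !tuple_integral0 expr0 mul1e; by rewrite [X in g X]tuple0.
have mmap : measurable_fun setT (fun t : n.+1.-tuple T => [tuple phi j (tnth t j) | j < n.+1]).
  by apply: measurable_map_tuple => j; have [] := sphi j.
split => //; first exact: exprn_ge0.
move=> g mg g0; rewrite !tuple_integralS//; last exact: (measurableT_comp mg mmap).
have [_ mIH {}IH] := IH (fun j => phi (lift ord0 j)) (fun j => sphi _).
have mgc : measurable_fun setT (g \o @tuple_cons _ T n).
  exact: (measurableT_comp mg (@measurable_tuple_cons _ T n)).
have consE x (t : n.-tuple T) : [tuple phi j (tnth (tuple_cons (x, t)) j) | j < n.+1] =
    tuple_cons (phi ord0 x, [tuple phi (lift ord0 j) (tnth t j) | j < n]).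
  apply: eq_from_tnth => j; rewrite tnth_mktuple.
  have [->|[j' ->]] : j = ord0 \/ exists j', j = lift ord0 j'.
    by case: (unliftP ord0 j) => [j' ->|->]; [right; exists j'|left].
    by rewrite !tnth0.
  by rewrite !tnthS tnth_mktuple.
under eq_integral => x _.
  under eq_integral do rewrite consE.
  rewrite (IH (fun t => g (tuple_cons (phi ord0 x, t))))//; last first.
    exact: (measurableT_comp mgc (measurable_pair1 _)).
  over.
have mF := measurable_section_integral (tuple_measure m n) mgc (fun x => g0 _).
have [_ m0 h0] := sphi ord0.
have F0 x : (0 <= \int[tuple_measure m n]_t g (tuple_cons (x, t)))%E.
  exact: integral_ge0.
rewrite ge0_integralZl//; last 2 first.
- exact: (measurableT_comp mF m0).
- by rewrite lee_fin exprn_ge0.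
rewrite (h0 (fun x => \int[tuple_measure m n]_t g (tuple_cons (x, t)))%E)//.
by rewrite muleA -EFinM exprSr.
Qed.

Lemma tuple_integral_prod n (phi : T -> R) :
  measurable_fun setT phi -> (forall x, 0 <= phi x) ->
  (\int[tuple_measure m n]_t (\prod_(j < n) phi (tnth t j))%:E =
   (\int[m]_x (phi x)%:E) ^+ n)%E.
Proof.
move=> mphi phi0; elim: n => [|n IH].
  by rewrite tuple_integral0 big_ord0 expe0.
have mprod k : measurable_fun setT (fun t : k.-tuple T => (\prod_(j < k) phi (tnth t j))%:E).
  apply/measurable_EFinP; apply: measurable_prod => j _.
  exact: (measurableT_comp mphi (measurable_tnth j)).
rewrite tuple_integralS//; last by move=> t; rewrite lee_fin prodr_ge0.
have sec x : (\int[tuple_measure m n]_t (\prod_(j < n.+1) phi (tnth (tuple_cons (x, t)) j))%:E =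
    (phi x)%:E * (\int[m]_x (phi x)%:E) ^+ n)%E.
  rewrite -IH -ge0_integralZl ?lee_fin//.
    apply: eq_integral => t _; rewrite big_ord_recl tnth0 -EFinM; congr (_ * _)%:E.
    by apply: eq_bigr => j _; rewrite tnthS.
    exact: mprod.
  by move=> t _; rewrite lee_fin prodr_ge0.
under eq_integral do rewrite sec.
rewrite ge0_integralZr//; last 3 first.
- exact/measurable_EFinP.
- by move=> x _; rewrite lee_fin.
- by rewrite expe_ge0// integral_ge0// => x _; rewrite lee_fin.
by rewrite expeS.
Qed.

End TupleIntegral.

Section EuclideanNorm.
Context {R : realType} {d : nat}.
Implicit Types (z w : 'rV[R[i]]_d).

Lemma enorm_ge0 z : 0 <= enorm z. Proof. exact: sqrtr_ge0. Qed.

Lemma enorm_sqr z : enorm z ^+ 2 = \sum_(j < d) rnorm (z ord0 j) ^+ 2.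
Proof. by rewrite sqr_sqrtr// sumr_ge0// => j _; exact: sqr_ge0. Qed.

Lemma enorm0 : enorm (0 : 'rV[R[i]]_d) = 0.
Proof.
apply/eqP; rewrite -sqrf_eq0 enorm_sqr big1// => j _.
by rewrite mxE rnorm0 expr0n.
Qed.

Lemma enormZ (c : R[i]) z : enorm (c *: z) = rnorm c * enorm z.
Proof.
apply/eqP; rewrite -(@eqrXn2 _ 2)// ?mulr_ge0 ?rnorm_ge0 ?enorm_ge0//.
rewrite exprMn !enorm_sqr mulr_sumr; apply/eqP; apply: eq_bigr => j _.
by rewrite mxE rnormM exprMn.
Qed.

Lemma rnorm_coord_le z j : rnorm (z ord0 j) <= enorm z.
Proof.
rewrite -(@ler_sqr R) ?nnegrE ?rnorm_ge0 ?enorm_ge0// enorm_sqr (bigD1 j)//= lerDl.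
by rewrite sumr_ge0// => i _; exact: sqr_ge0.
Qed.

Lemma rnorm_le_enorm z : rnorm z <= enorm z.
Proof.
have [z0|z0] := eqVneq z 0; first by rewrite z0 rnorm0 enorm_ge0.
have : mx_norm z != 0 by apply: contra_neq z0; exact: mx_norm_eq0.
move=> /mx_norm_neq0[[i j] /= zE]; have {}zE : `|z| = `|z i j| by [].
by rewrite /rnorm zE ord1; exact: rnorm_coord_le.
Qed.

Lemma enorm_le z (e : R) : 0 <= e -> (forall j, rnorm (z ord0 j) <= e) ->
  enorm z <= d%:R * e.
Proof.
move=> e0 ze; rewrite -(@ler_sqr R) ?nnegrE ?mulr_ge0 ?enorm_ge0//.
rewrite enorm_sqr exprMn.
apply: (@le_trans _ _ (\sum_(j < d) e ^+ 2)).
  by apply: ler_sum => j _; rewrite ler_sqr ?nnegrE ?rnorm_ge0.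
rewrite sumr_const card_ord -[leLHS]mulr_natl ler_wpM2r ?sqr_ge0//.
by rewrite -natrX ler_nat; case: (d) => // n; rewrite leq_pmulr.
Qed.

Lemma enormD z w : enorm (z + w) <= enorm z + enorm w.
Proof.
have [e0|z0] := eqVneq (enorm z) 0.
  have -> : z = 0; last by rewrite add0r enorm0 add0r.
  apply/rowP => j; rewrite mxE; apply: rnorm0_eq0; apply/eqP.
  by rewrite eq_le rnorm_ge0 -e0 rnorm_coord_le.
have [e0|w0] := eqVneq (enorm w) 0.
  have -> : w = 0; last by rewrite addr0 enorm0 addr0.
  apply/rowP => j; rewrite mxE; apply: rnorm0_eq0; apply/eqP.
  by rewrite eq_le rnorm_ge0 -e0 rnorm_coord_le.
have {}z0 : 0 < enorm z by rewrite lt_neqAle eq_sym z0 enorm_ge0.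
have {}w0 : 0 < enorm w by rewrite lt_neqAle eq_sym w0 enorm_ge0.
set a := enorm z in z0 *; set b := enorm w in w0 *.
have aE : a ^+ 2 = \sum_(j < d) rnorm (z ord0 j) ^+ 2 by exact: enorm_sqr.
have bE : b ^+ 2 = \sum_(j < d) rnorm (w ord0 j) ^+ 2 by exact: enorm_sqr.
have [a0 b0] := (ltW z0, ltW w0).
rewrite -(@ler_sqr R) ?nnegrE ?addr_ge0 ?enorm_ge0// enorm_sqr.
(* convexity of the square, with weights [a / (a + b)] and [b / (a + b)] *)
apply: (@le_trans _ _ (\sum_(j < d) ((1 + b / a) * rnorm (z ord0 j) ^+ 2 +
    (1 + a / b) * rnorm (w ord0 j) ^+ 2))).
  apply: ler_sum => j _; rewrite mxE.
  set x := rnorm (z _ _); set y := rnorm (w _ _).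
  apply: (@le_trans _ _ ((x + y) ^+ 2)).
    by rewrite ler_sqr ?nnegrE ?addr_ge0 ?rnorm_ge0// rnormD.
  rewrite -subr_ge0 (_ : _ - _ = (b * x - a * y) ^+ 2 / (a * b)).
    by rewrite divr_ge0 ?sqr_ge0 ?mulr_ge0.
  by field; rewrite !gt_eqF.
rewrite big_split/= -!mulr_sumr -aE -bE le_eqVlt; apply/orP; left; apply/eqP.
by field; rewrite !gt_eqF.
Qed.

Lemma enormN z : enorm (- z) = enorm z.
Proof. by rewrite -scaleN1r enormZ rnormN -(rmorph1 (real_complex R)) rnormC normr1 mul1r. Qed.

End EuclideanNorm.

Section RealContinuity.
Context {R : realType} {V : normedModType R[i]}.
Implicit Types F G : V -> R.

(* [R[i]] itself carries no canonical topology, only [R[i]^o] does: going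
   through an abstract [V] lets ['rV[R[i]]_d] be recognized as a normed module. *)
Definition rcontinuous F := continuous F.

Lemma rcontinuous_near F z : rcontinuous F -> forall e, 0 < e ->
  exists2 r : R, 0 < r & forall y, rnorm (z - y) < r -> `|F z - F y| < e.
Proof.
move=> Fc e e0; have := Fc z => /cvgrPdist_lt/(_ _ e0)/nbhs_ballP[r /= r0 rF].
exists (complex.Re r); first by move: r0; rewrite ltcE => /andP[].
by move=> y yr; apply: rF; rewrite -ball_normE /ball_/= rnorm_lt0.
Qed.

End RealContinuity.

(** * Change of variables, grids and measurability on C^d *)

Section IntegralCn.
Context {R : realType} {d : nat}.
Local Notation RT := (measurableTypeR R).
Local Notation plane := (RT * RT)%type.
Local Notation leb := (@lebesgueC R d).
Implicit Types (z w : 'rV[R[i]]_d) (t : d.-tuple plane).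

Let affine_map (r : R) w (j : 'I_d) (x : plane) : plane :=
  (r * x.1 + complex.Re (w ord0 j), r * x.2 + complex.Im (w ord0 j)).

Let cvec_affine (r : R) w t :
  cvec [tuple affine_map r w j (tnth t j) | j < d] = r%:C *: cvec t + w.
Proof.
apply/rowP => j; rewrite !mxE tnth_mktuple /affine_map /=.
by case: (w _ _) => a b; apply/eqP; rewrite eq_complex /= !mul0r subr0 addr0 !eqxx.
Qed.

Let affine_map_scales (r : R) w : 0 < r ->
  scales_by leb ((r^-1 * r^-1) ^+ d)
    (fun t => [tuple affine_map r w j (tnth t j) | j < d]).
Proof.
move=> r0; apply: tuple_scales_by => [|j]; last exact: plane_affine_scales_by.
by rewrite mulr_ge0 ?invr_ge0 ?ltW.
Qed.

Lemma measurable_cvec_affine d' (U : measurableType d') (r : R) w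
    (g : 'rV[R[i]]_d -> U) : 0 < r ->
  measurable_fun setT (g \o @cvec R d) ->
  measurable_fun setT (fun t => g (r%:C *: @cvec R d t + w)).
Proof.
move=> r0 mg; have [_ mT _] := affine_map_scales w r0.
apply: eq_measurable_fun (measurableT_comp mg mT) => t _.
by rewrite /= cvec_affine.
Qed.

Lemma integralC_affine (r : R) w (g : 'rV[R[i]]_d -> \bar R) : 0 < r ->
  measurable_fun setT (g \o @cvec R d) -> (forall z, (0 <= g z)%E) ->
  (integralC (fun z => g (r%:C *: z + w)%R) = ((r^-1 * r^-1) ^+ d)%:E * integralC g)%E.
Proof.
move=> r0 mg g0; have [_ _ /(_ _ mg)] := affine_map_scales w r0.
rewrite /integralC => <-; last by move=> x; exact: g0.
by apply: eq_integral => t _ /=; rewrite cvec_affine.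
Qed.

Lemma measurable_cvec_translate d' (U : measurableType d') w
    (g : 'rV[R[i]]_d -> U) : measurable_fun setT (g \o @cvec R d) ->
  measurable_fun setT (fun t => g (w + @cvec R d t)).
Proof.
move=> mg; apply: eq_measurable_fun (measurable_cvec_affine w ltr01 mg) => t _.
by rewrite scale1r addrC.
Qed.

Lemma integralC_translate w (g : 'rV[R[i]]_d -> \bar R) :
  measurable_fun setT (g \o @cvec R d) -> (forall z, (0 <= g z)%E) ->
  integralC (fun z => g (w + z)%R) = integralC g.
Proof.
move=> mg g0; have := integralC_affine w ltr01 mg g0.
rewrite (_ : (1^-1 * 1^-1) ^+ d = 1); last by rewrite invr1 mulr1 expr1n.
by rewrite mul1e => <-; apply: eq_integral => t _; rewrite scale1r addrC.
Qed.

Lemma integralC_rot (u : R[i]) (g : 'rV[R[i]]_d -> \bar R) : rnorm u = 1 ->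
  measurable_fun setT (g \o @cvec R d) -> (forall z, (0 <= g z)%E) ->
  integralC (fun z => g (u *: z)) = integralC g.
Proof.
move=> u1 mg g0.
have cs : complex.Re u ^+ 2 + complex.Im u ^+ 2 = 1 by rewrite -rnorm_sqr u1 expr1n.
have [_ _ /(_ _ mg)] := tuple_scales_by ler01 (fun j : 'I_d => plane_rot_scales_by cs).
rewrite /integralC expr1n mul1e => <-; last by move=> x; exact: g0.
apply: eq_integral => t _ /=; congr g; apply/rowP => j; rewrite !mxE tnth_mktuple /=.
by case: u {u1 cs} => a b; apply/eqP; rewrite eq_complex /= eqxx addrC eqxx.
Qed.

(* The half-open cubes of side [1 / (n + 1)] tiling [[- (n + 1), n + 1]^2d]. *)
Definition grid_node (n k : nat) : R := k%:R / n.+1%:R - n.+1%:R.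

Definition grid_index (n : nat) : finType :=
  {ffun 'I_d -> 'I_(n.+1 * n.+1).*2 * 'I_(n.+1 * n.+1).*2}.

Definition grid_cell n (j : grid_index n) : set (d.-tuple plane) :=
  [set t | forall i, grid_node n (j i).1 <= (tnth t i).1 < grid_node n (j i).1.+1 /\
                     grid_node n (j i).2 <= (tnth t i).2 < grid_node n (j i).2.+1].

Definition grid_point n (j : grid_index n) : 'rV[R[i]]_d :=
  \row_i (grid_node n (j i).1 +i* grid_node n (j i).2).

(** The index is the integer part of [(x + n + 1) (n + 1)]. *)
Lemma grid_node_inj n k l (x : R) :
  grid_node n k <= x < grid_node n k.+1 -> grid_node n l <= x < grid_node n l.+1 ->
  k = l.
Proof.
have h p : (grid_node n p <= x < grid_node n p.+1) =
    (p%:R <= (x + n.+1%:R) * n.+1%:R < p.+1%:R).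
  by rewrite /grid_node lerBlDr ltrBrDr ler_pdivrMr// ltr_pdivlMr.
by rewrite !h => /truncn_def <- /truncn_def <-.
Qed.

Lemma grid_node_ex n (x : R) : - n.+1%:R <= x < n.+1%:R ->
  exists k : 'I_(n.+1 * n.+1).*2, grid_node n k <= x < grid_node n k.+1.
Proof.
move=> /andP[x1 x2]; pose y := (x + n.+1%:R) * n.+1%:R.
have y0 : 0 <= y by rewrite mulr_ge0// -lerBlDr sub0r.
have yK : (Num.truncn y < (n.+1 * n.+1).*2)%N.
  rewrite truncn_lt_nat// -muln2 !natrM mulrAC /y ltr_pM2r//.
  by rewrite mulr_natr mulr2n ltrD2r.
exists (Ordinal yK) => /=; rewrite /grid_node lerBlDr ltrBrDr ler_pdivrMr// ltr_pdivlMr//.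
by have := truncn_itv y0.
Qed.

Lemma grid_nodeS n k : grid_node n k.+1 - grid_node n k = n.+1%:R^-1.
Proof. by rewrite /grid_node -natr1; field; rewrite gt_eqF. Qed.

Lemma grid_cell_dist n (j : grid_index n) t : grid_cell j t ->
  enorm (cvec t - grid_point j) <= d%:R * (2 / n.+1%:R).
Proof.
move=> tj; apply: enorm_le => [|i]; first by rewrite divr_ge0.
rewrite !mxE; have [/andP[a1 a2] /andP[b1 b2]] := tj i.
apply: (le_trans (rnorm_le_ReIm _)); rewrite /= !ger0_norm ?subr_ge0//.
rewrite mulrDl mul1r; apply: lerD.
  by rewrite -(grid_nodeS n (j i).1) lerD2r ltW.
by rewrite -(grid_nodeS n (j i).2) lerD2r ltW.
Qed.

Lemma grid_cell_inj n (j k : grid_index n) t : grid_cell j t -> grid_cell k t -> j = k.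
Proof.
move=> tj tk; apply/ffunP => i; have [a1 b1] := tj i; have [a2 b2] := tk i.
rewrite [LHS]surjective_pairing [RHS]surjective_pairing.
by congr (_, _); apply: val_inj; [exact: grid_node_inj a1 a2|exact: grid_node_inj b1 b2].
Qed.

Lemma grid_cell_ex t : exists n0, forall n, (n0 <= n)%N ->
  exists j : grid_index n, grid_cell j t.
Proof.
pose M := \sum_(i < d) (`|(tnth t i).1| + `|(tnth t i).2|).
exists (Num.truncn M) => n Mn.
have tM i : `|(tnth t i).1| <= M /\ `|(tnth t i).2| <= M.
  rewrite /M (bigD1 i)//=.
  have h : 0 <= \sum_(k < d | k != i) (`|(tnth t k).1| + `|(tnth t k).2|).
    by apply: sumr_ge0 => k _; exact: addr_ge0.
  have := normr_ge0 (tnth t i).1; have := normr_ge0 (tnth t i).2; lra.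
have MS : M < n.+1%:R.
  rewrite (lt_le_trans (truncnS_gt M))// ler_nat ltnS//.
have itv x : `|x| <= M -> exists k : 'I_(n.+1 * n.+1).*2, grid_node n k <= x < grid_node n k.+1.
  move=> xM; apply: grid_node_ex; have := le_lt_trans xM MS.
  by rewrite ltr_norml => /andP[/ltW -> ->].
have /choice[f fP] : forall i, exists k : 'I_(n.+1 * n.+1).*2 * 'I_(n.+1 * n.+1).*2,
    grid_node n k.1 <= (tnth t i).1 < grid_node n k.1.+1 /\
    grid_node n k.2 <= (tnth t i).2 < grid_node n k.2.+1.
  by move=> i; have [/itv[k ?] /itv[l ?]] := tM i; exists (k, l).
by exists (finfun f) => i; rewrite ffunE.
Qed.

Lemma measurable_grid_cell n (j : grid_index n) : measurable (grid_cell j).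
Proof.
have -> : grid_cell j = \bigcap_(i in [set: 'I_d])
   ((fun t => (tnth t i).1) @^-1` `[grid_node n (j i).1, grid_node n (j i).1.+1[%classic `&`
    (fun t => (tnth t i).2) @^-1` `[grid_node n (j i).2, grid_node n (j i).2.+1[%classic).
  apply/seteqP; split => t tj i; first by move=> _ /=; rewrite !in_itv; exact: tj.
  by have := tj i I; rewrite /= !in_itv.
apply: fin_bigcap_measurable => // i _; apply: measurableI.
  rewrite -[X in measurable X]setTI.
  exact: (measurableT_comp measurable_fst (measurable_tnth i)).
rewrite -[X in measurable X]setTI.
exact: (measurableT_comp measurable_snd (measurable_tnth i)).
Qed.

(** The step function with the value of [H] at the lower corner of each cell, and 0 off the grid. It
    serves both to prove measurability and to compare integrals with Riemann sums. *)
Definition grid_sum n (H : 'rV[R[i]]_d -> R) t : R :=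
  \sum_(j : grid_index n) H (grid_point j) * \1_(grid_cell j) t.

Lemma grid_sum_in n (H : 'rV[R[i]]_d -> R) (j : grid_index n) t :
  grid_cell j t -> grid_sum n H t = H (grid_point j).
Proof.
move=> tj; rewrite /grid_sum (bigD1 j)//= indicE mem_set// mulr1 big1 ?addr0// => k kj.
rewrite indicE memNset ?mulr0// => tk; move/eqP: kj; apply; exact: grid_cell_inj tk tj.
Qed.

Lemma grid_sum_notin n (H : 'rV[R[i]]_d -> R) t :
  (forall j : grid_index n, ~ grid_cell j t) -> grid_sum n H t = 0.
Proof. by move=> tj; rewrite /grid_sum big1// => j _; rewrite indicE memNset ?mulr0. Qed.

Lemma grid_sum_cvg (H : 'rV[R[i]]_d -> R) t : rcontinuous H ->
  (fun n => grid_sum n H t) @ \oo --> H (cvec t).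
Proof.
move=> Hc; have [n0 n0P] := grid_cell_ex t.
apply/cvgrPdist_lt => /= e e0.
have [r r0 rH] := rcontinuous_near (cvec t) Hc e0.
have : (fun n => d%:R * (2 / n.+1%:R) : R) @ \oo --> d%:R * (2 * 0 : R).
  by apply: cvgMr; apply: cvgMr; exact: cvg_harmonic.
rewrite !mulr0 => /cvgrPdist_lt/(_ _ r0)[n1 _ n1P].
exists (maxn n0 n1) => // n /=; rewrite geq_max => /andP[/n0P[j tj] /n1P] /=.
rewrite sub0r normrN ger0_norm ?mulr_ge0 ?divr_ge0// => dr.
rewrite (grid_sum_in _ tj); apply: rH.
by rewrite (le_lt_trans (rnorm_le_enorm _))// (le_lt_trans (grid_cell_dist tj)).
Qed.

(** A Caratheodory function, measurable in one variable and continuous in the other, is a pointwise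
    limit of jointly measurable step functions. This links the norm topology of the row vectors to
    the product sigma-algebra on tuples. *)
Lemma measurable_cvec_continuous2 d' (T : measurableType d')
    (F : T -> 'rV[R[i]]_d -> R) :
  (forall x, rcontinuous (F x)) -> (forall z, measurable_fun setT (F ^~ z)) ->
  measurable_fun setT (fun x : T * d.-tuple plane => F x.1 (cvec x.2)).
Proof.
move=> Fc Fm.
apply: (@measurable_fun_cvg _ _ _ _ (fun n x => grid_sum n (F x.1) x.2)).
  move=> n; apply: measurable_sum => j; apply: measurable_funM.
    exact: (measurableT_comp (Fm _) measurable_fst).
  have mj : measurable_fun setT (\1_(grid_cell j) : d.-tuple plane -> R).
    by apply: measurable_indic; exact: measurable_grid_cell.
  exact: (measurableT_comp mj measurable_snd).
by move=> [x t] _; apply: grid_sum_cvg; exact: Fc.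
Qed.

Lemma measurable_cvec_continuous (F : 'rV[R[i]]_d -> R) : rcontinuous F ->
  measurable_fun setT (F \o @cvec R d).
Proof.
move=> Fc; have h := @measurable_cvec_continuous2 _ RT (fun=> F) (fun=> Fc) (fun=> measurable_cst _).
exact: (measurableT_comp h (measurable_pair1 (0 : RT))).
Qed.

End IntegralCn.

Section RealContinuityTheory.
Context {R : realType}.

Lemma rcontinuous_lipschitz (V W : normedModType R[i]) (f : V -> W) (l : W -> R) :
  continuous f -> (forall x y, `|l x - l y| <= rnorm (x - y)) ->
  rcontinuous (l \o f).
Proof.
move=> fc ll z; apply/cvgrPdist_lt => /= e e0.
have := fc z => /cvgrPdist_lt/(_ e%:C); rewrite ltcR => /(_ e0).
apply: filterS => y; rewrite rnormE ltcR; exact: le_lt_trans.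
Qed.

Lemma rcontinuous_comp (V : normedModType R[i]) (F : V -> R) (phi : R -> R) :
  rcontinuous F -> continuous phi -> rcontinuous (phi \o F).
Proof. by move=> Fc phic z; apply: continuous_comp; [exact: Fc|exact: phic]. Qed.

Lemma rcontinuousM (V : normedModType R[i]) (F G : V -> R) :
  rcontinuous F -> rcontinuous G -> rcontinuous (fun z => F z * G z).
Proof. by move=> Fc Gc z; apply: cvgM; [exact: Fc|exact: Gc]. Qed.

Lemma rcontinuousD (V : normedModType R[i]) (F G : V -> R) :
  rcontinuous F -> rcontinuous G -> rcontinuous (fun z => F z + G z).
Proof. by move=> Fc Gc z; apply: cvgD; [exact: Fc|exact: Gc]. Qed.

Lemma rcontinuous_sum (V : normedModType R[i]) (I : Type) (r : seq I) (F : I -> V -> R) :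
  (forall i, rcontinuous (F i)) -> rcontinuous (fun z => \sum_(i <- r) F i z).
Proof.
move=> Fc; elim: r => [|i r IH].
  under eq_fun do rewrite big_nil; exact: cst_continuous.
by under eq_fun do rewrite big_cons; exact: rcontinuousD.
Qed.

Lemma rnorm_lipschitz (W : normedModType R[i]) (x y : W) :
  `|rnorm x - rnorm y| <= rnorm (x - y).
Proof.
have h (a b : W) : rnorm a <= rnorm b + rnorm (a - b).
  by rewrite -[X in rnorm X <= _](subrKC b a) rnormD.
have := h x y; have := h y x; rewrite -opprB rnormN ler_norml; lra.
Qed.

Lemma rcontinuous_enorm d : rcontinuous (@enorm R d).
Proof.
have coord (j : 'I_d) : rcontinuous (fun z : 'rV[R[i]]_d => rnorm (z ord0 j)).
  apply: (@rcontinuous_lipschitz _ (R[i]^o) (fun z : 'rV[R[i]]_d => z ord0 j) rnorm).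
    exact: coord_continuous.
  exact: rnorm_lipschitz.
have -> : @enorm R d = Num.sqrt \o (fun z : 'rV[R[i]]_d => \sum_(j < d) rnorm (z ord0 j) ^+ 2).
  by [].
apply: rcontinuous_comp.
  by apply: rcontinuous_sum => j; apply: rcontinuousM.
exact: sqrt_continuous.
Qed.

Lemma measurable_enorm d : measurable_fun setT (@enorm R d \o @cvec R d).
Proof. apply: measurable_cvec_continuous; exact: rcontinuous_enorm. Qed.

Lemma entire_rcontinuous d (W : normedModType R[i]) (f : 'rV[R[i]]_d -> W) (l : W -> R) :
  entire f -> (forall x y, `|l x - l y| <= rnorm (x - y)) -> rcontinuous (l \o f).
Proof.
move=> fe; apply: rcontinuous_lipschitz => z.
exact: differentiable_continuous.
Qed.

Lemma measurable_entire d (W : normedModType R[i]) (f : 'rV[R[i]]_d -> W) (l : W -> R) :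
  entire f -> (forall x y, `|l x - l y| <= rnorm (x - y)) ->
  measurable_fun setT (l \o f \o @cvec R d).
Proof. by move=> fe ll; apply: measurable_cvec_continuous; exact: entire_rcontinuous. Qed.

End RealContinuityTheory.

(** * Growth of elements of the Fock spaces *)

Section Phase.
Context {R : realType} {d : nat} (m beta : R).
Hypotheses (m1 : 1 <= m) (beta0 : 0 < beta).
Implicit Types z w : 'rV[R[i]]_d.

Definition phase z : R := beta / 2 * enorm z `^ (2 * m).

Let m20 : 0 < 2 * m. Proof. by rewrite mulr_gt0// (lt_le_trans ltr01). Qed.
Let m20' : 0 <= 2 * m. Proof. exact: ltW. Qed.
Let b20 : 0 < beta / 2. Proof. exact: divr_gt0. Qed.
Let b20' : 0 <= beta / 2. Proof. exact: ltW. Qed.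

Lemma phase_ge0 z : 0 <= phase z.
Proof. by rewrite mulr_ge0 ?powR_ge0. Qed.

Lemma phaseZ c z : phase (c *: z) = rnorm c `^ (2 * m) * phase z.
Proof. by rewrite /phase enormZ powRM ?rnorm_ge0 ?enorm_ge0// mulrCA. Qed.

Lemma measurable_phase : measurable_fun setT (phase \o @cvec R d).
Proof.
apply: measurable_funM => //.
exact: (measurableT_comp (@measurable_powR R (2 * m)) (@measurable_enorm R d)).
Qed.

Lemma weighted_normE (Y : normedModType R[i]) (f : 'rV[R[i]]_d -> Y) z :
  weighted_norm m beta f z = rnorm (f z) * expR (- phase z).
Proof. by rewrite /weighted_norm mulNr. Qed.

(** With [q ^ (2 m) = tau], the inequality [enorm z + r <= q * enorm z] holds as soon as [enorm z]
    exceeds [r / (q - 1)]; below that threshold the left-hand side is bounded, which gives [C]. *)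
Lemma phase_add (tau r : R) : 1 < tau -> 0 <= r -> exists2 C : R, 0 <= C &
  forall z w, enorm w <= r -> phase (z + w) <= tau * phase z + C.
Proof.
move=> tau1 r0; pose q := tau `^ (2 * m)^-1.
have q1 : 1 < q.
  have -> : 1 = 1 `^ (2 * m)^-1 :> R by rewrite powR1.
  by apply: gt0_ltr_powR; rewrite ?invr_gt0 ?nnegrE// ltW// (lt_trans ltr01).
have q0 : 0 <= q := powR_ge0 _ _.
have q10 : 0 < q - 1 by rewrite subr_gt0.
exists (beta / 2 * (r / (q - 1) + r) `^ (2 * m)); first by rewrite mulr_ge0 ?powR_ge0.
move=> z w wr; have zw := le_trans (enormD z w) (lerD (lexx _) wr).
have tau0 : 0 <= tau * phase z by rewrite mulr_ge0 ?phase_ge0// ltW// (lt_trans ltr01).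
have C0 : 0 <= beta / 2 * (r / (q - 1) + r) `^ (2 * m) by rewrite mulr_ge0 ?powR_ge0.
have [h|h] := leP (enorm z) (r / (q - 1)).
  apply: le_trans (ler_wpDl tau0 (lexx _)).
  rewrite ler_wpM2l// ge0_ler_powR// ?nnegrE ?enorm_ge0 ?addr_ge0 ?divr_ge0 ?(ltW q10)//.
  by rewrite (le_trans zw)// lerD2r.
apply: le_trans (ler_wpDr C0 (lexx _)).
have -> : tau * phase z = beta / 2 * (q * enorm z) `^ (2 * m).
  rewrite powRM ?enorm_ge0// -powRrM mulVf ?gt_eqF// powRr1; first by rewrite mulrCA.
  by rewrite ltW// (lt_trans ltr01).
rewrite ler_wpM2l// ge0_ler_powR// ?nnegrE ?enorm_ge0 ?mulr_ge0 ?enorm_ge0//.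
rewrite (le_trans zw)// -lerBrDl -[X in _ <= _ - X]mul1r -mulrBl mulrC.
by rewrite -ler_pdivrMr// ltW.
Qed.

(** Because [2 m >= 2], the weight dominates a Gaussian one, up to the constant that absorbs the
    points of norm less than 1. *)
Lemma phase_ge_sqr z : beta / 2 * (enorm z ^+ 2 - 1) <= phase z.
Proof.
rewrite ler_wpM2l//; have [z1|z1] := leP 1 (enorm z).
  rewrite -powR_mulrn ?enorm_ge0// (@le_trans _ _ (enorm z `^ 2))// ?gerBl//.
  by rewrite ler_powR// -[leLHS]mulr1 ler_wpM2l.
rewrite (@le_trans _ _ 0) ?powR_ge0// subr_le0 expr_le1 ?enorm_ge0//; exact: ltW.
Qed.

End Phase.

(** * Integrability of the weights and the volume of the unit ball *)

Section Gaussian.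
Context {R : realType} {d : nat}.
Local Notation mu := (@lebesgue_measure R).
Local Open Scope ereal_scope.

Lemma gaussian_line (b : R) : (0 < b)%R ->
  \int[mu]_x (expR (- b * x ^+ 2))%:E < +oo.
Proof.
move=> b0; have sb : (0 < Num.sqrt b)%R by rewrite sqrtr_gt0.
have [_ _ /(_ (EFin \o @gauss_fun R))] := lebesgue_scales_by 0%R sb.
have mg : measurable_fun setT (EFin \o @gauss_fun R).
  by apply/measurable_EFinP; exact: measurable_gauss_fun.
move=> /(_ mg)h; have -> : \int[mu]_x (expR (- b * x ^+ 2))%:E =
    \int[mu]_x (EFin \o @gauss_fun R) (Num.sqrt b * x + 0)%R.
  apply: eq_integral => x _ /=; rewrite /gauss_fun addr0 exprMn sqr_sqrtr ?mulNr//.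
  exact: ltW.
rewrite h; last by move=> x; rewrite lee_fin gauss_fun_ge0.
rewrite lte_mul_pinfty ?lee_fin ?invr_ge0 ?sqrtr_ge0//.
have /integrableP[_] := @integrableT_gauss R.
under eq_integral do rewrite gee0_abs ?lee_fin ?gauss_fun_ge0//.
by [].
Qed.

Lemma gaussian_plane (b : R) : (0 < b)%R ->
  \int[@plane_lebesgue R]_x (expR (- b * (x.1 ^+ 2 + x.2 ^+ 2)))%:E < +oo.
Proof.
move=> b0; have g0 x : 0 <= (expR (- b * x ^+ 2))%:E by rewrite lee_fin expR_ge0.
have mg : measurable_fun setT (fun x : measurableTypeR R => (expR (- b * x ^+ 2))%:E).
  by apply/measurable_EFinP; apply: measurableT_comp => //; apply: measurable_funM.
rewrite plane_integral//=; last first.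
  apply/measurable_EFinP; apply: measurableT_comp => //; apply: measurable_funM => //.
  by apply: measurable_funD; apply: measurable_funX.
have -> : \int[mu]_x \int[mu]_y (expR (- b * (x ^+ 2 + y ^+ 2)))%:E =
    \int[mu]_x ((expR (- b * x ^+ 2))%:E * \int[mu]_y (expR (- b * y ^+ 2))%:E).
  apply: eq_integral => x _; rewrite -ge0_integralZl ?lee_fin ?expR_ge0//.
  by apply: eq_integral => y _; rewrite mulrDr expRD EFinM.
rewrite ge0_integralZr//; last exact: integral_ge0.
by rewrite lte_mul_pinfty ?ge0_fin_numE ?integral_ge0// gaussian_line.
Qed.

Lemma gaussian_Cn (b : R) : (0 < b)%R ->
  integralC (fun z : 'rV[R[i]]_d => (expR (- b * enorm z ^+ 2))%:E) < +oo.
Proof.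
move=> b0.
pose phi (x : measurableTypeR R * measurableTypeR R) := expR (- b * (x.1 ^+ 2 + x.2 ^+ 2)).
have mphi : measurable_fun setT phi.
  apply: measurableT_comp => //; apply: measurable_funM => //.
  by apply: measurable_funD; apply: measurable_funX.
have -> : integralC (fun z : 'rV[R[i]]_d => (expR (- b * enorm z ^+ 2))%:E) =
    \int[lebesgueC d]_t (\prod_(j < d) phi (tnth t j))%:E.
  apply: eq_integral => t _; congr EFin; rewrite /phi -expR_sum; congr expR.
  rewrite enorm_sqr -mulr_sumr; congr (_ * _)%R; apply: eq_bigr => j _.
  by rewrite mxE rnorm_sqr.
rewrite tuple_integral_prod// => [|x]; last exact: expR_ge0.
have fin : \int[@plane_lebesgue R]_x (phi x)%:E \is a fin_num.
  rewrite ge0_fin_numE ?gaussian_plane// integral_ge0// => x _.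
  by rewrite lee_fin expR_ge0.
by rewrite -ge0_fin_numE ?expe_ge0 ?fin_numX// integral_ge0// => x _; rewrite lee_fin expR_ge0.
Qed.

Lemma phase_integrable (m beta eps : R) : (1 <= m)%R -> (0 < beta)%R -> (0 < eps)%R ->
  integralC (fun z : 'rV[R[i]]_d => (expR (- eps * phase m beta z))%:E) < +oo.
Proof.
move=> m1 b0 e0; pose b := (eps * (beta / 2))%R.
have bb : (0 < b)%R by rewrite mulr_gt0 ?divr_gt0.
have mg : measurable_fun setT (fun t => (expR (- b * enorm (@cvec R d t) ^+ 2))%:E).
  apply/measurable_EFinP; apply: measurableT_comp => //; apply: measurable_funM => //.
  by apply: measurable_funX; exact: measurable_enorm.
apply: (@le_lt_trans _ _ ((expR b)%:E * integralC (fun z : 'rV[R[i]]_d => (expR (- b * enorm z ^+ 2))%:E))).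
  rewrite /integralC -ge0_integralZl ?lee_fin ?expR_ge0//.
  apply: ge0_le_integral => //.
  - apply/measurable_EFinP; apply: measurableT_comp => //; apply: measurable_funM => //.
    exact: measurable_phase.
  - exact: measurable_funeM.
  move=> t _; rewrite -EFinM lee_fin -expRD ler_expR.
  have := phase_ge_sqr m1 b0 (cvec t); rewrite -(ler_pM2l e0) /b; lra.
by rewrite lte_mul_pinfty ?lee_fin ?expR_ge0// gaussian_Cn.
Qed.

Definition unit_ball_indic (z : 'rV[R[i]]_d) : R := (enorm z <= 1)%R%:R.

Lemma unit_ball_indic_ge0 z : (0 <= unit_ball_indic z)%R.
Proof. exact: ler0n. Qed.

Lemma measurable_unit_ball_indic :
  measurable_fun setT (unit_ball_indic \o @cvec R d).
Proof.
have -> : unit_ball_indic \o @cvec R d =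
    \1_((@enorm R d \o @cvec R d) @^-1` `]-oo, 1%R]%classic).
  apply/funext => t; rewrite /unit_ball_indic /= indicE; congr (nat_of_bool _)%:R.
  by apply/idP/idP; rewrite inE /= in_itv.
apply: measurable_indic; rewrite -[X in measurable X]setTI.
by apply: measurable_enorm => //; exact: measurable_itv.
Qed.

Definition unit_ball_volume := integralC (fun z => (unit_ball_indic z)%:E).

Lemma unit_ball_volume_fin_num : unit_ball_volume \is a fin_num.
Proof.
rewrite ge0_fin_numE; last by apply: integral_ge0 => t _; rewrite lee_fin unit_ball_indic_ge0.
apply: (@le_lt_trans _ _ ((expR 1)%:E * integralC (fun z : 'rV[R[i]]_d => (expR (- 1 * enorm z ^+ 2))%:E))).
  have mg : measurable_fun setT (fun t => (expR (- 1 * enorm (@cvec R d t) ^+ 2))%:E).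
    apply/measurable_EFinP; apply: measurableT_comp => //; apply: measurable_funM => //.
    by apply: measurable_funX; exact: measurable_enorm.
  rewrite /unit_ball_volume /integralC -ge0_integralZl ?lee_fin ?expR_ge0//.
  apply: ge0_le_integral => //.
  - by move=> t _; rewrite lee_fin unit_ball_indic_ge0.
  - by apply/measurable_EFinP; exact: measurable_unit_ball_indic.
  - exact: measurable_funeM.
  move=> t _; rewrite -EFinM lee_fin -expRD /unit_ball_indic.
  have [t1|_] := leP (enorm (cvec t)) 1%R; last exact: expR_ge0.
  by rewrite -[leLHS]expR0 ler_expR mulN1r subr_ge0 expr_le1 ?enorm_ge0.
by rewrite lte_mul_pinfty ?lee_fin ?expR_ge0// gaussian_Cn.
Qed.

Lemma unit_ball_volume_gt0 : 0 < unit_ball_volume.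
Proof.
(* A product of squares of side [e] fits in the unit ball, since [d * (e + e) = d / (d + 1)]; the
   successor keeps [e] positive when [d = 0]. *)
pose e : R := (2 * d.+1%:R)^-1%R.
have e0 : (0 < e)%R by rewrite invr_gt0 mulr_gt0.
pose Q : set (measurableTypeR R * measurableTypeR R) := `[0%R, e]%classic `*` `[0%R, e]%classic.
have mQ : measurable Q by apply: measurableX; exact: measurable_itv.
have mu_e : mu `[0%R, e]%classic = e%:E.
  by rewrite lebesgue_measure_itv/= lte_fin e0 sube0.
have Q2 : \int[@plane_lebesgue R]_x (\1_Q x)%:E = (e * e)%:E.
  rewrite integral_indic// setIT EFinM -mu_e.
  by apply: product_measure1E; exact: measurable_itv.
have : \int[lebesgueC d]_t (\prod_(j < d) \1_Q (tnth t j))%:E = ((e * e) ^+ d)%:E.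
  by rewrite tuple_integral_prod// ?Q2 ?EFin_expe//.
move=> volQ; apply: (@lt_le_trans _ _ ((e * e) ^+ d)%:E).
  by rewrite lte_fin exprn_gt0// mulr_gt0.
rewrite -volQ; apply: ge0_le_integral => //.
- by move=> t _; rewrite lee_fin prodr_ge0// => j _; rewrite indicE.
- apply/measurable_EFinP; apply: measurable_prod => j _.
  have mi : measurable_fun setT (\1_Q : _ -> R) by exact: measurable_indic.
  exact: (measurableT_comp mi (measurable_tnth j)).
- by apply/measurable_EFinP; exact: measurable_unit_ball_indic.
move=> t _; rewrite lee_fin /unit_ball_indic.
have [tQ|/existsNP[j tj]] := pselect (forall j, Q (tnth t j)); last first.
  by rewrite (bigD1 j)//= indicE memNset// mul0r ler0n.
rewrite big1 => [|j _]; last by rewrite indicE mem_set.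
have -> // : (enorm (cvec t) <= 1)%R.
apply: (@le_trans _ _ (d%:R * (e + e))%R).
  apply: enorm_le => [|j]; first by rewrite addr_ge0// ltW.
  rewrite !mxE; have [] := tQ j; rewrite /= !in_itv/= => /andP[a0 ae] /andP[b0 be].
  by rewrite (le_trans (rnorm_le_ReIm _))//= !ger0_norm// lerD.
have -> : (d%:R * (e + e) = d%:R / d.+1%:R)%R by rewrite /e; field; rewrite gt_eqF.
by rewrite ler_pdivrMr// mul1r ler_nat.
Qed.

End Gaussian.

(** * Complex functionals and submean inequalities *)

Section ComplexFunctional.
Context {R : realType} {Y : normedModType R[i]}.

Definition clinear (l : Y -> R[i]) :=
  (forall x y, l (x + y) = l x + l y) /\ (forall c x, l (c *: x) = c * l x).

(* A norming real-linear functional [u] gives the complex-linear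
   [u x - i u (i x)]. *)
Lemma complex_functional (v : Y) : exists l : Y -> R[i],
  [/\ clinear l, forall x, rnorm (l x) <= 2 * rnorm x,
      forall x, complex.Re (l x) <= rnorm x & complex.Re (l v) = rnorm v].
Proof.
have [u [uD uZ ule uv]] := hahn_banach v.
have rI : rnorm ('i : R[i]) = 1.
  by apply/eqP; rewrite -(@eqrXn2 _ 2)// ?rnorm_ge0// rnorm_sqr /= expr0n !expr1n add0r.
exists (fun x => u x +i* (- u ('i *: x))); split => //.
- split => [x y|c x].
    by rewrite scalerDr !uD opprD; apply/eqP; rewrite eq_complex /= !eqxx.
  have c1 : c = (complex.Re c)%:C + (complex.Im c)%:C * 'i.
    by case: c => a b; apply/eqP; rewrite eq_complex /=; apply/andP; split; apply/eqP; ring.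
  have c2 : 'i * c = (complex.Re c)%:C * 'i + (- complex.Im c)%:C.
    by case: c {c1} => a b; apply/eqP; rewrite eq_complex /=; apply/andP; split; apply/eqP; ring.
  have u1 : u (c *: x) = complex.Re c * u x + complex.Im c * u ('i *: x).
    by rewrite {1}c1 scalerDl uD uZ -scalerA uZ.
  have u2 : u ('i *: (c *: x)) = complex.Re c * u ('i *: x) - complex.Im c * u x.
    by rewrite scalerA c2 scalerDl uD -scalerA !uZ mulNr.
  rewrite u1 u2; case: {c1 c2 u1 u2} c => a b; apply/eqP; rewrite eq_complex /=.
  by apply/andP; split; apply/eqP; ring.
- move=> x; rewrite (le_trans (rnorm_le_ReIm _))//= normrN mulr_natl mulr2n.
  apply: lerD; first exact: ule.
  by apply: (le_trans (ule _)); rewrite rnormZ rI mul1r.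
- by move=> x /=; rewrite (le_trans (ler_norm _)).
Qed.

(** The passage from several variables to one: on a complex line, after a functional, [f] becomes a
    function to which [circle_mean] and [circle_vanishing] apply. *)
Lemma cderivable_line (V : normedModType R[i]) (f : V -> Y) (l : Y -> R[i])
    (z w : V) (c : R[i]) : clinear l -> (forall x, rnorm (l x) <= 2 * rnorm x) ->
  differentiable f (z + c *: w) -> cderivable (fun k => l (f (z + k *: w))) c.
Proof.
move=> [lD lZ] l2 df; exists (l ('d f (z + c *: w) w)) => e e0.
have lB x y : l (x - y) = l x - l y by rewrite lD -scaleN1r lZ mulN1r.
have w1 : 0 < rnorm w + 1 by rewrite ltr_wpDl ?rnorm_ge0.
have [|r r0 fr] := differentiable_rnorm df (e := e / 2 / (rnorm w + 1)).
  by rewrite !divr_gt0.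
exists (r / (rnorm w + 1)); first exact: divr_gt0.
move=> h; rewrite ltr_pdivlMr// => hr.
have hw : rnorm (h *: w) <= rnorm h * (rnorm w + 1).
  by rewrite rnormZ ler_wpM2l ?rnorm_ge0// lerDl.
rewrite scalerDl addrA [_ * h]mulrC -lZ.
have <- : 'd f (z + c *: w) (h *: w) = h *: 'd f (z + c *: w) w by exact: linearZ.
rewrite -!lB; apply: (le_trans (l2 _)).
apply: (@le_trans _ _ (2 * (e / 2 / (rnorm w + 1) * (rnorm h * (rnorm w + 1))))).
  rewrite ler_wpM2l//; apply: (le_trans (fr _ (le_lt_trans hw hr))).
  by rewrite ler_wpM2l// !divr_ge0 ?(ltW e0) ?(ltW w1).
by rewrite le_eqVlt; apply/orP; left; apply/eqP; field; rewrite gt_eqF.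
Qed.

Local Notation mu := (@lebesgue_measure R).

Lemma continuous_circle (V : normedModType R[i]) (F : V -> R) (z w : V) :
  rcontinuous F -> continuous (fun y : R => F (z + cis y *: w)).
Proof.
move=> Fc y; apply/cvgrPdist_lt => /= e e0.
have [r r0 rF] := rcontinuous_near (z + cis y *: w) Fc e0.
pose k := r / 2 / (rnorm w + 1).
have w1 : 0 < rnorm w + 1 by rewrite ltr_wpDl ?rnorm_ge0.
have k0 : 0 < k by rewrite !divr_gt0.
near=> x; apply: rF.
rewrite opprD addrACA subrr add0r -scalerBl rnormZ.
have cx : `|cos y - cos x| < k by near: x; have /cvgrPdist_lt/(_ _ k0) := @continuous_cos R y.
have sx : `|sin y - sin x| < k by near: x; have /cvgrPdist_lt/(_ _ k0) := @continuous_sin R y.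
apply: (@le_lt_trans _ _ (rnorm (cis y - cis x) * (rnorm w + 1))).
  by rewrite ler_wpM2l ?rnorm_ge0// lerDl.
rewrite -ltr_pdivlMr// (le_lt_trans (rnorm_le_ReIm _))//=.
have -> : r / (rnorm w + 1) = k + k by rewrite /k; field; rewrite gt_eqF.
exact: ltrD.
Unshelve. all: by end_near. Qed.

(** The functional [l] norms the central value [f z], while [Re (l x) <= ||x||] everywhere; the mean
    value property of [Re (l f)] thus becomes a submean inequality for the norm. *)
Lemma circle_submean d (f : 'rV[R[i]]_d -> Y) z w : entire f ->
  ((2 * pi * rnorm (f z))%:E <=
   \int[mu]_(y in `[0%R, (2 * pi)%R]) (rnorm (f (z + cis y *: w)%R))%:E)%E.
Proof.
move=> fe; have [l [lL l2 lre lfz]] := complex_functional (f z).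
have pi20 : 0 <= 2 * pi :> R by rewrite mulr_ge0 ?pi_ge0.
have := @circle_mean R (fun k => l (f (z + k *: w))).
rewrite scale0r addr0 lfz => mean.
have fc : rcontinuous (fun z => rnorm (f z)).
  exact: (entire_rcontinuous fe (@rnorm_lipschitz _ _)).
have lc : rcontinuous (fun z => complex.Re (l (f z))).
  apply: (entire_rcontinuous (l := fun y => complex.Re (l y)) fe) => x y.
  have [lD lZ] := lL; have lN a : l (- a) = - l a by rewrite -scaleN1r lZ mulN1r.
  rewrite -raddfB -lN -lD ler_norml lre andbT lerNl -raddfN -lN.
  by rewrite (le_trans (lre _))// rnormN.
have ic : mu.-integrable `[0, 2 * pi] (EFin \o (fun y => rnorm (f (z + cis y *: w)))).
  by apply: continuous_itv_integrable => y _; exact: (continuous_circle fc).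
have il : mu.-integrable `[0, 2 * pi] (EFin \o (fun y => complex.Re (l (f (z + cis y *: w))))).
  by apply: continuous_itv_integrable => y _; exact: (continuous_circle lc).
have le_int : \int[mu]_(y in `[0, 2 * pi]) complex.Re (l (f (z + cis y *: w))) <=
    \int[mu]_(y in `[0, 2 * pi]) rnorm (f (z + cis y *: w)).
  by apply: le_Rintegral.
have <- : (\int[mu]_(y in `[0, 2 * pi]) rnorm (f (z + cis y *: w)))%:E =
    (\int[mu]_(y in `[0%R, (2 * pi)%R]) (rnorm (f (z + cis y *: w)%R))%:E)%E.
  by rewrite fineK//; exact: integrable_fin_num.
rewrite lee_fin [leLHS]mulrC -mean// => k _.
exact: (cderivable_line lL l2 (fe (z + k *: w))).
Qed.

End ComplexFunctional.

Lemma near_rcontinuous (R : realType) (V : normedModType R[i]) (F : V -> R) :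
  (forall z e, 0 < e -> exists2 r : R, 0 < r &
     forall y, rnorm (z - y) < r -> `|F z - F y| < e) -> rcontinuous F.
Proof.
move=> FP z; apply/cvgrPdist_lt => /= e e0; have [r r0 rF] := FP z e e0.
apply/nbhs_ballP; exists r%:C; first by rewrite /= ltcR.
by move=> y; rewrite -ball_normE /ball_/= rnormE ltcR; exact: rF.
Qed.

Lemma rcontinuous_affine (R : realType) (V : normedModType R[i]) (F : V -> R) z c :
  rcontinuous F -> rcontinuous (fun w => F (z + c *: w)).
Proof.
move=> Fc; apply: near_rcontinuous => w e e0.
have [r r0 rF] := rcontinuous_near (z + c *: w) Fc e0.
have c1 : 0 < rnorm c + 1 by rewrite ltr_wpDl ?rnorm_ge0.
exists (r / (rnorm c + 1)); first exact: divr_gt0.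
move=> y; rewrite ltr_pdivlMr// => yr; apply: rF.
rewrite opprD addrACA subrr add0r -scalerBr rnormZ mulrC.
by apply: le_lt_trans yr; rewrite ler_wpM2l ?rnorm_ge0// lerDl.
Qed.

Section Submean.
Context {R : realType} {d : nat}.
Local Notation mu := (@lebesgue_measure R).
Local Open Scope ereal_scope.

(** Integrate [circle_submean] over [w] in the unit ball and exchange the integrals. For each angle
    the rotation of [w] preserves the measure and the ball, so the inner integral is the same [A]
    for all angles. *)
Lemma ball_submean (Y : normedModType R[i]) (f : 'rV[R[i]]_d -> Y) z : entire f ->
  (rnorm (f z))%:E * @unit_ball_volume R d <=
  integralC (fun w => (unit_ball_indic w * rnorm (f (z + w)))%:E).
Proof.
move=> fe; set A := (X in _ <= X).
have pi20 : (0 < 2 * pi :> R)%R by rewrite mulr_gt0 ?pi_gt0.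
pose D : set (measurableTypeR R) := `[0%R, (2 * pi)%R]%classic.
have mD : measurable D by exact: measurable_itv.
have muD : mu D = (2 * pi)%:E by rewrite lebesgue_measure_itv/= lte_fin pi20 sube0.
have fc : rcontinuous (fun z => rnorm (f z)).
  exact: (entire_rcontinuous fe (@rnorm_lipschitz _ _)).
have fz : rcontinuous (fun w : 'rV[R[i]]_d => rnorm (f (z + w)%R)).
  have -> : (fun w : 'rV[R[i]]_d => rnorm (f (z + w)%R)) = (fun w => rnorm (f (z + 1%R *: w)%R)).
    by apply/funext => w; rewrite scale1r.
  exact: (@rcontinuous_affine _ _ _ z 1%R fc).
pose F (x : measurableTypeR R * d.-tuple (measurableTypeR R * measurableTypeR R)) :=
  (unit_ball_indic (cvec x.2) * rnorm (f (z + cis x.1 *: cvec x.2)))%R.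
have F0 x : (0 <= F x)%R by rewrite mulr_ge0 ?unit_ball_indic_ge0 ?rnorm_ge0.
have mF : measurable_fun setT F.
  apply: measurable_funM.
    exact: (measurableT_comp (@measurable_unit_ball_indic R d) measurable_snd).
  apply: (@measurable_cvec_continuous2 R d _ (measurableTypeR R)
    (fun y w => rnorm (f (z + cis y *: w)%R))) => [y|w].
    exact: (@rcontinuous_affine _ _ _ z (cis y) fc).
  apply: continuous_measurable_fun; exact: (continuous_circle fc).
(* The interval of angles enters as an indicator so that Tonelli applies on the full product. *)
have mFD : measurable_fun setT (fun x => ((F x) * \1_D x.1)%:E).
  apply/measurable_EFinP; apply: measurable_funM => //.
  have mi : measurable_fun setT (\1_D : _ -> R) by exact: measurable_indic.
  exact: (measurableT_comp mi measurable_fst).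
have FD0 x : 0 <= ((F x) * \1_D x.1)%:E.
  by rewrite lee_fin mulr_ge0// indicE.
have swap := fubini_tonelli (m1 := mu) (m2 := @lebesgueC R d) _ mFD FD0.
have rot y : \int[@lebesgueC R d]_t (F (y, t) * \1_D y)%:E = (\1_D y)%:E * A.
  have <- : integralC (fun w => (unit_ball_indic w * rnorm (f (z + cis y *: w)%R))%:E) = A.
    rewrite /A -(@integralC_rot _ _ (cis y)
      (fun w => (unit_ball_indic w * rnorm (f (z + w)%R))%:E) (rnorm_cis y)).
    - by apply: eq_integral => t _; rewrite /unit_ball_indic enormZ rnorm_cis mul1r.
    - apply/measurable_EFinP; apply: measurable_funM.
        exact: measurable_unit_ball_indic.
      exact: (measurable_cvec_continuous fz).
    - by move=> w; rewrite lee_fin mulr_ge0 ?unit_ball_indic_ge0 ?rnorm_ge0.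
  rewrite /integralC -ge0_integralZl//.
  - by apply: eq_integral => t _; rewrite -EFinM mulrC.
  - apply/measurable_EFinP; exact: (measurableT_comp mF (measurable_pair1 y)).
  - by move=> t _; rewrite lee_fin mulr_ge0 ?unit_ball_indic_ge0 ?rnorm_ge0.
have A0 : 0 <= A.
  by apply: integral_ge0 => t _; rewrite lee_fin mulr_ge0 ?unit_ball_indic_ge0 ?rnorm_ge0.
have lhs : \int[mu]_y \int[@lebesgueC R d]_t (F (y, t) * \1_D y)%:E = (2 * pi)%:E * A.
  under eq_integral do rewrite rot.
  rewrite ge0_integralZr//.
  - by rewrite integral_indic// setIT; congr (_ * A); exact: muD.
  - by apply/measurable_EFinP; exact: measurable_indic.
suff : (2 * pi)%:E * ((rnorm (f z))%:E * @unit_ball_volume R d) <= (2 * pi)%:E * A.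
  by rewrite lee_pmul2l// lte_fin.
rewrite -lhs swap muleA -EFinM /unit_ball_volume /integralC -ge0_integralZl//; last 3 first.
- by apply/measurable_EFinP; exact: measurable_unit_ball_indic.
- by move=> t _; rewrite lee_fin unit_ball_indic_ge0.
- by rewrite lee_fin mulr_ge0 ?rnorm_ge0// ltW.
apply: ge0_le_integral => //.
- by move=> t _; rewrite lee_fin mulr_ge0 ?unit_ball_indic_ge0// mulr_ge0 ?rnorm_ge0// ltW.
- apply: measurable_funeM; apply/measurable_EFinP; exact: measurable_unit_ball_indic.
- exact: (measurable_section_integral2 mu mFD FD0).
move=> t _; have := circle_submean z (cvec t) fe.
rewrite integral_mkcond => h.
have -> : \int[mu]_y (F (y, t) * \1_D y)%:E =
    (unit_ball_indic (cvec t))%:E *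
    \int[mu]_y (((fun y => (rnorm (f (z + cis y *: cvec t)))%:E) \_ D) y).
  rewrite -ge0_integralZl//.
  - apply: eq_integral => y _; rewrite /F /= patchE indicE.
    by case: (y \in D); rewrite ?mulr1 ?mulr0 ?mule0// -EFinM.
  - apply/(measurable_restrictT _ _).1 => //; apply/measurable_EFinP.
    apply: measurable_funTS; apply: continuous_measurable_fun; exact: (continuous_circle fc).
  - by move=> y _; rewrite patchE; case: ifP => // _; rewrite lee_fin rnorm_ge0.
  - by rewrite lee_fin unit_ball_indic_ge0.
by rewrite muleC lee_wpmul2l// lee_fin unit_ball_indic_ge0.
Qed.

End Submean.

Section Growth.
Context {R : realType} {d : nat} (m beta : R).
Hypotheses (m1 : 1 <= m) (beta0 : 0 < beta).

Lemma measurable_rnorm_entire (Y : normedModType R[i]) (f : 'rV[R[i]]_d -> Y) :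
  entire f -> measurable_fun setT (fun t => rnorm (f (@cvec R d t))).
Proof.
by move=> fe; exact: (measurable_entire fe (@rnorm_lipschitz _ _)).
Qed.

Lemma measurable_weighted_norm (Y : normedModType R[i]) (f : 'rV[R[i]]_d -> Y) (p : R) :
  entire f -> measurable_fun setT (fun t => weighted_norm m beta f (@cvec R d t) `^ p).
Proof.
move=> fe; have mw : measurable_fun setT (fun t => weighted_norm m beta f (@cvec R d t)).
  have -> : (fun t => weighted_norm m beta f (@cvec R d t)) =
      (fun t => rnorm (f (cvec t)) * expR (- phase m beta (cvec t))).
    by apply/funext => t; exact: weighted_normE.
  apply: measurable_funM; first exact: measurable_rnorm_entire.
  apply: measurableT_comp => //; apply: measurableT_comp => //.
  exact: measurable_phase.
exact: (measurableT_comp (@measurable_powR R p) mw).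
Qed.

Lemma weighted_norm_ge0 (Y : normedModType R[i]) (f : 'rV[R[i]]_d -> Y) z :
  0 <= weighted_norm m beta f z.
Proof. by rewrite weighted_normE mulr_ge0 ?rnorm_ge0 ?expR_ge0 ?E0. Qed.

Lemma rnorm_weighted (Y : normedModType R[i]) (f : 'rV[R[i]]_d -> Y) z :
  rnorm (f z) = weighted_norm m beta f z * expR (phase m beta z).
Proof. by rewrite weighted_normE -mulrA -expRD addNr expR0 mulr1. Qed.

(** Above the threshold [s] one has [x / s <= (x / s) ^ p]. This linear substitute for Hoelder's
    inequality bounds a mean by an integral of [p]-th powers. *)
Lemma ler_truncated_powR (p s x : R) : 1 <= p -> 0 < s -> 0 <= x ->
  x <= s + s `^ (1 - p) * x `^ p.
Proof.
move=> p1 s0 x0; have h0 : 0 <= s `^ (1 - p) * x `^ p by rewrite mulr_ge0 ?powR_ge0.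
have [xs|sx] := leP x s; first by rewrite (le_trans xs)// lerDl.
rewrite ler_wpDl ?(ltW s0)//.
have -> : s `^ (1 - p) * x `^ p = (x / s) `^ p * s.
  have -> : x `^ p = (x / s) `^ p * s `^ p.
    by rewrite -powRM ?divr_ge0 ?(ltW s0)// divfK ?gt_eqF.
  rewrite mulrCA -powRD ?subrK ?powRr1 ?(ltW s0)//.
  by apply/implyP => _; rewrite gt_eqF.
rewrite -[leLHS](@divfK _ s) ?gt_eqF// ler_wpM2r ?(ltW s0)// le1r_powR//.
by rewrite ler_pdivlMr// mul1r ltW.
Qed.

Lemma le_divr_volume (x E s v X : R) : 0 <= E -> 0 <= s -> 0 < v -> 0 <= X ->
  x * v <= E * (s * v + X) -> x <= E * ((1 + v^-1) * (s + X)).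
Proof.
move=> E0 s0 v0 X0 xv; have vi : 0 <= v^-1 by rewrite invr_ge0 ltW.
have {xv} : x <= E * (s * v + X) / v by rewrite ler_pdivlMr.
move=> /le_trans; apply; have -> : E * (s * v + X) / v = E * (s + v^-1 * X).
  by field; rewrite gt_eqF.
apply: ler_wpM2l => //.
by have := mulr_ge0 vi s0; have := mulr_ge0 vi X0; lra.
Qed.

(* The free scale [s] makes the right-hand side small when [I] is. *)
Lemma fock_growth (p tau : R) : 1 <= p -> 1 < tau -> exists2 C : R, 0 <= C &
  forall (Y : normedModType R[i]) (f : 'rV[R[i]]_d -> Y) (I s : R), entire f ->
  (integralC (fun z => (weighted_norm m beta f z `^ p)%:E) <= I%:E)%E -> 0 < s ->
  forall z, rnorm (f z) <= C * expR (tau * phase m beta z) * (s + s `^ (1 - p) * I).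
Proof.
move=> p1 tau1; have [C0 C00 C0P] := @phase_add R d m beta m1 beta0 tau 1 tau1 ler01.
have [v v0 vE] : exists2 v : R, 0 < v & @unit_ball_volume R d = v%:E.
  exists (fine (@unit_ball_volume R d)); last by rewrite fineK ?unit_ball_volume_fin_num.
  by rewrite -lte_fin fineK ?unit_ball_volume_fin_num ?unit_ball_volume_gt0.
exists (expR C0 * (1 + v^-1)); first by rewrite mulr_ge0 ?expR_ge0 ?E0// addr_ge0// invr_ge0 ltW.
move=> Y f I s fe fI s0 z.
have s0' := ltW s0.
pose E := expR (tau * phase m beta z + C0).
pose W w := weighted_norm m beta f (z + w) `^ p.
have W0 w : 0 <= W w by exact: powR_ge0.
have mWf := measurable_weighted_norm p fe.
have WI : integralC (fun w => (W w)%:E) = integralC (fun z => (weighted_norm m beta f z `^ p)%:E).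
  apply: (@integralC_translate _ _ z (fun w => (weighted_norm m beta f w `^ p)%:E)).
    exact/measurable_EFinP.
  by move=> w; rewrite lee_fin powR_ge0.
have mW : measurable_fun setT (fun t => W (@cvec R d t)).
  exact: (measurable_cvec_translate z (g := fun w => weighted_norm m beta f w `^ p) mWf).
have I0 : 0 <= I.
  by rewrite -lee_fin; apply: le_trans fI; apply: integral_ge0 => t _; rewrite lee_fin powR_ge0.
have E0 : 0 <= E by exact: expR_ge0.
have EE : E = expR (tau * phase m beta z) * expR C0 by exact: expRD.
move: E E0 EE => E E0 EE.
suff : ((rnorm (f z))%:E * v%:E <= (E * (s * v + s `^ (1 - p) * I))%:E)%E.
  rewrite -EFinM lee_fin => /(le_divr_volume E0 s0' v0 (mulr_ge0 (powR_ge0 _ _) I0)).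
  move=> /le_trans; apply; rewrite EE le_eqVlt; apply/orP; left; apply/eqP; ring.
(* On the unit ball [phase_add] bounds the inverse weight by [E], and [ler_truncated_powR] passes to
   the [p]-th power. The power term carries no indicator: its integral over the whole space is at
   most [I]. *)
have pt w : unit_ball_indic w * rnorm (f (z + w)) <=
    E * s * unit_ball_indic w + E * s `^ (1 - p) * W w.
  have sW : 0 <= E * s `^ (1 - p) * W w.
    by apply: mulr_ge0 (W0 w); apply: mulr_ge0 E0 (powR_ge0 _ _).
  rewrite /unit_ball_indic; have [w1|_] := leP (enorm w) 1; last first.
    by rewrite mul0r mulr0 add0r.
  rewrite mul1r mulr1 rnorm_weighted /W.
  have := weighted_norm_ge0 f (z + w); move: (weighted_norm _ _ _ _) => wn wn0.
  apply: (@le_trans _ _ (wn * E)).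
    by apply: (ler_wpM2l wn0); rewrite EE -expRD ler_expR; exact: C0P.
  rewrite mulrC -mulrA -mulrDr; apply: (ler_wpM2l E0).
  exact: ler_truncated_powR.
have mfz : measurable_fun setT (fun t => rnorm (f (z + @cvec R d t))).
  exact: (measurable_cvec_translate z (g := fun w => rnorm (f w)) (measurable_rnorm_entire fe)).
have mball := @measurable_unit_ball_indic R d.
have submean := ball_submean z fe.
have fz0 w : 0 <= unit_ball_indic w * rnorm (f (z + w)).
  by rewrite mulr_ge0 ?unit_ball_indic_ge0 ?rnorm_ge0.
move: (fun w => rnorm (f (z + w))) mfz submean pt fz0 => fz mfz.
clear C0P EE mWf; move: W W0 mW WI => W W0 mW WI submean pt fz0.
rewrite -vE; apply: (le_trans submean).
apply: (@le_trans _ _ (integralC (fun w => (E * s * unit_ball_indic w)%:E + (E * s `^ (1 - p) * W w)%:E))%E).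
  apply: ge0_le_integral => //.
  - by move=> t _; rewrite lee_fin.
  - by apply/measurable_EFinP; apply: measurable_funM.
  - by apply: emeasurable_funD; apply/measurable_EFinP; apply: measurable_funM.
  by move=> t _; rewrite -EFinD lee_fin.
rewrite /integralC ge0_integralD//; last 4 first.
- by move=> t _; rewrite lee_fin !mulr_ge0 ?expR_ge0 ?E0 ?unit_ball_indic_ge0.
- apply/measurable_EFinP; apply: measurable_funM => //; exact: measurable_unit_ball_indic.
- by move=> t _; rewrite lee_fin !mulr_ge0 ?powR_ge0 ?expR_ge0 ?E0.
- by apply/measurable_EFinP; apply: measurable_funM.
have Es0 : 0 <= E * s by rewrite mulr_ge0 ?expR_ge0 ?E0.
have Esp0 : 0 <= E * s `^ (1 - p) by rewrite mulr_ge0 ?powR_ge0 ?expR_ge0 ?E0.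
under eq_integral do rewrite EFinM.
rewrite ge0_integralZl//; last 2 first.
- apply/measurable_EFinP; exact: measurable_unit_ball_indic.
- by move=> t _; rewrite lee_fin unit_ball_indic_ge0.
under [X in (_ + X)%E]eq_integral do rewrite EFinM.
rewrite ge0_integralZl//; last 2 first.
- by apply/measurable_EFinP.
- by move=> t _; rewrite lee_fin.
rewrite -[X in (_ * X + _)%E]/(@unit_ball_volume R d) vE.
rewrite -[X in (_ + _ * X)%E]/(integralC (fun w => (W w)%:E)) WI.
rewrite mulrDr !mulrA EFinD -EFinM leeD2l//.
by rewrite (EFinM _ I); apply: lee_wpmul2l.
Qed.

End Growth.

(** * The reproducing kernel *)

Section SignedIntegral.
Context {R : realType} {d : nat}.
Implicit Type h : 'rV[R[i]]_d -> R.

Lemma integralC_posneg h :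
  integralC (fun z => (h z)%:E) =
  (integralC (fun z => (Num.max (h z) 0)%:E) -
   integralC (fun z => (Num.max (- h z) 0)%:E))%E.
Proof.
rewrite /integralC integralE; congr (_ - _)%E; apply: eq_integral => t _.
  by rewrite funeposE EFin_max.
by rewrite funenegE -EFinN EFin_max.
Qed.

(** The positive and negative parts trade places; if one of them has infinite integral, [fine]
    returns 0 on both sides. *)
Lemma fine_integralC_opp h :
  fine (integralC (fun z => (- h z)%:E)) = - fine (integralC (fun z => (h z)%:E)).
Proof.
rewrite (integralC_posneg h) (integralC_posneg (fun z => - h z)).
under [X in fine (_ - X)]eq_integral do rewrite opprK.
have : (0 <= integralC (fun z => (Num.max (h z) 0)%:E))%E.
  by apply: integral_ge0 => t _; rewrite lee_fin le_max lexx orbT.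
have : (0 <= integralC (fun z => (Num.max (- h z) 0)%:E))%E.
  by apply: integral_ge0 => t _; rewrite lee_fin le_max lexx orbT.
rewrite /integralC.
move: (\int[_]_t _)%E => x; move: (\int[_]_t _)%E => y.
by case: x => [x| |]; case: y => [y| |] //= _ _; rewrite ?oppr0// opprB.
Qed.

Lemma integralC_rot_signed (u : R[i]) h : rnorm u = 1 ->
  measurable_fun setT (h \o @cvec R d) ->
  integralC (fun z => (h (u *: z))%:E) = integralC (fun z => (h z)%:E).
Proof.
move=> u1 mh; rewrite (integralC_posneg h) (integralC_posneg (fun z => h (u *: z))).
congr (_ - _)%E.
  apply: (@integralC_rot _ _ u (fun z => (Num.max (h z) 0)%:E)) => // [|z].
    by apply/measurable_EFinP; apply: measurable_maxr.
  by rewrite lee_fin le_max lexx orbT.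
apply: (@integralC_rot _ _ u (fun z => (Num.max (- h z) 0)%:E)) => // [|z].
  apply/measurable_EFinP; apply: measurable_maxr => //.
  exact: measurableT_comp.
by rewrite lee_fin le_max lexx orbT.
Qed.

End SignedIntegral.

Section Kernel.
Context {R : realType} {d : nat} (m beta : R).
Variable K : 'rV[R[i]]_d -> 'rV[R[i]]_d -> R[i].
Hypotheses (m1 : 1 <= m) (beta0 : 0 < beta) (hK : reproducing_kernel m beta K).
Implicit Types (z a w : 'rV[R[i]]_d) (f g : 'rV[R[i]]_d -> R[i]).
Local Notation c := (fock_const d m beta).
Local Notation N := (@phase R d m beta).
Local Notation H := (@fock_hilbert R d m beta).
Local Notation inner := (@fock_inner R d m beta).
Local Notation rho := (@fock_density R d m beta).

Lemma fock_densityE z : rho z = c * expR (- 2 * N z).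
Proof. by rewrite /fock_density /phase; congr (_ * expR _); field. Qed.

Lemma fock_const_ge0 : 0 <= c.
Proof.
have G0 s : 0 <= Gamma s :> R.
  by apply: Rintegral_ge0 => x _; rewrite mulr_ge0 ?powR_ge0 ?expR_ge0.
rewrite /fock_const !mulr_ge0 ?powR_ge0 ?invr_ge0 ?exprn_ge0 ?pi_ge0 ?G0//.
exact: le_trans m1.
Qed.

(* Were the constant zero, the density would vanish, contradicting
   [1 = <1, K_a>]. *)
Lemma fock_const_gt0 : 0 < c.
Proof.
rewrite lt_neqAle fock_const_ge0 andbT eq_sym; apply/eqP => c0.
have rho0 z : rho z = 0 by rewrite fock_densityE c0 mul0r.
have int0 (F : 'rV[R[i]]_d -> \bar R) : (forall z, F z = 0%E) -> integralC F = 0%E.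
  by move=> F0; rewrite /integralC integral0_eq.
have H1 : H (fun=> 1).
  split; first by move=> z; exact: differentiable_cst.
  by rewrite int0 ?ltry// => z; rewrite rho0 mulr0.
have [_ /(_ _ H1)/eqP] := hK 0.
rewrite /fock_inner /cintegralC !int0 => [|z|z]; try by rewrite rho0 mulr0.
by rewrite /= oner_eq0.
Qed.

Lemma rho_ge0 z : 0 <= rho z.
Proof. by rewrite fock_densityE mulr_ge0 ?expR_ge0// ltW// fock_const_gt0. Qed.

Lemma inner_conj f g : inner f g = (inner g f)^*.
Proof.
rewrite /fock_inner /cintegralC; apply/eqP; rewrite eq_complex /=; apply/andP; split; apply/eqP.
  congr fine; apply: eq_integral => t _; congr EFin.
  case: (f _) => a b; case: (g _) => a' b' /=; ring.
rewrite -fine_integralC_opp; congr fine; apply: eq_integral => t _; congr EFin.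
by case: (f _) => a b; case: (g _) => a' b' /=; ring.
Qed.

(** The reproducing property, applied to each of the two kernel functions, gives their inner
    products in the two orders. *)
Lemma kernel_conj z a : K z a = (K a z)^*.
Proof.
have [Ha _] := hK a; have [Hz _] := hK z.
have [_ /(_ _ Hz) ->] := hK a; have [_ /(_ _ Ha) ->] := hK z.
exact: inner_conj.
Qed.

Lemma kernel_entire a : entire (K ^~ a : _ -> R[i]^o).
Proof. by have [[]] := hK a. Qed.

Lemma Re_lipschitz (x y : R[i]) : `|complex.Re x - complex.Re y| <= rnorm (x - y).
Proof. by rewrite -raddfB; exact: Re_le_rnorm. Qed.

Lemma Im_lipschitz (x y : R[i]) : `|complex.Im x - complex.Im y| <= rnorm (x - y).
Proof. by rewrite -raddfB; exact: Im_le_rnorm. Qed.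

Lemma measurable_rho : measurable_fun setT (rho \o @cvec R d).
Proof.
rewrite (_ : _ \o _ = (fun t => c * expR (- 2 * N (cvec t)))); last first.
  by apply/funext => t; exact: fock_densityE.
apply: measurable_funM => //; apply: measurableT_comp => //.
by apply: measurable_funM => //; exact: measurable_phase.
Qed.

Lemma kernel_norm a :
  integralC (fun z => (rnorm (K z a) ^+ 2 * rho z)%:E) = (complex.Re (K a a))%:E.
Proof.
have [Ha rep] := hK a; have [_ fin] := Ha.
rewrite (rep _ Ha) /fock_inner /cintegralC /=.
rewrite -[LHS]fineK; last first.
  rewrite ge0_fin_numE//; apply: integral_ge0 => t _.
  by rewrite lee_fin mulr_ge0 ?rho_ge0 ?sqr_ge0.
congr (fine _)%:E; apply: eq_integral => t _; congr EFin.
by rewrite rnorm_sqr; case: (K _ _) => x y /=; ring.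
Qed.

Lemma kernel_diag_ge0 a : 0 <= complex.Re (K a a).
Proof.
rewrite -lee_fin -kernel_norm; apply: integral_ge0 => t _.
by rewrite lee_fin mulr_ge0 ?rho_ge0 ?sqr_ge0.
Qed.

Lemma kernel_weighted_norm a :
  integralC (fun z => (weighted_norm m beta (K ^~ a : _ -> R[i]^o) z `^ 2)%:E) =
  (complex.Re (K a a) / c)%:E.
Proof.
have c0 := fock_const_gt0.
have E z : weighted_norm m beta (K ^~ a : _ -> R[i]^o) z `^ 2 = c^-1 * (rnorm (K z a) ^+ 2 * rho z).
  rewrite powR_mulrn ?weighted_norm_ge0// weighted_normE fock_densityE exprMn -expRM_natl.
  rewrite mulrN -mulNr.
  by field; rewrite gt_eqF.
rewrite /integralC; under eq_integral do rewrite E EFinM.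
rewrite ge0_integralZl//.
- by rewrite -[X in (_ * X)%E]/(integralC (fun z => (rnorm (K z a) ^+ 2 * rho z)%:E)) kernel_norm -EFinM mulrC.
- apply/measurable_EFinP; apply: measurable_funM; last exact: measurable_rho.
  by apply: measurable_funX; exact: (measurable_rnorm_entire (kernel_entire a)).
- by move=> t _; rewrite lee_fin mulr_ge0 ?rho_ge0 ?sqr_ge0.
- by rewrite lee_fin invr_ge0 ltW.
Qed.

(** Let [s] be the square root of [K a a + 1]. As the squared norm of [K_a] is at most [s^2],
    [fock_growth] at scale [s] gives [|K z a| <= B e^(tau N z) s]. At [z = a] this reads
    [s^2 <= B e^(tau N a) s + 1], which bounds [s] itself; the added 1 ensures [s >= 1], so that one
    can divide. *)
Lemma kernel_growth (tau : R) : 1 < tau -> exists2 C : R, 0 <= C &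
  forall z a, rnorm (K z a) <= C * expR (tau * (N z + N a)).
Proof.
move=> tau1; have c0 := fock_const_gt0.
have [C C0 CP] := fock_growth m1 beta0 (ler1n R 2) tau1 (d := d).
pose B := C * (1 + c^-1).
have B0 : 0 <= B by rewrite mulr_ge0// addr_ge0// invr_ge0 ltW.
pose s a := Num.sqrt (complex.Re (K a a) + 1).
have k1 a : 1 <= complex.Re (K a a) + 1 by rewrite lerDr kernel_diag_ge0.
have s1 a : 1 <= s a by rewrite -sqrtr1 ler_wsqrtr.
have s0 a : 0 < s a by rewrite (lt_le_trans ltr01).
have sE a : s a ^+ 2 = complex.Re (K a a) + 1 by rewrite sqr_sqrtr// (le_trans ler01).
have bound z a : rnorm (K z a) <= B * expR (tau * N z) * s a.
  have := CP (R[i]^o) (K ^~ a) _ (s a) (kernel_entire a) _ (s0 a) z.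
  move=> /(_ (complex.Re (K a a) / c))/(_ _)/le_trans; apply.
    by rewrite kernel_weighted_norm.
  rewrite -[leLHS]mulrA -[leRHS]mulrA /B -[leRHS]mulrA.
  apply: ler_wpM2l => //; rewrite [leRHS]mulrCA; apply: ler_wpM2l; first exact: expR_ge0.
  have -> : s a `^ (1 - 2) = (s a)^-1.
    by rewrite (_ : 1 - 2 = -1) ?powR_inv1 ?(ltW (s0 a))//; lra.
  rewrite mulrDl mul1r lerD2l mulrA [c^-1 * _]mulrC ler_wpM2r ?invr_ge0 ?(ltW c0)//.
  by rewrite ler_pdivrMl// -expr2 sE lerDl.
have sb a : s a <= (B + 1) * expR (tau * N a).
  have := le_trans (Re_le_rnorm _) (bound a a).
  rewrite ger0_norm ?kernel_diag_ge0// => h.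
  rewrite -(ler_pM2r (s0 a)) -expr2 sE.
  have e1 : 1 <= expR (tau * N a).
    by rewrite -[leLHS]expR0 ler_expR mulr_ge0 ?phase_ge0// ltW// (lt_trans ltr01).
  rewrite [leRHS]mulrAC mulrDl mul1r mulrDl; apply: lerD; first by rewrite mulrAC.
  by rewrite -[leLHS]mul1r; apply: ler_pM.
exists (B * (B + 1)) => [|z a]; first by rewrite mulr_ge0// addr_ge0.
rewrite (le_trans (bound z a))// (mulrDr tau) expRD mulrACA.
by apply: ler_wpM2l (sb a); rewrite mulr_ge0 ?expR_ge0.
Qed.

Lemma entire_scale (Y : normedModType R[i]) (f : 'rV[R[i]]_d -> Y) (u : R[i]) :
  entire f -> entire (fun z => f (u *: z)).
Proof.
move=> fe z; apply: (@differentiable_comp _ _ _ _ (fun z : 'rV[R[i]]_d => u *: z)).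
  by apply: differentiableZ; exact: ex_diff.
exact: fe.
Qed.

Lemma phase_rot (u : R[i]) z : rnorm u = 1 -> N (u *: z) = N z.
Proof. by move=> u1; rewrite phaseZ u1 powR1 mul1r. Qed.

Lemma rho_rot (u : R[i]) z : rnorm u = 1 -> rho (u *: z) = rho z.
Proof. by move=> u1; rewrite !fock_densityE phase_rot. Qed.

Lemma unitC_mul_conj (u : R[i]) : rnorm u = 1 -> u * u^* = 1.
Proof.
move=> u1; have := rnorm_sqr u; rewrite u1 expr1n; case: u {u1} => a b /= ab.
by apply/eqP; rewrite eq_complex /=; apply/andP; split; apply/eqP; rewrite ?ab; ring.
Qed.

Lemma fock_hilbert_rot (u : R[i]) f : rnorm u = 1 -> H f -> H (fun z => f (u *: z)).
Proof.
move=> u1 [fe ffin]; split; first exact: (@entire_scale (R[i]^o)).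
apply: le_lt_trans ffin; rewrite le_eqVlt; apply/orP; left; apply/eqP.
rewrite -(@integralC_rot _ _ u (fun z => (rnorm (f z) ^+ 2 * rho z)%:E) u1).
- by apply: eq_integral => t _; rewrite rho_rot.
- apply/measurable_EFinP; apply: measurable_funM; last exact: measurable_rho.
  by apply: measurable_funX; exact: (@measurable_rnorm_entire _ _ (R[i]^o)).
- by move=> z; rewrite lee_fin mulr_ge0 ?rho_ge0 ?sqr_ge0.
Qed.

Lemma inner_rot (u : R[i]) f g : rnorm u = 1 -> H f -> H g ->
  inner (fun z => f (u *: z)) (fun z => g (u *: z)) = inner f g.
Proof.
move=> u1 [fe _] [ge _].
have mRe h : entire (h : _ -> R[i]^o) -> measurable_fun setT (fun t => complex.Re (h (@cvec R d t))).
  by move=> he; exact: (measurable_entire he Re_lipschitz).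
have mIm h : entire (h : _ -> R[i]^o) -> measurable_fun setT (fun t => complex.Im (h (@cvec R d t))).
  by move=> he; exact: (measurable_entire he Im_lipschitz).
have ReE z : complex.Re (f z * (g z)^* * (rho z)%:C) =
   (complex.Re (f z) * complex.Re (g z) + complex.Im (f z) * complex.Im (g z)) * rho z.
  by case: (f z) => a b; case: (g z) => a' b' /=; ring.
have ImE z : complex.Im (f z * (g z)^* * (rho z)%:C) =
   (complex.Im (f z) * complex.Re (g z) - complex.Re (f z) * complex.Im (g z)) * rho z.
  by case: (f z) => a b; case: (g z) => a' b' /=; ring.
rewrite /fock_inner /cintegralC; congr (_ +i* _); congr fine.
  rewrite -(@integralC_rot_signed _ _ u (fun z => complex.Re (f z * (g z)^* * (rho z)%:C)) u1).
    by apply: eq_integral => t _; rewrite rho_rot.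
  rewrite (_ : _ \o _ = (fun t => (complex.Re (f (cvec t)) * complex.Re (g (cvec t)) +
     complex.Im (f (cvec t)) * complex.Im (g (cvec t))) * rho (cvec t))).
    apply: measurable_funM; last exact: measurable_rho.
    by apply: measurable_funD; apply: measurable_funM; (apply: mRe || apply: mIm).
  by apply/funext => t; exact: ReE.
rewrite -(@integralC_rot_signed _ _ u (fun z => complex.Im (f z * (g z)^* * (rho z)%:C)) u1).
  by apply: eq_integral => t _; rewrite rho_rot.
rewrite (_ : _ \o _ = (fun t => (complex.Im (f (cvec t)) * complex.Re (g (cvec t)) -
   complex.Re (f (cvec t)) * complex.Im (g (cvec t))) * rho (cvec t))).
  apply: measurable_funM; last exact: measurable_rho.
  by apply: measurable_funB; apply: measurable_funM; (apply: mRe || apply: mIm).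
by apply/funext => t; exact: ImE.
Qed.

(** Composition with [u] is unitary, and its inverse is composition with the conjugate of [u]. The
    left-hand side is the inner product of the rotated [K_a] with [K_z]; moving the rotation to
    [K_z] gives the right-hand side. *)
Lemma kernel_rot (u : R[i]) z a : rnorm u = 1 -> K (u *: z) a = K z (u^* *: a).
Proof.
move=> u1; have uu := unitC_mul_conj u1.
have [Ha repa] := hK a; have [Hz repz] := hK z.
have us1 : rnorm u^* = 1 by rewrite rnorm_conj.
have Hu := fock_hilbert_rot u1 Ha; have Hz' := fock_hilbert_rot us1 Hz.
have E := repz _ Hu; rewrite /= in E; rewrite E inner_conj kernel_conj; congr (_^*).
transitivity (inner (fun w => K (u^* *: w) z) (K ^~ a)); last exact/esym/(repa _ Hz').
rewrite -(inner_rot u1 Hz' Ha); congr (fock_inner _ _ _ _).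
by apply/funext => w; rewrite scalerA mulrC uu scale1r.
Qed.

(* Both sides are holomorphic in [t] and agree on the unit circle. *)
Lemma kernel_dilation (t : R) z a : 0 < t < 1 -> K (t%:C *: z) a = K z (t%:C *: a).
Proof.
move=> t01; apply/subr0_eq; rewrite [X in _ - X]kernel_conj.
have idl : clinear (fun x : R[i]^o => x : R[i]) by split.
have id2 (x : R[i]^o) : rnorm x <= 2 * rnorm x by rewrite mulr_natl mulr2n lerDl rnorm_ge0.
have line x b (l : R[i]) : cderivable (fun k => K (k *: x) b) l.
  have := @cderivable_line R (R[i]^o) _ (K ^~ b) (fun x => x) 0 x l idl id2 (kernel_entire b _).
  by under eq_fun do rewrite add0r.
have tc : conjc t%:C = t%:C by apply/eqP; rewrite eq_complex /= oppr0 !eqxx.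
(* With [l] in place of [t], the right-hand side has to carry the conjugate of [l] to agree with
   [kernel_rot] on the circle. Written as the conjugate of [K] with swapped arguments, it is
   holomorphic in [l] by reflection; at the real point [t] conjugation disappears. *)
have := @circle_vanishing R (fun l => K (l *: z) a - conjc (K (conjc l *: a) z)) _ _ t t01.
rewrite tc; apply.
- move=> l; apply: cderivable_sub; first exact: line.
  by apply: (cderivable_conj (f := fun l => K (l *: a) z)); exact: line.
- by move=> l l1; rewrite kernel_rot// kernel_conj subrr.
Qed.

(* Dilating by [t = tau^(- 1 / m)] trades growth in [z] for growth in [a]. *)
Lemma kernel_decay (tau : R) : 1 < tau -> exists2 C : R, 0 <= C &
  forall z a, rnorm (K z a) <= C * expR (tau^-1 * N z + tau ^+ 3 * N a).
Proof.
move=> tau1; have [C C0 CP] := kernel_growth tau1.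
have tau0 : 0 < tau by exact: lt_trans tau1.
have m20 : 0 < 2 * m by rewrite mulr_gt0// (lt_le_trans ltr01).
exists C => // z a; pose t := (tau ^- 2) `^ (2 * m)^-1.
have tt : t `^ (2 * m) = tau ^- 2.
  by rewrite -powRrM mulVf ?gt_eqF// powRr1// invr_ge0 exprn_ge0// ltW.
have t2 : 0 < tau ^- 2 by rewrite invr_gt0 exprn_gt0.
have t0 : 0 < t by exact: powR_gt0.
have t1 : t < 1.
  have -> : 1 = 1 `^ (2 * m)^-1 :> R by rewrite powR1.
  apply: gt0_ltr_powR; rewrite ?invr_gt0 ?nnegrE ?(ltW t2)//.
  by rewrite invf_lt1 ?exprn_gt0// exprn_egt1.
have -> : K z a = K (t%:C *: z) (t^-1%:C *: a).
  by rewrite kernel_dilation ?t0 ?t1// scalerA -rmorphM divff ?gt_eqF// scale1r.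
apply: (le_trans (CP _ _)); rewrite !phaseZ !rnormC !gtr0_norm ?invr_gt0//.
have -> : t^-1 `^ (2 * m) = tau ^+ 2.
  by rewrite -powR_inv1 ?(ltW t0)// powRAC tt powR_inv1 ?invrK// ltW.
rewrite tt; apply: ler_wpM2l => //; rewrite ler_expR le_eqVlt; apply/orP; left; apply/eqP.
by field; rewrite gt_eqF.
Qed.

End Kernel.

(** * Subcritical functions and dilations *)

Lemma ge0_dominated_to0 d (T : measurableType d) (R : realType)
    (mu : {measure set T -> \bar R}) (F : nat -> T -> R) (G : T -> R) :
  (forall n, measurable_fun setT (F n)) -> measurable_fun setT G ->
  (forall n x, 0 <= F n x <= G x) -> (\int[mu]_x (G x)%:E < +oo)%E ->
  (forall x, (F ^~ x) @ \oo --> (0 : R)) ->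
  forall e : R, 0 < e -> exists n0, forall n, (n0 <= n)%N ->
    (\int[mu]_x (F n x)%:E < e%:E)%E.
Proof.
move=> mF mG FG Goo F0 e e0.
have G0 x : 0 <= G x by have /andP[a b] := FG 0%N x; exact: le_trans a b.
have mF' n : measurable_fun setT (fun x => (F n x)%:E) by apply/measurable_EFinP.
have F0' : {ae mu, forall x, setT x -> (fun n => (F n x)%:E) @ \oo --> cst 0%E x}.
  by apply: aeW => x _; apply: cvg_EFin; [exact: nearW|exact: F0].
have iG : mu.-integrable setT (EFin \o G).
  apply/integrableP; split; first exact/measurable_EFinP.
  by under eq_integral do rewrite /= ger0_norm ?G0//.
have FG' : {ae mu, forall x n, setT x -> (`|(F n x)%:E| <= (EFin \o G) x)%E}.
  apply: aeW => x n _; have /andP[a b] := FG n x.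
  by rewrite gee0_abs ?lee_fin.
have [_ _] := dominated_convergence measurableT mF' (measurable_cst _) F0' iG FG'.
rewrite integral_cst// mul0e => /fine_cvgP[fin /cvgrPdist_lt/(_ _ e0) lt].
have [n0 _ n0P] := filterI fin lt.
exists n0 => n /n0P[/= fn]; rewrite /= sub0r normrN => h.
by rewrite -(fineK fn) lte_fin (le_lt_trans (ler_norm _)).
Qed.

Section Subcritical.
Context {R : realType} {d : nat} (m beta : R) {Y : normedModType R[i]}.
Hypotheses (m1 : 1 <= m) (beta0 : 0 < beta).
Implicit Types f g h : 'rV[R[i]]_d -> Y.
Local Notation N := (@phase R d m beta).

Lemma rnorm_bound_weighted f (C sigma : R) z :
  rnorm (f z) <= C * expR (sigma * N z) ->
  weighted_norm m beta f z <= C * expR (- (1 - sigma) * N z).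
Proof.
move=> fz; rewrite weighted_normE.
have -> : C * expR (- (1 - sigma) * N z) = C * expR (sigma * N z) * expR (- N z).
  by rewrite -mulrA -expRD; congr (_ * expR _); ring.
by rewrite ler_wpM2r ?expR_ge0.
Qed.

Lemma weighted_powR_bound f (C sigma p : R) z : 0 <= C -> 0 < p ->
  rnorm (f z) <= C * expR (sigma * N z) ->
  weighted_norm m beta f z `^ p <= C `^ p * expR (- (p * (1 - sigma)) * N z).
Proof.
move=> C0 p0 /rnorm_bound_weighted fz.
apply: (@le_trans _ _ ((C * expR (- (1 - sigma) * N z)) `^ p)).
  apply: ge0_ler_powR => //; rewrite ?nnegrE ?weighted_norm_ge0 ?mulr_ge0 ?expR_ge0 ?(ltW p0)//.
rewrite powRM ?expR_ge0// -expRM; apply: ler_wpM2l; first exact: powR_ge0.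
by rewrite ler_expR le_eqVlt; apply/orP; left; apply/eqP; ring.
Qed.

Let dominator (C sigma p : R) z := C `^ p * expR (- (p * (1 - sigma)) * N z).

Let measurable_dominator C sigma p :
  measurable_fun setT (fun t => dominator C sigma p (@cvec R d t)).
Proof.
apply: measurable_funM => //; apply: measurableT_comp => //.
by apply: measurable_funM => //; exact: measurable_phase.
Qed.

Let dominator_integrable (C sigma p : R) : 0 <= C -> 0 < p -> sigma < 1 ->
  (integralC (fun z => (dominator C sigma p z)%:E) < +oo)%E.
Proof.
move=> C0 p0 s1; rewrite /integralC; under eq_integral do rewrite EFinM.
rewrite ge0_integralZl//.
- rewrite lte_mul_pinfty ?lee_fin ?powR_ge0//.
  by apply: phase_integrable => //; rewrite mulr_gt0// subr_gt0.
- apply/measurable_EFinP; apply: measurableT_comp => //.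
  by apply: measurable_funM => //; exact: measurable_phase.
- by rewrite lee_fin powR_ge0.
Qed.

Lemma subcritical_integral f (C sigma p : R) : entire f -> 0 <= C -> sigma < 1 -> 0 < p ->
  (forall z, rnorm (f z) <= C * expR (sigma * N z)) ->
  (integralC (fun z => (weighted_norm m beta f z `^ p)%:E) < +oo)%E.
Proof.
move=> fe C0 s1 p0 fC; apply: le_lt_trans (dominator_integrable C0 p0 s1).
apply: ge0_le_integral => //.
- by move=> t _; rewrite lee_fin powR_ge0.
- by apply/measurable_EFinP; exact: measurable_weighted_norm.
- by apply/measurable_EFinP; exact: measurable_dominator.
- by move=> t _; rewrite lee_fin; exact: weighted_powR_bound.
Qed.

(** [M] depends only on [C], [sigma] and [e], so one radius serves a whole sequence. For norms at
    least 1, [N z] dominates a multiple of [enorm z - 1], and [1 + x <= expR x] is then enough. *)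
Lemma subcritical_vanishing (C sigma : R) : 0 <= C -> sigma < 1 ->
  forall e : R, 0 < e -> exists M : R, forall f z, M < enorm z ->
    rnorm (f z) <= C * expR (sigma * N z) -> weighted_norm m beta f z < e.
Proof.
move=> C0 s1 e e0; pose k := (1 - sigma) * (beta / 2).
have k0 : 0 < k by rewrite mulr_gt0 ?subr_gt0 ?divr_gt0.
exists (1 + C / e / k) => f z Mz /rnorm_bound_weighted fz.
apply: (le_lt_trans fz).
have z1 : 1 <= enorm z by rewrite (le_trans _ (ltW Mz))// lerDl !divr_ge0// ltW.
have kx : C / e < (1 - sigma) * N z.
  rewrite (@lt_le_trans _ _ (k * (enorm z - 1)))//.
    by rewrite [ltRHS]mulrC -ltr_pdivrMr// ltrBrDl.
  apply: (@le_trans _ _ (k * (enorm z ^+ 2 - 1))).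
    by rewrite ler_wpM2l ?(ltW k0)// lerD2r expr2 ler_peMr// (le_trans ler01).
  by rewrite /k -mulrA ler_wpM2l ?subr_ge0 ?(ltW s1)// phase_ge_sqr.
set x := (1 - sigma) * N z in kx.
have x0 : 0 < 1 + x.
  by rewrite ltr_pwDl// (le_trans _ (ltW kx))// divr_ge0// ltW.
have -> : - (1 - sigma) * N z = - x by rewrite mulNr.
rewrite expRN -ltr_pdivlMr ?invr_gt0 ?expR_gt0// invrK.
rewrite -ltr_pdivrMl// mulrC (lt_le_trans kx)//.
by rewrite (le_trans _ (expR_ge1Dx _))// lerDr.
Qed.

Lemma entire_sub f g : entire f -> entire g -> entire (f \- g).
Proof. by move=> fe ge z; apply: differentiableB; [exact: fe|exact: ge]. Qed.

Section Sequence.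
Variables (F : nat -> 'rV[R[i]]_d -> Y) (C sigma : R).
Hypotheses (Fe : forall n, entire (F n)) (C0 : 0 <= C) (s1 : sigma < 1).
Hypothesis FC : forall n z, rnorm (F n z) <= C * expR (sigma * N z).
Hypothesis F0 : forall z, (fun n => rnorm (F n z)) @ \oo --> (0 : R).

Lemma subcritical_seq_integral (p : R) : 1 <= p -> forall e : R, 0 < e ->
  exists n0, forall n, (n0 <= n)%N ->
  (integralC (fun z => (weighted_norm m beta (F n) z `^ p)%:E) < e%:E)%E.
Proof.
move=> p1; have p0 : 0 < p by exact: lt_le_trans p1.
apply: (@ge0_dominated_to0 _ _ _ (@lebesgueC R d)
  (fun n t => weighted_norm m beta (F n) (cvec t) `^ p)
  (fun t => dominator C sigma p (cvec t))).
- by move=> n; exact: measurable_weighted_norm.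
- exact: measurable_dominator.
- by move=> n t; rewrite powR_ge0/=; exact: weighted_powR_bound.
- exact: dominator_integrable.
move=> t; apply/cvgrPdist_lt => /= e e0.
have := F0 (cvec t) => /cvgrPdist_lt/(_ (e `^ p^-1))[|n0 _ n0P].
  by rewrite powR_gt0.
exists n0 => // n /n0P /=; rewrite !sub0r !normrN ger0_norm ?rnorm_ge0// ger0_norm ?powR_ge0//.
move=> h; have -> : e = (e `^ p^-1) `^ p.
  by rewrite -powRrM mulVf ?gt_eqF// powRr1// ltW.
apply: gt0_ltr_powR => //; rewrite ?nnegrE ?weighted_norm_ge0 ?powR_ge0//.
apply: le_lt_trans h; rewrite weighted_normE -[leRHS]mulr1 ler_wpM2l ?rnorm_ge0//.
by rewrite -[leRHS]expR0 ler_expR oppr_le0 phase_ge0.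
Qed.

(** Outside a fixed ball the common bound makes all terms small. Inside it, convergence of the
    integrals for [p = 1] is turned into uniform convergence by [fock_growth]. *)
Lemma subcritical_seq_sup (e : R) : 0 < e ->
  exists n0, forall n, (n0 <= n)%N -> forall z, weighted_norm m beta (F n) z <= e.
Proof.
move=> e0; have [M MP] := subcritical_vanishing C0 s1 e0.
have [A A0 AP] := fock_growth (d := d) m1 beta0 (lexx 1) (ltr1n R 2).
pose B := expR (beta / 2 * `|M| `^ (2 * m)).
have B0 : 0 < B by exact: expR_gt0.
(* With [s = I = e1], [p = 1] and [tau = 2], the growth estimate yields at most [A * B * (2 * e1)]
   on the ball, where [B] bounds [expR (N z)]; this is [e * (A * B / (A * B + 1))]. *)
pose e1 := e / (2 * (A * B + 1)).
have AB : 0 <= A * B by rewrite mulr_ge0// ltW.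
have AB1 : 0 < 2 * (A * B + 1) by rewrite mulr_gt0// ltr_wpDl.
have e10 : 0 < e1 by rewrite divr_gt0.
have [n0 n0P] := subcritical_seq_integral (lexx 1) e10.
exists n0 => n /n0P Fn z.
have [zM|Mz] := leP (enorm z) M; last exact/ltW/MP.
have := AP Y (F n) e1 e1 (Fe n) (ltW Fn) e10 z.
rewrite subrr powRr0 mul1r => Fz; rewrite weighted_normE.
apply: (@le_trans _ _ (A * expR (2 * N z) * (e1 + e1) * expR (- N z))).
  by rewrite ler_wpM2r ?expR_ge0.
have -> : A * expR (2 * N z) * (e1 + e1) * expR (- N z) = A * expR (N z) * (2 * e1).
  have -> : expR (N z) = expR (2 * N z) * expR (- N z).
    by rewrite -expRD; congr expR; ring.
  by ring.
apply: (@le_trans _ _ (A * B * (2 * e1))).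
  apply: ler_wpM2r; first by rewrite mulr_ge0// ltW.
  rewrite ler_wpM2l// ler_expR /phase ler_wpM2l ?divr_ge0 ?(ltW beta0)//.
  rewrite ge0_ler_powR ?nnegrE ?enorm_ge0//; last by rewrite (le_trans zM)// ler_norm.
  by rewrite mulr_ge0// (le_trans ler01).
have -> : A * B * (2 * e1) = e * ((A * B) / (A * B + 1)).
  by rewrite /e1; field; rewrite gt_eqF// ltr_wpDl.
by rewrite ler_piMr ?(ltW e0)// ler_pdivrMr ?ltr_wpDl// mul1r lerDl.
Qed.

End Sequence.
End Subcritical.

Lemma ge0_squeeze_to0 (R : realType) (u v : nat -> R) :
  (forall n, 0 <= u n <= v n) -> v @ \oo --> (0 : R) -> u @ \oo --> (0 : R).
Proof.
move=> uv v0; apply: (@squeeze_cvgr _ _ _ _ (cst 0) v); [exact: nearW|exact: cvg_cst|exact: v0].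
Qed.

(* The excess [(A_n - A)^+] has small integral because [(A - A_n)^+ <= A] does, by
   dominated convergence, and [D_n <= min (D_n, 2 c A) + c (A_n - A)^+]. *)
Lemma ge0_scheffe d (T : measurableType d) (R : realType)
    (mu : {measure set T -> \bar R}) (A_ D_ : nat -> T -> R) (A : T -> R)
    (c : R) (k : nat -> R) :
  (forall n, measurable_fun setT (A_ n)) -> (forall n, measurable_fun setT (D_ n)) ->
  measurable_fun setT A -> 0 <= c ->
  (forall n x, 0 <= A_ n x) -> (forall x, 0 <= A x) ->
  (forall n x, 0 <= D_ n x <= c * (A_ n x + A x)) ->
  (forall x, (A_ ^~ x) @ \oo --> A x) -> (forall x, (D_ ^~ x) @ \oo --> (0 : R)) ->
  (\int[mu]_x (A x)%:E < +oo)%E ->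
  (forall n, \int[mu]_x (A_ n x)%:E <= (k n)%:E * \int[mu]_x (A x)%:E)%E ->
  k @ \oo --> (1 : R) ->
  forall e : R, 0 < e -> exists n, (\int[mu]_x (D_ n x)%:E < e%:E)%E.
Proof.
move=> mA_ mD_ mA c0 A_0 A0 DA A_A D_0 Aoo kA k1 e e0.
have /fineK aE : (\int[mu]_x (A x)%:E)%E \is a fin_num.
  by rewrite ge0_fin_numE// integral_ge0// => x _; rewrite lee_fin.
set a := fine _ in aE.
have a0 : 0 <= a by rewrite fine_ge0// integral_ge0// => x _; rewrite lee_fin.
pose M_ n x := Num.max (A x - A_ n x) 0.
pose P_ n x := Num.max (A_ n x - A x) 0.
pose Q_ n x := Num.min (D_ n x) (2 * c * A x).
have mM n : measurable_fun setT (M_ n) by apply: measurable_maxr => //; exact: measurable_funB.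
have mP n : measurable_fun setT (P_ n) by apply: measurable_maxr => //; exact: measurable_funB.
have mcA : measurable_fun setT (fun x => 2 * c * A x) by exact: measurable_funM.
have mQ n : measurable_fun setT (Q_ n) by exact: measurable_minr.
have M0 n x : 0 <= M_ n x by rewrite le_max lexx orbT.
have P0 n x : 0 <= P_ n x by rewrite le_max lexx orbT.
have AP n x : A x + P_ n x = A_ n x + M_ n x.
  by rewrite /P_ /M_; have [h|h] := leP (A_ n x - A x) 0; have [h'|h'] := leP (A x - A_ n x) 0; lra.
have DQ n x : D_ n x <= Q_ n x + c * P_ n x.
  have /andP[_ Dle] := DA n x.
  have : c * (A_ n x - A x) <= c * P_ n x by rewrite ler_wpM2l// le_max lexx.
  have := mulr_ge0 c0 (P0 n x); rewrite /Q_.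
  by have [h|h] := leP (D_ n x) (2 * c * A x); lra.
have cA0 x : 0 <= 2 * c * A x by rewrite !mulr_ge0.
have Q0 n x : 0 <= Q_ n x.
  by have /andP[D0 _] := DA n x; rewrite le_min D0 cA0.
have D_0' n x : 0 <= D_ n x by have /andP[] := DA n x.
(* The excess [P_] will have integral below [2 * e1], hence contribute at most [e / 2]; the other
   half is left to [Q_]. *)
pose e1 := e / (4 * (c + 1)).
have c1 : 0 < c + 1 by rewrite ltr_wpDl.
have e10 : 0 < e1 by rewrite divr_gt0// mulr_gt0.
have e20 : 0 < e / 2 by rewrite divr_gt0.
have [n1 n1P] : exists n1, forall n, (n1 <= n)%N -> (\int[mu]_x (M_ n x)%:E < e1%:E)%E.
  apply: (ge0_dominated_to0 mM mA _ Aoo _ e10) => [n x|x].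
    by rewrite M0 /= ge_max A0 andbT gerBl.
  apply: (@ge0_squeeze_to0 _ _ (fun n => `|A x - A_ n x|)) => [n|].
    by rewrite M0 /= ge_max normr_ge0 andbT ler_norm.
  rewrite -[0](normr0 R) -(subrr (A x)).
  by apply: cvg_norm; apply: cvgB; [exact: cvg_cst|exact: A_A].
have [n2 n2P] : exists n2, forall n, (n2 <= n)%N -> (\int[mu]_x (Q_ n x)%:E < (e / 2)%:E)%E.
  apply: (ge0_dominated_to0 mQ mcA _ _ _ e20) => [n x||x].
  - by rewrite Q0 /= ge_min lexx orbT.
  - under eq_integral do rewrite EFinM; rewrite ge0_integralZl ?lee_fin ?mulr_ge0//.
    + by rewrite lte_mul_pinfty// lee_fin mulr_ge0.
    + exact/measurable_EFinP.
    + by move=> x _; rewrite lee_fin.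
  apply: (@ge0_squeeze_to0 _ _ (fun n => D_ n x)) => [n|]; last exact: D_0.
  by rewrite Q0 /= ge_min lexx.
have [n3 _ n3P] : \forall n \near \oo, `|1 - k n| < e1 / (a + 1).
  by move: k1 => /cvgrPdist_lt; apply; rewrite divr_gt0// ltr_wpDl.
exists (maxn n1 (maxn n2 n3)); set n := maxn _ _.
have {n1P} hM := n1P n (leq_maxl _ _).
have {n2P} hQ := n2P n (leq_trans (leq_maxl _ _) (leq_maxr _ _)).
have {n3P} hk := n3P n (leq_trans (leq_maxr _ _) (leq_maxr _ _)).
have intM : (\int[mu]_x (M_ n x)%:E)%E \is a fin_num.
  rewrite ge0_fin_numE; first exact: lt_le_trans hM (leey _).
  by apply: integral_ge0 => x _; rewrite lee_fin.
(* Integrating [A + P_ = A_ + M_] bounds the excess by [(k n - 1) * a] plus the integral of the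
   deficit, each at most [e1]. *)
have hP : (\int[mu]_x (P_ n x)%:E < (2 * e1)%:E)%E.
  have : (a%:E + \int[mu]_x (P_ n x)%:E <= (k n * a)%:E + \int[mu]_x (M_ n x)%:E)%E.
    rewrite EFinM aE.
    apply: le_trans (leeD2r _ (kA n)).
    by rewrite -!ge0_integralD//;
      do ?[by move=> x _; rewrite lee_fin|exact/measurable_EFinP];
      under eq_integral do rewrite -EFinD AP EFinD.
  rewrite -(fineK intM) -EFinD -leeBrDl// -EFinB => /le_lt_trans; apply.
  rewrite lte_fin; have : fine (\int[mu]_x (M_ n x)%:E)%E < e1 by rewrite -lte_fin fineK.
  have : (k n - 1) * a <= e1.
    apply: (@le_trans _ _ (e1 / (a + 1) * a)).
      rewrite ler_wpM2r// ltW// (le_lt_trans _ hk)// distrC; exact: ler_norm.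
    by rewrite mulrAC ler_pdivrMr ?ltr_wpDl// ler_wpM2l ?ltW// ltrDl.
  lra.
apply: (@le_lt_trans _ _ (\int[mu]_x (Q_ n x)%:E + c%:E * \int[mu]_x (P_ n x)%:E)%E).
  rewrite -ge0_integralZl//; do ?[by move=> x _; rewrite lee_fin|exact/measurable_EFinP].
  rewrite -ge0_integralD//;
    do ?[by move=> x _; rewrite ?lee_fin ?mulr_ge0|exact/measurable_EFinP
        |by apply: measurable_funeM; exact/measurable_EFinP].
  apply: ge0_le_integral => //; do ?[by move=> x _; rewrite lee_fin|exact/measurable_EFinP].
    by apply: emeasurable_funD; [exact/measurable_EFinP|apply: measurable_funeM; exact/measurable_EFinP].
apply: (@lt_le_trans _ _ ((e / 2)%:E + c%:E * (2 * e1)%:E)%E).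
  have cP : (c%:E * \int[mu]_x (P_ n x)%:E <= c%:E * (2 * e1)%:E)%E.
    by rewrite lee_wpmul2l ?lee_fin ?(ltW hP).
  apply: lt_le_trans (leeD2l _ cP); rewrite lteD2rE//.
  rewrite fin_numM// ge0_fin_numE ?(lt_trans hP)// ?ltry//.
  by apply: integral_ge0 => x _; rewrite lee_fin.
rewrite -EFinM -EFinD lee_fin /e1.
have -> : c * (2 * (e / (4 * (c + 1)))) = e / 2 * (c / (c + 1)) by field; rewrite gt_eqF.
have : e / 2 * (c / (c + 1)) <= e / 2.
  by rewrite ler_piMr ?ltW// ltr_pdivrMr// mul1r ltrDl.
lra.
Qed.

Lemma EFin_gt0_muley (R : realType) (c : R) (x : \bar R) : 0 < c ->
  (c%:E * x < +oo)%E -> (x < +oo)%E.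
Proof.
move=> c0; case: x => [x||]//=; first by move=> _; exact: ltry.
by rewrite gt0_muley ?lte_fin.
Qed.

(** * Growth bounds in the Fock spaces and dilates of entire functions *)

Section Dilation.
Context {R : realType} {d : nat} (m beta : R) {Y : normedModType R[i]}.
Hypotheses (m1 : 1 <= m) (beta0 : 0 < beta).
Implicit Types f g h : 'rV[R[i]]_d -> Y.
Local Notation N := (@phase R d m beta).

Lemma fock_space_growth f (p tau : R) : 0 < fock_const d m beta ->
  1 <= p -> 1 < tau -> fock_space m beta p f ->
  exists2 C : R, 0 <= C & forall z, rnorm (f z) <= C * expR (tau * N z).
Proof.
move=> c0 p1 tau1 [fe] /(EFin_gt0_muley c0) foo.
have [C C0 CP] := fock_growth (d := d) m1 beta0 p1 tau1.
set I := integralC _ in foo.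
have I0 : (0 <= I)%E by apply: integral_ge0 => t _; rewrite lee_fin powR_ge0.
have IE : I = (fine I)%:E by rewrite fineK// ge0_fin_numE.
exists (C * (1 + fine I)); first by rewrite mulr_ge0// addr_ge0// fine_ge0.
move=> z; have := CP Y f (fine I) 1 fe; rewrite -IE lexx powR1 mul1r => /(_ isT ltr01 z).
by rewrite mulrAC.
Qed.

(** The decay condition speaks only of points of norm above [M]. A point inside is the centre of a
    circle lying entirely outside, of direction [w] with norm at least [2 |M| + 1], which exists
    because [d >= 1]; [circle_submean] carries the bound inwards. *)
Lemma fock_space_infty0_growth f : (1 <= d)%N -> fock_space_infty0 m beta f ->
  exists2 C : R, 0 <= C & forall z, rnorm (f z) <= C * expR (N z).
Proof.
move=> d1 [fe /(_ _ ltr01)[M MP]].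
have m20 : 0 <= 2 * m by rewrite mulr_ge0// (le_trans ler01).
have far z : M < enorm z -> rnorm (f z) <= expR (N z).
  move=> /MP/ltW fz; rewrite (rnorm_weighted m beta) -[leRHS]mul1r.
  by rewrite ler_wpM2r ?expR_ge0.
pose w : 'rV[R[i]]_d := const_mx (2 * `|M| + 1)%:C.
have M1 : 0 <= 2 * `|M| + 1 by rewrite addr_ge0// mulr_ge0.
have w2 : 2 * `|M| + 1 <= enorm w.
  have := rnorm_coord_le w (Ordinal d1).
  by rewrite mxE rnormC ger0_norm.
pose E := expR (beta / 2 * (`|M| + enorm w) `^ (2 * m)).
exists (1 + E); first by rewrite addr_ge0 ?expR_ge0.
move=> z; have [zM|Mz] := leP (enorm z) M; last first.
  rewrite (le_trans (far _ Mz))// ler_peMl ?expR_ge0//.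
  by rewrite lerDl expR_ge0.
have zM' : enorm z <= `|M| by rewrite (le_trans zM)// ler_norm.
have cw y : enorm (cis y *: w) = enorm w by rewrite enormZ rnorm_cis mul1r.
have circ y : rnorm (f (z + cis y *: w)) <= E.
  have yM : M < enorm (z + cis y *: w).
    have := enormD (z + cis y *: w) (- z); rewrite addrC addKr cw enormN => h.
    have := ler_norm M; move: h w2 zM' M1; lra.
  rewrite (le_trans (far _ yM))// ler_expR ler_wpM2l ?divr_ge0 ?(ltW beta0)//.
  rewrite ge0_ler_powR ?nnegrE ?addr_ge0 ?enorm_ge0//.
  by rewrite (le_trans (enormD _ _))// cw lerD2r.
have fc : rcontinuous (fun z => rnorm (f z)) by exact: (entire_rcontinuous fe (@rnorm_lipschitz _ _)).
have pi20 : 0 < 2 * pi :> R by rewrite mulr_gt0 ?pi_gt0.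
have fE : rnorm (f z) <= E.
  rewrite -(ler_pM2l pi20) -lee_fin (le_trans (circle_submean z w fe))//.
  apply: (@le_trans _ _ (\int[@lebesgue_measure R]_(y in `[0%R, (2 * pi)%R]) (E%:E))%E).
    apply: ge0_le_integral => //.
    - by move=> y _; rewrite lee_fin rnorm_ge0.
    - apply/measurable_EFinP; apply: measurable_funTS.
      apply: continuous_measurable_fun.
      exact: (continuous_circle fc).
    - by move=> y _; rewrite lee_fin.
  rewrite integral_cst//= lebesgue_measure_itv /= lte_fin pi20 -EFinD -EFinM lee_fin.
  by rewrite subr0 mulrC.
apply: (le_trans fE); have E0 : 0 <= E by exact: expR_ge0.
have N1 : 1 <= expR (N z) by rewrite -[leLHS]expR0 ler_expR phase_ge0.
have : (1 + E) * 1 <= (1 + E) * expR (N z) 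
  by apply: (ler_wpM2l _ N1); exact: addr_ge0 ler01 E0.
clear far circ MP; move: E0; lra.
Qed.

Lemma phase_dilate (r : R) z : 0 <= r -> N (r%:C *: z) = r `^ (2 * m) * N z.
Proof. by move=> r0; rewrite phaseZ rnormC ger0_norm. Qed.

Lemma phase_contract (r : R) z : 0 <= r <= 1 -> N (r%:C *: z) <= N z.
Proof.
move=> /andP[r0 r1]; rewrite phase_dilate// ler_piMl ?phase_ge0//.
apply: (@le_trans _ _ (1 `^ (2 * m))); last by rewrite powR1.
rewrite ge0_ler_powR ?nnegrE//.
by rewrite mulr_ge0// (le_trans ler01).
Qed.

Lemma dilate_subcritical f (r : R) : 0 < r < 1 ->
  (forall tau, 1 < tau ->
    exists2 C : R, 0 <= C & forall z, rnorm (f z) <= C * expR (tau * N z)) ->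
  exists C sigma : R, [/\ 0 <= C, 0 <= sigma < 1 &
    forall z, rnorm (f (r%:C *: z)) <= C * expR (sigma * N z)].
Proof.
move=> /andP[r0 r1] fg; set q := r `^ (2 * m).
have m20 : 0 < 2 * m by rewrite mulr_gt0// (lt_le_trans ltr01).
have q0 : 0 < q by exact: powR_gt0.
have q1 : q < 1.
  apply: (@lt_le_trans _ _ (1 `^ (2 * m))); last by rewrite powR1.
  by rewrite gt0_ltr_powR ?nnegrE ?(ltW r0).
have q1' : 0 < 1 + q by rewrite addr_gt0.
(* The growth rate [2 / (1 + q)] is above 1, yet falls below 1 after multiplication by [q], the
   factor by which dilation shrinks the phase. *)
have [|C C0 CP] := fg (2 / (1 + q)); first by rewrite ltr_pdivlMr//; lra.
exists C, (2 / (1 + q) * q); split; [exact: C0| |].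
  clear CP; rewrite mulr_ge0 ?divr_ge0 ?(ltW q0) ?(ltW q1')//= mulrAC ltr_pdivrMr//; lra.
by move=> z; apply: (le_trans (CP _)); rewrite (phase_dilate _ (ltW r0)) mulrA.
Qed.

(** Halving the harmonic term keeps the factor positive, and at least [1 / 2], already at
    [n = 0]. *)
Definition dilation_factor (n : nat) : R := 1 - harmonic n / 2.

Lemma dilation_factor_cvg : dilation_factor @ \oo --> (1 : R).
Proof.
rewrite -[X in _ --> X]subr0 -[X in _ - X](mul0r 2^-1).
by apply: cvgB; [exact: cvg_cst|apply: cvgMl; exact: cvg_harmonic].
Qed.

Lemma dilation_factor_bounds n : 2^-1 <= dilation_factor n < 1.
Proof.
have h0 : 0 < harmonic n :> R by rewrite /= invr_gt0.
have h1 : harmonic n <= 1 :> R by rewrite /= invf_le1// ler1n.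
by rewrite /dilation_factor; move: h0 h1; lra.
Qed.

Lemma dilation_factor_gt0_lt1 n : 0 < dilation_factor n < 1.
Proof.
by have /andP[h ->] := dilation_factor_bounds n; rewrite (lt_le_trans _ h)// invr_gt0.
Qed.

Local Notation r_ := dilation_factor.
Lemma dilate_cvg (V : normedModType R[i]) (F : V -> R) z : rcontinuous F ->
  (fun n => F ((r_ n)%:C *: z)) @ \oo --> F z.
Proof.
move=> Fc; apply/cvgrPdist_lt => /= e e0.
have [s s0 sP] := rcontinuous_near z Fc e0.
have z1 : 0 < rnorm z + 1 by rewrite ltr_wpDl ?rnorm_ge0.
have := dilation_factor_cvg => /cvgrPdist_lt/(_ (s / (rnorm z + 1)))[|n0 _ n0P].
  exact: divr_gt0.
exists n0 => // n /n0P /= rs; apply: sP.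
rewrite -{1}[z]scale1r -scalerBl rnormZ -raddfB rnormC.
rewrite (le_lt_trans _ (_ : `|1 - r_ n| * (rnorm z + 1) < s))//.
  by rewrite ler_wpM2l// lerDl.
by rewrite -ltr_pdivlMr.
Qed.

Lemma dilate_diff_cvg f z : entire f ->
  (fun n => rnorm (f z - f ((r_ n)%:C *: z))) @ \oo --> (0 : R).
Proof.
move=> fe; have := @dilate_cvg _ (fun w => rnorm (f z - f w)) z.
rewrite subrr rnorm0; apply.
apply: (@rcontinuous_lipschitz _ _ _ f (fun y => rnorm (f z - y))).
  by move=> w; exact: differentiable_continuous.
move=> x y; rewrite (le_trans (rnorm_lipschitz _ _))//.
by rewrite opprB addrC addrA subrK -rnormN opprB addrC.
Qed.

End Dilation.

(** The absolute value makes the power continuous on the whole line, 0 included, so that it composes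
    with arbitrary real functions. *)
Lemma continuous_norm_powR (R : realType) (p : R) : 0 < p ->
  continuous (fun x : R => `|x| `^ p).
Proof.
move=> p0 x; rewrite /continuous_at; have [->|x0] := eqVneq x 0.
  rewrite normr0 powR0 ?gt_eqF//; apply/cvgrPdist_lt => /= e e0.
  have ep0 : 0 < e `^ p^-1 by exact: powR_gt0.
  apply/nbhs_ballP; exists (e `^ p^-1) => //= y.
  rewrite /ball /= !sub0r !normrN => ye; rewrite ger0_norm ?powR_ge0//.
  have -> : e = (e `^ p^-1) `^ p by rewrite -powRrM mulVf ?gt_eqF// powRr1// ltW.
  by apply: gt0_ltr_powR; rewrite ?nnegrE ?(ltW ep0).
have nx : 0 < `|x| by rewrite normr_gt0.
have -> : `|x| `^ p = expR (p * ln `|x|) by rewrite /powR gt_eqF.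
apply: (@cvg_trans _ ((fun y => expR (p * ln `|y|)) @ x)).
  apply: near_eq_cvg; apply/nbhs_ballP; exists `|x| => //= y.
  rewrite /ball /= => xy; have y0 : y != 0 by apply: contraTneq xy => ->; rewrite subr0 ltxx.
  by rewrite /powR ifN// normr_eq0.
apply: (@continuous_comp _ _ _ (fun y : R => p * ln `|y|) expR); last exact: continuous_expR.
apply: cvgMr; apply: (@continuous_comp _ _ _ (fun y : R => `|y|) (@ln R)).
  exact: norm_continuous.
exact: continuous_ln.
Qed.

Lemma ler_powRD (R : realType) (a b p : R) : 0 <= a -> 0 <= b -> 0 <= p ->
  (a + b) `^ p <= 2 `^ p * (a `^ p + b `^ p).
Proof.
move=> a0 b0 p0; pose M := Num.max a b.
have aM : a <= M by rewrite le_max lexx.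
have bM : b <= M by rewrite le_max lexx orbT.
have M0 : 0 <= M by exact: le_trans aM.
apply: (@le_trans _ _ ((2 * M) `^ p)).
  apply: ge0_ler_powR; rewrite ?nnegrE ?addr_ge0 ?mulr_ge0//.
  by move: aM bM; lra.
rewrite powRM//; apply: ler_wpM2l; first exact: powR_ge0.
by rewrite /M; have [ab|ab] := leP a b; rewrite ?lerDl ?lerDr powR_ge0.
Qed.

Section DilationApproximation.
Context {R : realType} {d : nat} (m beta : R) {Y : normedModType R[i]}.
Hypotheses (m1 : 1 <= m) (beta0 : 0 < beta).
Implicit Types f g h : 'rV[R[i]]_d -> Y.
Local Notation N := (@phase R d m beta).
Local Notation r_ := (@dilation_factor R).

Lemma weighted_normB f g z :
  weighted_norm m beta (f \- g) z <= weighted_norm m beta f z + weighted_norm m beta g z.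
Proof.
rewrite !weighted_normE -mulrDl ler_wpM2r ?expR_ge0//.
by rewrite (le_trans (rnormD _ _))// rnormN.
Qed.

Lemma weighted_norm_powRB f g p z : 0 <= p ->
  weighted_norm m beta (f \- g) z `^ p <=
  2 `^ p * (weighted_norm m beta f z `^ p + weighted_norm m beta g z `^ p).
Proof.
move=> p0; apply: le_trans (ler_powRD _ _ p0); rewrite ?weighted_norm_ge0//.
by rewrite ge0_ler_powR ?nnegrE ?addr_ge0 ?weighted_norm_ge0 ?weighted_normB.
Qed.

(** Scheffe's argument applies because the phase decreases under contraction: replacing [N z] by
    [N (r z)] only enlarges the weighted norm of the dilate, and the substitution [r z] then bounds
    its integral by [r^(- 2 d)] times that of [f]. This factor tends to 1. *)
Lemma dilate_approx_integral f (p e : R) : entire f -> 1 <= p -> 0 < e ->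
  (integralC (fun z => (weighted_norm m beta f z `^ p)%:E) < +oo)%E ->
  exists n, (integralC (fun z =>
    (weighted_norm m beta (f \- (fun w => f ((r_ n)%:C *: w))) z `^ p)%:E) < e%:E)%E.
Proof.
move=> fe p1 e0 foo; have p0 : 0 < p by exact: lt_le_trans p1.
have r01 n : 0 < r_ n <= 1 by have /andP[-> /ltW] := @dilation_factor_gt0_lt1 R n.
have re n : entire (fun w => f ((r_ n)%:C *: w)) by exact: entire_scale.
(* The weight is frozen at [z]: only the argument of [f] is dilated, so pointwise convergence is
   continuity of [f] alone. *)
have wc z : rcontinuous (fun w => (rnorm (f w) * expR (- N z)) `^ p).
  have -> : (fun w => (rnorm (f w) * expR (- N z)) `^ p) =
      (fun x => `|x| `^ p) \o (fun w => rnorm (f w) * expR (- N z)).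
    by apply/funext => w /=; rewrite ger0_norm// mulr_ge0 ?rnorm_ge0 ?expR_ge0.
  apply: rcontinuous_comp; last exact: continuous_norm_powR.
  apply: rcontinuousM; last exact: cst_continuous.
  exact: (entire_rcontinuous fe (@rnorm_lipschitz _ _)).
apply: (@ge0_scheffe _ _ _ (@lebesgueC R d)
  (fun n t => weighted_norm m beta (fun w => f ((r_ n)%:C *: w)) (cvec t) `^ p)
  (fun n t => weighted_norm m beta (f \- (fun w => f ((r_ n)%:C *: w))) (cvec t) `^ p)
  (fun t => weighted_norm m beta f (cvec t) `^ p) (2 `^ p)
  (fun n => ((r_ n)^-1 * (r_ n)^-1) ^+ d)).
- by move=> n; exact: measurable_weighted_norm.
- by move=> n; apply: measurable_weighted_norm; exact: entire_sub.
- exact: measurable_weighted_norm.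
- exact: powR_ge0.
- by move=> n t; exact: powR_ge0.
- by move=> t; exact: powR_ge0.
- move=> n t; rewrite powR_ge0 addrC; exact: weighted_norm_powRB (ltW p0).
- move=> t; under eq_fun do rewrite weighted_normE.
  have -> : weighted_norm m beta f (cvec t) `^ p =
      (rnorm (f (cvec t)) * expR (- N (cvec t))) `^ p by rewrite weighted_normE.
  exact: dilate_cvg (wc (cvec t)).
- move=> t; under eq_fun do rewrite weighted_normE.
  have h0 : (fun n => `|rnorm (f (cvec t) - f ((r_ n)%:C *: cvec t)) * expR (- N (cvec t))| `^ p)
      @ \oo --> (`|0 * expR (- N (cvec t))| `^ p : R).
    have := @continuous_norm_powR R p p0 (0 * expR (- N (cvec t))).
    apply: cvg_comp; apply: cvgMl.
    exact: dilate_diff_cvg.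
  move: h0; rewrite mul0r normr0 powR0 ?gt_eqF//.
  by under eq_fun do rewrite ger0_norm ?mulr_ge0 ?rnorm_ge0 ?expR_ge0//.
- exact: foo.
- move=> n; have /andP[r0 r1] := r01 n.
  have <- := @integralC_affine _ _ _ 0 (fun z => (weighted_norm m beta f z `^ p)%:E) r0.
  + apply: ge0_le_integral; first exact: measurableT.
    * by move=> t _; rewrite lee_fin powR_ge0.
    * by apply/measurable_EFinP; exact: measurable_weighted_norm.
    * apply/measurable_EFinP.
      apply: (@measurable_cvec_affine _ _ _ _ _ 0 (fun z => weighted_norm m beta f z `^ p) r0).
      exact: measurable_weighted_norm.
    move=> t _; rewrite lee_fin addr0; apply: ge0_ler_powR.
    * exact: ltW.
    * by rewrite nnegrE weighted_norm_ge0.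
    * by rewrite nnegrE weighted_norm_ge0.
    rewrite !weighted_normE; apply: ler_wpM2l; first exact: rnorm_ge0.
    rewrite ler_expR lerN2; apply: (phase_contract m1 beta0).
    by rewrite (ltW r0).
  + by apply/measurable_EFinP; exact: measurable_weighted_norm.
  + by move=> z; rewrite lee_fin powR_ge0.
- have -> : 1 = (1^-1 * 1^-1) ^+ d :> R by rewrite invr1 mulr1 expr1n.
  have iV : (fun n => (r_ n)^-1) @ \oo --> (1^-1 : R).
    by apply: cvgV; [exact: oner_neq0|exact: dilation_factor_cvg].
  apply: (@cvg_comp _ _ _ (fun n => (r_ n)^-1 * (r_ n)^-1) (fun x => x ^+ d)).
    by apply: cvgM; exact: iV.
  exact: exprn_continuous.
- exact: e0.
Qed.

(* The difference is subcritical for the weight [2 beta], hence uniformly small on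
   balls; outside a large ball both terms are small. *)
Lemma dilate_approx_sup f (e : R) : (1 <= d)%N -> fock_space_infty0 m beta f -> 0 < e ->
  exists n, forall z,
    weighted_norm m beta (f \- (fun w => f ((r_ n)%:C *: w))) z <= e.
Proof.
move=> d1 F0 e0; have [C C0 CP] := fock_space_infty0_growth m1 beta0 d1 F0.
have [fe decay] := F0.
have r01 n : 0 <= r_ n <= 1 by have /andP[/ltW -> /ltW] := @dilation_factor_gt0_lt1 R n.
pose F n := f \- (fun w => f ((r_ n)%:C *: w)).
have Fe n : entire (F n) by apply: entire_sub => //; exact: entire_scale.
have beta20 : 0 < 2 * beta by rewrite mulr_gt0.
have N2 z : phase m (2 * beta) z = 2 * N z by rewrite /phase; field.
have FC n z : rnorm (F n z) <= 2 * C * expR (2^-1 * phase m (2 * beta) z).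
  rewrite N2 mulrA mulVf ?pnatr_eq0// mul1r.
  rewrite (le_trans (rnormD _ _))// rnormN.
  have h : expR (N ((r_ n)%:C *: z)) <= expR (N z).
    by rewrite ler_expR; exact: (phase_contract m1 beta0).
  have -> : 2 * C * expR (N z) = C * expR (N z) + C * expR (N z) by ring.
  by apply: lerD (CP z) (le_trans (CP _) (ler_wpM2l C0 h)).
have half1 : 2^-1 < 1 :> R by rewrite invf_lt1// ltr1n.
have F_0 z : (fun n => rnorm (F n z)) @ \oo --> (0 : R) by exact: dilate_diff_cvg.
have C20 : 0 <= 2 * C by exact: mulr_ge0.
have [M MP] := decay (e / 2) (divr_gt0 e0 (ltr0Sn R 1)).
(* The radius is [2 |M|] because dilation factors are at least [1 / 2]: beyond it both [z] and its
   dilate have norm above [M]. Within it, [B] is the cost of returning from the weight [2 beta] to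
   [beta]. *)
pose B := expR (beta / 2 * (2 * `|M|) `^ (2 * m)).
have B0 : 0 < B by exact: expR_gt0.
have [n nP] := subcritical_seq_sup m1 beta20 Fe C20 half1 FC F_0 (divr_gt0 e0 B0).
exists n => z; have [zM|Mz] := leP (enorm z) (2 * `|M|).
  have := nP n (leqnn n) z; rewrite !weighted_normE N2 => h.
  have -> : rnorm (F n z) * expR (- N z) = rnorm (F n z) * expR (- (2 * N z)) * expR (N z).
    by rewrite -mulrA -expRD; congr (_ * expR _); ring.
  have NB : expR (N z) <= B.
    rewrite ler_expR ler_wpM2l ?divr_ge0 ?(ltW beta0)//.
    by rewrite ge0_ler_powR ?nnegrE ?enorm_ge0 ?mulr_ge0// (le_trans ler01).
  have -> : e = e / B * B by rewrite divfK// gt_eqF.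
  apply: ler_pM; [|exact: expR_ge0|exact: h|exact: NB].
  by apply: mulr_ge0; [exact: rnorm_ge0|exact: expR_ge0].
have zM : M < enorm z.
  by apply: le_lt_trans Mz; rewrite (le_trans (ler_norm M))// ler_peMl// ler1n.
have rzM : M < enorm ((r_ n)%:C *: z).
  have /andP[h1 _] := @dilation_factor_bounds R n.
  rewrite enormZ rnormC ger0_norm; last by have /andP[] := r01 n.
  apply: lt_le_trans (ler_wpM2r (enorm_ge0 z) h1); apply: (le_lt_trans (ler_norm M)).
  by rewrite mulrC ltr_pdivlMr// mulrC.
apply: (le_trans (weighted_normB _ _ _)).
have h3 : weighted_norm m beta (fun w => f ((r_ n)%:C *: w)) z <=
    weighted_norm m beta f ((r_ n)%:C *: z).
  rewrite !weighted_normE; apply: ler_wpM2l; first exact: rnorm_ge0.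
  by rewrite ler_expR lerN2; exact: (phase_contract m1 beta0).
rewrite [leRHS]splitr; apply: lerD; first exact: ltW (MP _ zM).
exact: le_trans h3 (ltW (MP _ rzM)).
Qed.

End DilationApproximation.

(** * Riemann sums of the reproducing formula *)

Lemma continuousZ (R : realType) (V W : normedModType R[i]) (s : V -> R[i]^o) (f : V -> W) :
  continuous s -> continuous f -> continuous (fun v => s v *: f v).
Proof. by move=> sc fc v; apply: cvgZ; [exact: sc|exact: fc]. Qed.

Lemma continuous_conjc (R : realType) (V : normedModType R[i]) (s : V -> R[i]^o) :
  continuous s -> continuous (fun v => conjc (s v) : R[i]^o).
Proof.
move=> sc v; apply/cvgrPdist_lt => /= e e0.
have := sc v => /cvgrPdist_lt/(_ _ e0); apply: filterS => w /=.
have -> : conjc (s v) - conjc (s w) = conjc (s v - s w) by rewrite rmorphB.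
by rewrite !rnormE rnorm_conj.
Qed.

Section KernelField.
Context {R : realType} {d : nat} (m beta : R) {Y : normedModType R[i]}.
Context (K : 'rV[R[i]]_d -> 'rV[R[i]]_d -> R[i]).
Hypotheses (m1 : 1 <= m) (beta0 : 0 < beta) (hK : reproducing_kernel m beta K).
Local Notation N := (@phase R d m beta).
Local Notation c := (fock_const d m beta).
Local Notation rho := (@fock_density R d m beta).
Local Notation leb := (@lebesgueC R d).

Lemma clinear_sub (l : Y -> R[i]) x y : clinear l -> l (x - y) = l x - l y.
Proof. by move=> [lD lZ]; rewrite lD -scaleN1r lZ mulN1r. Qed.

Lemma clinear0 (l : Y -> R[i]) : clinear l -> l 0 = 0.
Proof. by move=> [lD lZ]; rewrite -(scale0r (0 : Y)) lZ mul0r. Qed.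

Lemma entire_functional (l : Y -> R[i]) (g : 'rV[R[i]]_d -> Y) :
  clinear l -> (forall x, rnorm (l x) <= 2 * rnorm x) -> entire g ->
  entire (l \o g : _ -> R[i]^o).
Proof.
move=> lL l2 ge z; have [lD lZ] := lL.
have lP : linear (l : Y -> R[i]^o) by move=> a x y; rewrite lD lZ.
pose L : {linear Y -> R[i]^o} := HB.pack (l : Y -> R[i]^o) (GRing.isLinear.Build _ _ _ _ _ lP).
apply: (@differentiable_comp _ _ _ _ g (L : Y -> R[i]^o)); first exact: ge.
apply: linear_differentiable => x; apply/cvgrPdist_lt => /= e e0.
apply/nbhs_ballP; exists (e / 2) => /=; first exact: divr_gt0.
move=> y; rewrite -ball_normE /ball_/= => xy.
rewrite -(clinear_sub _ _ lL); apply: (@le_lt_trans _ _ (2 * `|x - y|)).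
  have -> : 2 = (2 : R)%:C :> R[i] by rewrite rmorph_nat.
  rewrite !rnormE -rmorphM lecR; exact: l2.
by rewrite mulrC -ltr_pdivlMr.
Qed.

Lemma subcritical_hilbert (f : 'rV[R[i]]_d -> R[i]) (C sigma : R) :
  entire (f : _ -> R[i]^o) -> 0 <= C -> sigma < 1 ->
  (forall z, rnorm (f z) <= C * expR (sigma * N z)) -> fock_hilbert m beta f.
Proof.
move=> fe C0 s1 fC; split => //.
have c0 := fock_const_gt0 m1 hK.
have E z : rnorm (f z) ^+ 2 * rho z = c * weighted_norm m beta (f : _ -> R[i]^o) z `^ 2.
  rewrite powR_mulrn ?weighted_norm_ge0// weighted_normE fock_densityE exprMn -expRM_natl.
  by rewrite mulrN -mulNr mulrCA.
rewrite /integralC; under eq_integral do rewrite E EFinM.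
rewrite ge0_integralZl//.
- rewrite lte_mul_pinfty ?lee_fin ?(ltW c0)//.
  exact: (@subcritical_integral _ _ _ _ (R[i]^o) m1 beta0 f C sigma 2 fe C0 s1 (ltr0n R 2) fC).
- by apply/measurable_EFinP; exact: measurable_weighted_norm.
- by move=> t _; rewrite lee_fin powR_ge0.
- by rewrite lee_fin ltW.
Qed.

Section Field.
Variables (g : 'rV[R[i]]_d -> Y) (C sigma : R) (z : 'rV[R[i]]_d).
Hypotheses (ge : entire g) (C0 : 0 <= C) (s0 : 0 <= sigma) (s1 : sigma < 1).
Hypothesis gC : forall w, rnorm (g w) <= C * expR (sigma * N w).

Definition kernel_field w : Y := K z w *: g w.

Lemma kernel_field_rcontinuous (phi : Y -> R) :
  (forall x y, `|phi x - phi y| <= rnorm (x - y)) -> rcontinuous (phi \o kernel_field).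
Proof.
have -> : kernel_field = (fun w => conjc (K w z) *: g w).
  by apply/funext => w; rewrite /kernel_field (kernel_conj hK).
apply: rcontinuous_lipschitz; apply: (@continuousZ _ _ Y).
  by apply: continuous_conjc => w; exact: differentiable_continuous (kernel_entire hK z w).
by move=> w; exact: differentiable_continuous.
Qed.

(** The scalar function [l g] is subcritical, hence in the Hilbert space, and [kernel_conj] turns
    the conjugated kernel of the inner product into [K z w]. The real part suffices for the norming
    functionals. *)
Lemma kernel_field_functional_reproducing (l : Y -> R[i]) :
  clinear l -> (forall x, rnorm (l x) <= 2 * rnorm x) ->
  complex.Re (l (g z)) =
  fine (integralC (fun w => (rho w * complex.Re (l (kernel_field w)))%:E)).
Proof.
move=> lL l2; have [_ rep] := hK z.
have lH : fock_hilbert m beta (l \o g).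
  apply: (@subcritical_hilbert _ (2 * C) sigma) => //.
  - exact: entire_functional.
  - exact: mulr_ge0.
  - by move=> w; rewrite (le_trans (l2 _))// -mulrA ler_wpM2l.
have /= -> := rep _ lH; rewrite /fock_inner /cintegralC /=; congr fine.
apply: eq_integral => t _; congr EFin.
rewrite /kernel_field (kernel_conj hK z); have [_ ->] := lL.
case: (l _) => a b; case: (K _ _) => a' b' /=; ring.
Qed.

End Field.

Let exponent_bound (a b b' tau sigma A nw nt nz : R) :
  0 <= a -> 0 <= b * b' -> 0 <= tau ^+ 3 + sigma -> nw <= tau * nt + A ->
  a * expR (- 2 * nt) * (b * expR (tau^-1 * nz + tau ^+ 3 * nw) * (b' * expR (sigma * nw))) <=
  a * (b * b' * expR ((tau ^+ 3 + sigma) * A)) * expR (tau^-1 * nz) *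
    expR (- (2 - (tau ^+ 3 + sigma) * tau) * nt).
Proof.
move=> a0 b0 k0 nwt.
rewrite (_ : a * expR (- 2 * nt) * _ = a * (b * b' *
   (expR (- 2 * nt) * expR (tau^-1 * nz + tau ^+ 3 * nw) * expR (sigma * nw)))); last by ring.
rewrite -2![X in _ <= X]mulrA; apply: (ler_wpM2l a0); rewrite -[X in _ <= X]mulrA; apply: (ler_wpM2l b0).
rewrite -!expRD ler_expR; have := ler_wpM2l k0 nwt; lra.
Qed.

(** The density is taken at [t] and the field at a nearby [w], because a Riemann sum evaluates the
    field at the node of the cell containing [t]. Passing from [N w] to [N t] costs a further factor
    [tau], so the integrand decays when [(tau^3 + sigma) * tau < 2]. *)
Lemma kernel_field_bound (g : 'rV[R[i]]_d -> Y) (C sigma r : R) :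
  0 <= C -> 0 <= sigma < 1 -> 0 <= r ->
  (forall w, rnorm (g w) <= C * expR (sigma * N w)) ->
  exists tau C2 eps : R, [/\ 1 < tau, 0 <= C2, 0 < eps & forall z t w, enorm (w - t) <= r ->
    rho t * rnorm (kernel_field g z w) <= C2 * expR (tau^-1 * N z) * expR (- eps * N t)].
Proof.
(* With [tau = 1 + x] and [sigma = 1 - 16 x], the product [(tau^3 + sigma) * tau] equals 2 minus [x]
   times a quantity that is positive for [x <= 1 / 16]. *)
move=> C0 /andP[s0 s1] r0 gC; pose x := (1 - sigma) / 16; pose tau := 1 + x.
have x0 : 0 < x by rewrite divr_gt0// subr_gt0.
have sE : sigma = 1 - 16 * x by rewrite /x; field.
have x1 : x <= 16^-1 by rewrite /x ler_pdivrMr// mulVf ?pnatr_eq0//; lra.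
have tau1 : 1 < tau by rewrite ltrDl.
pose kappa := tau ^+ 3 + sigma.
have kappa0 : 0 <= kappa by rewrite addr_ge0// exprn_ge0// (le_trans ler01)// ltW.
have ktau : kappa * tau < 2.
  rewrite /kappa sE /tau.
  have -> : ((1 + x) ^+ 3 + (1 - 16 * x)) * (1 + x) =
    2 - x * (11 + x * (10 - x * (4 + x))) by ring.
  rewrite ltrBlDr ltrDl mulr_gt0// ltr_wpDr// mulr_ge0 ?(ltW x0)//.
  have : x * (4 + x) <= 16^-1 * (4 + 16^-1).
    by apply: ler_pM => //; [exact: ltW|rewrite addr_ge0// ltW|rewrite lerD2l].
  lra.
have [C1 C10 C1P] := @kernel_decay _ _ _ _ _ m1 beta0 hK _ tau1.
have [A A0 AP] := @phase_add R d m beta m1 beta0 tau r tau1 r0.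
have c0 := fock_const_gt0 m1 hK.
pose C2 := c * (C1 * C * expR (kappa * A)).
exists tau, C2, (2 - kappa * tau); split; [exact: tau1| |by rewrite subr_gt0|].
  apply: mulr_ge0; first exact: ltW.
  by apply: mulr_ge0; [exact: mulr_ge0|exact: expR_ge0].
move=> z t w wt; rewrite /kernel_field rnormZ fock_densityE.
have Nw : N w <= tau * N t + A by have := AP t _ wt; rewrite addrC subrK.
apply: (@le_trans _ _ (c * expR (- 2 * N t) *
    (C1 * expR (tau^-1 * N z + tau ^+ 3 * N w) * (C * expR (sigma * N w))))).
  apply: ler_wpM2l; first by apply: mulr_ge0; [exact: ltW|exact: expR_ge0].
  by apply: ler_pM; [exact: rnorm_ge0|exact: rnorm_ge0|exact: C1P|exact: gC].
rewrite /C2 /kappa; exact: exponent_bound (ltW c0) (mulr_ge0 C10 C0) kappa0 Nw.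
Qed.

End KernelField.

Section RiemannSums.
Context {R : realType} {d : nat} (m beta : R) {Y : normedModType R[i]}.
Context (K : 'rV[R[i]]_d -> 'rV[R[i]]_d -> R[i]).
Hypotheses (m1 : 1 <= m) (beta0 : 0 < beta) (hK : reproducing_kernel m beta K).
Local Notation N := (@phase R d m beta).
Local Notation rho := (@fock_density R d m beta).
Local Notation leb := (@lebesgueC R d).
Variables (g : 'rV[R[i]]_d -> Y) (C sigma : R).
Hypotheses (ge : entire g) (C0 : 0 <= C) (s01 : 0 <= sigma < 1).
Hypothesis gC : forall w, rnorm (g w) <= C * expR (sigma * N w).
Variables (B : 'rV[R[i]]_d -> R) (eps : R).
Hypotheses (eps0 : 0 < eps) (B0 : forall z, 0 <= B z).
Hypothesis GB : forall z t w, enorm (w - t) <= 2 * d%:R ->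
  rho t * rnorm (kernel_field K g z w) <= B z * expR (- eps * N t).
Local Notation G := (kernel_field K g).

Definition cell_mass n (j : @grid_index d n) : R :=
  fine (\int[leb]_t (rho (cvec t) * \1_(grid_cell j) t)%:E)%E.

(** The cell masses are absorbed into the vector coefficients, which gives the sum the shape
    required by [kernel_span]. *)
Definition riemann_sum n z : Y :=
  \sum_(j : @grid_index d n)
    K z (grid_point j) *: ((cell_mass j)%:C *: g (grid_point j)).

(** A scalar majorant of the error. On the grid the first term compares the field with its value at
    the node and the second vanishes; off the grid only the second remains and is the whole tail of
    the integrand. *)
Definition riemann_defect n z t : R :=
  rho (cvec t) * (grid_sum n (fun a => rnorm (G z (cvec t) - G z a)) t +
                  (1 - grid_sum n (fun=> 1) t) * rnorm (G z (cvec t))).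

Let rho_0 t : 0 <= rho t. Proof. exact: (rho_ge0 m1 hK). Qed.

Let diag_bound z t : rho t * rnorm (G z t) <= B z * expR (- eps * N t).
Proof. by apply: GB; rewrite subrr enorm0 mulr_ge0. Qed.

(** The radius [2 * d] in [GB] bounds the distance from a point to the node of its cell for every
    [n]. *)
Let cell_bound n z (j : @grid_index d n) t : grid_cell j t ->
  rho (cvec t) * rnorm (G z (grid_point j)) <= B z * expR (- eps * N (cvec t)).
Proof.
move=> /grid_cell_dist tj; apply: GB; rewrite -enormN opprB (le_trans tj)// mulrC.
by rewrite ler_wpM2r// ler_pdivrMr// ler_peMr// ler1n.
Qed.

Let B2 z t : 0 <= B z * expR (- eps * N t).
Proof. by apply: mulr_ge0; [exact: B0|exact: expR_ge0]. Qed.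

Lemma riemann_defect_bound n z t :
  0 <= riemann_defect n z t <= 2 * B z * expR (- eps * N (cvec t)).
Proof.
rewrite /riemann_defect -mulrA mulr_natl mulr2n.
have [[j tj]|tn] := pselect (exists j : @grid_index d n, grid_cell j t).
  rewrite !(grid_sum_in _ tj) subrr mul0r addr0 mulr_ge0 ?rnorm_ge0//=.
  apply: (@le_trans _ _ (rho (cvec t) * (rnorm (G z (cvec t)) + rnorm (G z (grid_point j))))).
    by rewrite ler_wpM2l// (le_trans (rnormD _ _))// rnormN.
  by rewrite mulrDr; apply: lerD; [exact: diag_bound|exact: cell_bound].
have tn' (j : @grid_index d n) : ~ grid_cell j t by move=> tj; apply: tn; exists j.
rewrite !(grid_sum_notin _ tn') add0r subr0 mul1r mulr_ge0 ?rnorm_ge0//=.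
by apply: (le_trans (diag_bound _ _)); rewrite lerDl.
Qed.

Let dist_rcontinuous z (y : Y) : rcontinuous (fun w => rnorm (y - G z w)).
Proof.
apply: (@kernel_field_rcontinuous _ _ m beta Y K hK g z ge (fun x => rnorm (y - x))).
move=> x x'; apply: (le_trans (rnorm_lipschitz _ _)).
by rewrite opprB addrC addrA subrK -rnormN opprB.
Qed.

Let norm_rcontinuous z : rcontinuous (fun w => rnorm (G z w)).
Proof.
exact: (@kernel_field_rcontinuous _ _ m beta Y K hK g z ge (@rnorm R Y) (@rnorm_lipschitz _ _)).
Qed.

Let measurable_cell n (j : @grid_index d n) : measurable_fun setT (\1_(@grid_cell R d n j) : _ -> R).
Proof. by apply: measurable_indic; exact: measurable_grid_cell. Qed.

Lemma measurable_riemann_defect n z : measurable_fun setT (riemann_defect n z).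
Proof.
apply: measurable_funM; first exact: measurable_rho.
apply: measurable_funD.
  apply: measurable_sum => j; apply: measurable_funM; last exact: measurable_cell.
  apply: (@measurable_cvec_continuous _ _ (fun w => rnorm (G z w - G z (grid_point j)))).
  have := @dist_rcontinuous z (G z (grid_point j)).
  by under eq_fun do rewrite -rnormN opprB.
apply: measurable_funM; last exact: (measurable_cvec_continuous (@norm_rcontinuous z)).
apply: measurable_funB; first exact: measurable_cst.
by apply: measurable_sum => j; apply: measurable_funM => //; exact: measurable_cell.
Qed.

Lemma riemann_defect_cvg z t : (fun n => riemann_defect n z t) @ \oo --> (0 : R).
Proof.
have h1 := @grid_sum_cvg _ _ _ t (@dist_rcontinuous z (G z (cvec t))).
have h2 : (fun n => grid_sum n (fun=> 1 : R) t) @ \oo --> (1 : R).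
  by apply: (@grid_sum_cvg _ _ (fun=> 1)); exact: cst_continuous.
rewrite [X in _ --> X](_ : _ =
  rho (cvec t) * (rnorm (G z (cvec t) - G z (cvec t)) + (1 - 1) * rnorm (G z (cvec t)))).
  apply: cvgMr; apply: cvgD; first exact: h1.
  by apply: cvgMl; apply: cvgB; [exact: cvg_cst|exact: h2].
by rewrite !subrr rnorm0 mul0r addr0 mulr0.
Qed.

Lemma measurable_exp_phase (a : R) : measurable_fun setT (fun t => expR (- a * N (@cvec R d t))).
Proof.
by apply: measurableT_comp => //; apply: measurable_funM => //; exact: measurable_phase.
Qed.

Let integrable_exp_phase (a b : R) : 0 < b ->
  leb.-integrable setT (fun t => (a * expR (- b * N (cvec t)))%:E).
Proof.
move=> b0; under eq_fun do rewrite EFinM; apply: integrableZl => //.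
apply/integrableP; split; first by apply/measurable_EFinP; exact: measurable_exp_phase.
under eq_integral do rewrite gee0_abs ?lee_fin ?expR_ge0//.
exact: phase_integrable.
Qed.

Let integrable_of_bound z (F : d.-tuple (measurableTypeR R * measurableTypeR R) -> R) :
  measurable_fun setT F ->
  (forall t, `|F t| <= 2 * B z * expR (- eps * N (cvec t))) ->
  leb.-integrable setT (EFin \o F).
Proof.
move=> mF FB; apply: (le_integrable _ _ _ (integrable_exp_phase (2 * B z) eps0)) => //.
  exact/measurable_EFinP.
move=> t _; rewrite !abse_EFin lee_fin [leRHS]ger0_norm; first exact: FB.
by rewrite -mulrA mulr_ge0.
Qed.

Let integrable_cell n (j : @grid_index d n) :
  leb.-integrable setT (fun t => (rho (cvec t) * \1_(grid_cell j) t)%:E).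
Proof.
have h := @integrable_exp_phase (fock_const d m beta) 2 (ltr0n _ 2).
apply: (le_integrable _ _ _ h) => //.
  apply/measurable_EFinP; apply: measurable_funM; last exact: measurable_cell.
  exact: measurable_rho.
move=> t _; rewrite !abse_EFin lee_fin -fock_densityE normrM ler_piMr// indicE.
by case: (_ \in _); rewrite ?normr1 ?normr0.
Qed.

(** Each cell indicator integrates against [rho] to the cell mass, so the functional of a Riemann
    sum is the integral of a step function. *)
Let Re_functional_sum n z (l : Y -> R[i]) : clinear l ->
  (complex.Re (l (riemann_sum n z)))%:E =
  (\int[leb]_t (rho (cvec t) * grid_sum n (fun a => complex.Re (l (G z a))) t)%:E)%E.
Proof.
move=> lL; have [lD lZ] := lL; have l0 := clinear0 lL.
under eq_integral => t _.
  rewrite /grid_sum mulr_sumr.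
  under eq_bigr do rewrite mulrCA.
  rewrite -sumEFin; over.
rewrite integral_sum//; last first.
  by move=> j; under eq_fun do rewrite EFinM; exact: integrableZl.
rewrite /riemann_sum (big_morph l lD l0) (raddf_sum (@complex.Re R)) -sumEFin.
apply: eq_bigr => j _; under eq_integral do rewrite EFinM.
rewrite integralZl//= -[X in (_ * X)%E]fineK ?integrable_fin_num//.
rewrite -EFinM -/(cell_mass j) /kernel_field !lZ; congr EFin.
by case: (K _ _) => a b; case: (l _) => a' b' /=; ring.
Qed.

(** For [l] norming the error vector, both [Re (l (g z))] and [Re (l (riemann_sum n z))] are scalar
    integrals against [rho], and [Re (l x) <= ||x||] bounds the difference of the integrands by the
    defect. *)
Lemma riemann_sum_error n z :
  ((rnorm (g z - riemann_sum n z))%:E <= \int[leb]_t (riemann_defect n z t)%:E)%E.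
Proof.
have [l [lL l2 lre <-]] := complex_functional (g z - riemann_sum n z).
have lB x y := clinear_sub x y lL; have l0 := clinear0 lL.
have lRe x : `|complex.Re (l x)| <= rnorm x.
  have lN : l (- x) = - l x by have := lB 0 x; rewrite l0 !sub0r.
  rewrite ler_norml lre andbT lerNl -raddfN -lN -(rnormN x); exact: lre.
have s1 : sigma < 1 by have /andP[] := s01.
have le2 z' t (x : R) : x <= B z' * expR (- eps * N t) -> x <= 2 * B z' * expR (- eps * N t).
  by move=> xB; rewrite -mulrA mulr_natl mulr2n (le_trans xB)// lerDl.
pose A t := rho (@cvec R d t) * complex.Re (l (G z (cvec t))).
pose S t := rho (@cvec R d t) * grid_sum n (fun a => complex.Re (l (G z a))) t.
have iA : leb.-integrable setT (EFin \o A).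
  apply: (@integrable_of_bound z).
    apply: measurable_funM; first exact: measurable_rho.
    apply: (@measurable_cvec_continuous _ _ (fun w => complex.Re (l (G z w)))).
    apply: (@kernel_field_rcontinuous _ _ m beta Y K hK g z ge (fun x => complex.Re (l x))).
    by move=> x y; have := lRe (x - y); rewrite lB raddfB.
  move=> t; apply: le2; rewrite normrM (ger0_norm (rho_0 _)).
  exact: le_trans (ler_wpM2l (rho_0 _) (lRe _)) (diag_bound _ _).
have iS : leb.-integrable setT (EFin \o S).
  apply: (@integrable_of_bound z).
    apply: measurable_funM; first exact: measurable_rho.
    by apply: measurable_sum => j; apply: measurable_funM => //; exact: measurable_cell.
  move=> t; rewrite /S; have [[j tj]|tn] := pselect (exists j : @grid_index d n, grid_cell j t).
    rewrite (grid_sum_in _ tj); apply: le2; rewrite normrM (ger0_norm (rho_0 _)).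
    exact: le_trans (ler_wpM2l (rho_0 _) (lRe _)) (cell_bound _ tj).
  rewrite grid_sum_notin; last by move=> j tj; apply: tn; exists j.
  by rewrite mulr0 normr0; apply: le2.
have iD : leb.-integrable setT (EFin \o riemann_defect n z).
  apply: (@integrable_of_bound z); first exact: measurable_riemann_defect.
  by move=> t; have /andP[h1 h2] := riemann_defect_bound n z t; rewrite ger0_norm.
have lg : (complex.Re (l (g z)))%:E = (\int[leb]_t (A t)%:E)%E.
  rewrite (kernel_field_functional_reproducing m1 beta0 hK z ge C0 s1 gC lL l2).
  by rewrite fineK//; exact: integrable_fin_num.
rewrite lB raddfB EFinB lg Re_functional_sum// -integralB_EFin//.
apply: le_integral => //; first exact: integrableB.
move=> t _; rewrite -EFinB lee_fin /riemann_defect -mulrBr; apply: (ler_wpM2l (rho_0 _)).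
have [[j tj]|tn] := pselect (exists j : @grid_index d n, grid_cell j t).
  by rewrite !(grid_sum_in _ tj) subrr mul0r addr0 -raddfB -lB; exact: lre.
have tn' (j : @grid_index d n) : ~ grid_cell j t by move=> tj; apply: tn; exists j.
by rewrite !(grid_sum_notin _ tn') add0r !subr0 mul1r; exact: lre.
Qed.

End RiemannSums.

Lemma rnorm_sum (R : realType) (Y : normedModType R[i]) (I : Type) (r : seq I) (F : I -> Y) :
  rnorm (\sum_(i <- r) F i) <= \sum_(i <- r) rnorm (F i).
Proof.
elim: r => [|i r IH]; first by rewrite !big_nil rnorm0.
by rewrite !big_cons (le_trans (rnormD _ _))// lerD2l.
Qed.

Section KernelSpan.
Context {R : realType} {d : nat} (m beta : R) {Y : normedModType R[i]}.
Context (K : 'rV[R[i]]_d -> 'rV[R[i]]_d -> R[i]).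
Hypotheses (m1 : 1 <= m) (beta0 : 0 < beta) (hK : reproducing_kernel m beta K).
Implicit Types f g h : 'rV[R[i]]_d -> Y.
Local Notation N := (@phase R d m beta).
Local Notation leb := (@lebesgueC R d).

Lemma kernel_span_entire h : kernel_span K h -> entire h.
Proof.
move=> [n [a [c [_ ->]]]]; rewrite -fct_sumE => z; apply: differentiable_sum => l.
have kd := @kernel_entire _ _ _ _ _ hK (a l) z.
exact: (@differentiableZl _ _ _ (K ^~ (a l) : _ -> R[i]^o) (c l) z kd).
Qed.

(** [kernel_decay] with [tau = 2]: elements of the span are subcritical, hence belong to all the
    spaces. *)
Lemma kernel_span_bound h : kernel_span K h ->
  exists2 C : R, 0 <= C & forall z, rnorm (h z) <= C * expR (2^-1 * N z).
Proof.
move=> [n [a [c [_ ->]]]].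
have [C C0 CP] := @kernel_decay _ _ _ _ _ m1 beta0 hK _ (ltr1n R 2).
exists (\sum_(l < n) C * expR (2 ^+ 3 * N (a l)) * rnorm (c l)).
  apply: sumr_ge0 => l _; apply: mulr_ge0; last exact: rnorm_ge0.
  by apply: mulr_ge0 => //; exact: expR_ge0.
move=> z; rewrite mulr_suml; apply: le_trans (rnorm_sum _ _) _; apply: ler_sum => l _.
rewrite rnormZ mulrAC; apply: ler_wpM2r; first exact: rnorm_ge0.
by rewrite -mulrA -expRD addrC; exact: CP.
Qed.

Lemma riemann_sum_span g n : kernel_span K (riemann_sum m beta K g n).
Proof.
exists #|@grid_index d n|, (fun l => grid_point (enum_val l)),
  (fun l => (cell_mass m beta (enum_val l))%:C *: g (grid_point (enum_val l))).
split.
  by rewrite card_ffun expn_gt0 card_prod card_ord muln_gt0 double_gt0 muln_gt0.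
apply/funext => z; rewrite /riemann_sum.
by rewrite -(big_enum_val (fun j => K z (grid_point j) *: ((cell_mass m beta j)%:C *: g (grid_point j)))).
Qed.

(** The defect has a majorant independent of [n] that splits into [e^(N z / tau)] and an integrable
    function of [t]. Its integral gives the uniform bound with [sigma' = 1 / tau], and dominated
    convergence in [t] gives the pointwise limit. *)
Lemma riemann_sum_approx g (C sigma : R) :
  entire g -> 0 <= C -> 0 <= sigma < 1 -> (forall z, rnorm (g z) <= C * expR (sigma * N z)) ->
  exists C' sigma' : R, [/\ 0 <= C', sigma' < 1,
    forall n z, rnorm (g z - riemann_sum m beta K g n z) <= C' * expR (sigma' * N z) &
    forall z, (fun n => rnorm (g z - riemann_sum m beta K g n z)) @ \oo --> (0 : R)].
Proof.
move=> ge C0 s01 gC; have d20 : 0 <= 2 * d%:R :> R by exact: mulr_ge0.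
have [tau [C2 [eps [tau1 C20 eps0 GB]]]] :=
  kernel_field_bound m1 beta0 hK C0 s01 d20 gC.
pose B z := C2 * expR (tau^-1 * N z).
have B0 z : 0 <= B z by apply: mulr_ge0 => //; exact: expR_ge0.
have err := riemann_sum_error m1 beta0 hK ge C0 s01 gC eps0 B0 GB.
have Dle := riemann_defect_bound m1 hK B0 GB.
have mD n z := measurable_riemann_defect hK ge n z.
have mE : measurable_fun setT (fun t => expR (- eps * N (@cvec R d t))).
  exact: measurable_exp_phase.
pose J := (\int[leb]_t (expR (- eps * N (cvec t)))%:E)%E.
have Joo : (J < +oo)%E by exact: phase_integrable.
have J0 : (0 <= J)%E by apply: integral_ge0 => t _; rewrite lee_fin expR_ge0.
have JE : J = (fine J)%:E by rewrite fineK// ge0_fin_numE.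
have dom z : (\int[leb]_t (2 * B z * expR (- eps * N (cvec t)))%:E = (2 * B z * fine J)%:E)%E.
  under eq_integral do rewrite EFinM.
  rewrite ge0_integralZl//.
  - by rewrite -/J JE -EFinM.
  - exact/measurable_EFinP.
  - by rewrite lee_fin mulr_ge0.
exists (2 * C2 * fine J), tau^-1; split.
- by apply: mulr_ge0; [exact: mulr_ge0|exact: fine_ge0].
- by rewrite invf_lt1// (lt_trans ltr01).
- move=> n z; rewrite -lee_fin; apply: (le_trans (err n z)).
  have -> : 2 * C2 * fine J * expR (tau^-1 * N z) = 2 * B z * fine J by rewrite /B; ring.
  rewrite -dom; apply: ge0_le_integral; first exact: measurableT.
  + by move=> t _; rewrite lee_fin; have /andP[] := Dle n z t.
  + exact/measurable_EFinP.
  + by apply/measurable_EFinP; apply: measurable_funM.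
  + by move=> t _; rewrite lee_fin; have /andP[] := Dle n z t.
move=> z; apply/cvgrPdist_lt => /= e e0.
have [n0 n0P] : exists n0, forall n, (n0 <= n)%N ->
    (\int[leb]_t (riemann_defect m beta K g n z t)%:E < e%:E)%E.
  apply: (ge0_dominated_to0 (G := fun t => 2 * B z * expR (- eps * N (cvec t))) _ _ _ _ _ e0).
  - by move=> n; exact: mD.
  - by apply: measurable_funM.
  - by move=> n t; exact: Dle.
  - by rewrite dom ltry.
  - by move=> t; exact: (riemann_defect_cvg hK ge).
exists n0 => // n /n0P /=; rewrite sub0r normrN ger0_norm ?rnorm_ge0// => h.
by rewrite -lte_fin; exact: le_lt_trans (err n z) h.
Qed.

End KernelSpan.

(** * Density in the two families of norms *)

Section Density.
Context {R : realType} {d : nat} (m beta : R) {Y : normedModType R[i]}.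
Context (K : 'rV[R[i]]_d -> 'rV[R[i]]_d -> R[i]).
Hypotheses (d1 : (1 <= d)%N) (m1 : 1 <= m) (beta0 : 0 < beta).
Hypothesis hK : reproducing_kernel m beta K.
Implicit Types f g h : 'rV[R[i]]_d -> Y.
Local Notation N := (@phase R d m beta).

Lemma riemann_sum_approx_integral g (C sigma p e : R) :
  entire g -> 0 <= C -> 0 <= sigma < 1 -> (forall z, rnorm (g z) <= C * expR (sigma * N z)) ->
  1 <= p -> 0 < e -> exists2 h, kernel_span K h &
    (integralC (fun z => (weighted_norm m beta (g \- h) z `^ p)%:E) < e%:E)%E.
Proof.
move=> ge C0 s01 gC p1 e0.
have [C' [s' [C'0 s'1 bd cv]]] := riemann_sum_approx m1 beta0 hK ge C0 s01 gC.
have Fe n : entire (g \- riemann_sum m beta K g n).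
  by apply: entire_sub => //; exact: (kernel_span_entire hK (riemann_sum_span m beta K g n)).
have [n nP] := subcritical_seq_integral m1 beta0 Fe C'0 s'1 bd cv p1 e0.
by exists (riemann_sum m beta K g n); [exact: riemann_sum_span|exact: nP].
Qed.

Lemma riemann_sum_approx_sup g (C sigma e : R) :
  entire g -> 0 <= C -> 0 <= sigma < 1 -> (forall z, rnorm (g z) <= C * expR (sigma * N z)) ->
  0 < e -> exists2 h, kernel_span K h & forall z, weighted_norm m beta (g \- h) z <= e.
Proof.
move=> ge C0 s01 gC e0.
have [C' [s' [C'0 s'1 bd cv]]] := riemann_sum_approx m1 beta0 hK ge C0 s01 gC.
have Fe n : entire (g \- riemann_sum m beta K g n).
  by apply: entire_sub => //; exact: (kernel_span_entire hK (riemann_sum_span m beta K g n)).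
have [n nP] := subcritical_seq_sup m1 beta0 Fe C'0 s'1 bd cv e0.
by exists (riemann_sum m beta K g n); [exact: riemann_sum_span|exact: nP].
Qed.

Lemma weighted_norm_triangle f g h z : weighted_norm m beta (f \- h) z <=
  weighted_norm m beta (f \- g) z + weighted_norm m beta (g \- h) z.
Proof.
rewrite !weighted_normE -mulrDl; apply: ler_wpM2r; first exact: expR_ge0.
by rewrite /= -[f z - h z](subrKA (g z)) rnormD.
Qed.

Lemma dense_fock_space (p : R) : 1 <= p ->
  dense_for (fock_norm m beta p) (fock_space m beta p) (kernel_span (Y := Y) K).
Proof.
move=> p1; have p0 : 0 < p by exact: lt_le_trans p1.
have c0 := fock_const_gt0 m1 hK.
have half1 : 2^-1 < 1 :> R by rewrite invf_lt1// ltr1n.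
split=> [h Vh|f Ff e e0].
  have he := kernel_span_entire hK Vh.
  have [C C0 hC] := kernel_span_bound m1 beta0 hK Vh.
  split=> //; rewrite lte_mul_pinfty ?lee_fin ?(ltW c0)//.
  exact: (subcritical_integral m1 beta0 he C0 half1 p0 hC).
have [fe foo] := Ff; have fint := EFin_gt0_muley c0 foo.
(* Chosen so that [fock_const d m beta * 2 ^ p * (e1 + e1) = e ^ p]: [e1] bounds the dilation error
   and the Riemann sum error, and [2 ^ p] comes from the power of a sum. *)
pose e1 := e `^ p / fock_const d m beta / (2 `^ p * 2).
have p20 : 0 < 2 `^ p * 2 :> R by rewrite mulr_gt0// powR_gt0.
have e10 : 0 < e1 by rewrite !divr_gt0// powR_gt0.
have [n fn] := dilate_approx_integral m1 beta0 fe p1 e10 fint.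
set g := (fun w => f ((dilation_factor n)%:C *: w)) in fn.
have ge : entire g by exact: entire_scale.
have fg tau (tau1 : 1 < tau) := fock_space_growth m1 beta0 c0 p1 tau1 Ff.
have [C [s [C0 s01 gC]]] := dilate_subcritical m1 (dilation_factor_gt0_lt1 n) fg.
have [h Vh gh] := riemann_sum_approx_integral ge C0 s01 gC p1 e10.
have he := kernel_span_entire hK Vh.
exists h; split=> //.
pose I1 := integralC (fun z => (weighted_norm m beta (f \- g) z `^ p)%:E).
pose I2 := integralC (fun z => (weighted_norm m beta (g \- h) z `^ p)%:E).
have I12 : (integralC (fun z => (weighted_norm m beta (f \- h) z `^ p)%:E) <=
    (2 `^ p)%:E * (I1 + I2))%E.
  have mw u v : entire u -> entire v ->
      measurable_fun setT (fun t => (weighted_norm m beta (u \- v : _ -> Y) (@cvec R d t) `^ p)%:E).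
    by move=> ue ve; apply/measurable_EFinP; apply: measurable_weighted_norm; exact: entire_sub.
  have w0 u t : [set: d.-tuple (measurableTypeR R * measurableTypeR R)] t ->
      (0 <= (weighted_norm m beta (u : _ -> Y) (cvec t) `^ p)%:E)%E.
    by rewrite lee_fin powR_ge0.
  have mfg := mw _ _ fe ge; have mgh := mw _ _ ge he.
  rewrite /I1 /I2 /integralC -(ge0_integralD _ measurableT (w0 _) mfg (w0 _) mgh).
  rewrite -(ge0_integralZl _ measurableT); first last.
  - by rewrite lee_fin powR_ge0.
  - by move=> t tT; apply: adde_ge0; exact: w0.
  - exact: emeasurable_funD.
  apply: ge0_le_integral; first exact: measurableT.
  - by move=> t _; rewrite lee_fin powR_ge0.
  - exact: mw.
  - by apply: measurable_funeM; apply: emeasurable_funD; exact: mw.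
  move=> t _; rewrite -EFinD -EFinM lee_fin; apply: le_trans (ler_powRD _ _ (ltW p0)).
  - apply: ge0_ler_powR; rewrite ?nnegrE ?addr_ge0 ?weighted_norm_ge0 ?(ltW p0)//.
    exact: weighted_norm_triangle.
  - exact: weighted_norm_ge0.
  - exact: weighted_norm_ge0.
have Ilt : (integralC (fun z => (weighted_norm m beta (f \- h) z `^ p)%:E) <
    (e `^ p / fock_const d m beta)%:E)%E.
  apply: (le_lt_trans I12); have -> : e `^ p / fock_const d m beta = 2 `^ p * (e1 + e1).
    by rewrite /e1; field; rewrite !gt_eqF// powR_gt0.
  rewrite EFinM EFinD lte_pmul2l; first exact: lteD fn gh.
    by [].
  by rewrite lte_fin powR_gt0.
rewrite /fock_norm /fock_normp.
set I := integralC _ in Ilt *.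
have I0 : (0 <= I)%E by apply: integral_ge0 => t _; rewrite lee_fin powR_ge0.
have Ifin : I \is a fin_num by rewrite (ge0_fin_numE I0); exact: lt_le_trans Ilt (leey _).
have IE : I = (fine I)%:E by rewrite (fineK Ifin).
move: Ilt; rewrite IE lte_fin => Ilt; rewrite -EFinM poweR_EFin lte_fin.
have -> : e = (e `^ p) `^ p^-1 by rewrite -powRrM mulfV ?gt_eqF// powRr1// ltW.
have fI0 : 0 <= fine I by exact: fine_ge0.
apply: gt0_ltr_powR; rewrite ?invr_gt0// ?nnegrE ?powR_ge0//.
  by apply: mulr_ge0 => //; exact: ltW.
by rewrite mulrC -ltr_pdivlMr.
Qed.

Lemma dense_fock_space_infty0 :
  dense_for (fock_norm_infty m beta) (fock_space_infty0 m beta) (kernel_span (Y := Y) K).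
Proof.
have half1 : 2^-1 < 1 :> R by rewrite invf_lt1// ltr1n.
split=> [h Vh|f Ff e e0].
  have he := kernel_span_entire hK Vh.
  have [C C0 hC] := kernel_span_bound m1 beta0 hK Vh.
  split=> // eps eps0; have [M MP] := @subcritical_vanishing R d m beta Y m1 beta0 _ _ C0 half1 _ eps0.
  by exists M => z Mz; exact: MP Mz (hC z).
(* Two errors of [e / 4] give a supremum of at most [e / 2], which restores the strict
   inequality. *)
have e40 : 0 < e / 4 by exact: divr_gt0.
have fe : entire f by have [] := Ff.
have [n fn] := dilate_approx_sup m1 beta0 d1 Ff e40.
set g := (fun w => f ((dilation_factor n)%:C *: w)) in fn.
have ge : entire g by exact: entire_scale.
have fg tau : 1 < tau ->
    exists2 C : R, 0 <= C & forall z, rnorm (f z) <= C * expR (tau * N z).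
  move=> tau1; have [C C0 fC] := fock_space_infty0_growth m1 beta0 d1 Ff.
  exists C => // z; apply: (le_trans (fC z)); apply: (ler_wpM2l C0).
  by rewrite ler_expR ler_peMl ?phase_ge0// ltW.
have [C [s [C0 s01 gC]]] := dilate_subcritical m1 (dilation_factor_gt0_lt1 n) fg.
have [h Vh gh] := riemann_sum_approx_sup ge C0 s01 gC e40.
exists h; split=> //; apply: (@le_lt_trans _ _ (e / 2)%:E).
  apply: ge_ereal_sup => _ [z _ <-]; rewrite lee_fin.
  apply: (le_trans (weighted_norm_triangle f g h z)).
  have -> : e / 2 = e / 4 + e / 4 by field.
  by apply: lerD; [exact: fn|exact: gh].
by rewrite lte_fin ltr_pdivrMr// ltr_pMr// ltr1n.
Qed.

End Density.

Theorem proposition11 (R : realType) (d : nat) (m beta : R)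
    (Y : completeNormedModType R[i])
    (K : 'rV[R[i]]_d -> 'rV[R[i]]_d -> R[i]) :
  (1 <= d)%N -> 1 <= m -> 0 < beta ->
  reproducing_kernel m beta K ->
  (forall p : R, 1 <= p ->
     dense_for (fock_norm m beta p) (fock_space m beta p)
       (kernel_span (Y := Y) K)) /\
  dense_for (fock_norm_infty m beta) (fock_space_infty0 m beta)
    (kernel_span (Y := Y) K).
Proof.
move=> d1 m1 beta0 hK; split=> [p p1|].
  exact: (dense_fock_space m1 beta0 hK p1).
exact: (dense_fock_space_infty0 d1 m1 beta0 hK).
Qed.
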